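(* The integral $I_N$ satisfies the $(N-1)$-th order linear, partial $q$-difference equation $$I_N(a_1,\ldots,a_{2N})=\sum_{i=1}^{N-1} b_i\, I_N(a_1,\ldots,a_{i-1},q^{-1}a_i,a_{i+1},\ldots,a_{2N}),$$ where $$b_i=\frac{\prod_{m=N}^{2N}(1-q^{-1}a_ia_m)}{(1-q^{1-N}a_1a_2\cdots a_{2N})\prod_{1\le j\le N-1,\ j\ne i}(1-a_ia_j^{-1})}.$$ Or equivalently, using the replacements $a_i\mapsto qa_i$ ($1\le i\le N-1$) in this equation, $$I_N(qa_1,\ldots,qa_{N-1},a_N,\ldots,a_{2N})=\sum_{i=1}^{N-1}c_i\, I_N(qa_1,\ldots,qa_{i-1},a_i,qa_{i+1},\ldots,qa_{N-1},a_N,\ldots,a_{2N}),$$ where the coefficient $c_i$ is $$c_i=\frac{\prod_{m=N}^{2N}(1-a_ia_m)}{(1-a_1a_2\cdots a_{2N})\prod_{1\le j\le N-1,\ j\ne i}(1-a_ia_j^{-1})}.$$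
   Context: Let $N\ge 2$ be an integer and $|q|<1$. Notation: $(a;q)_\infty=\prod_{k\ge0}(1-aq^k)$, $(az^{\pm1};q)_\infty=(az;q)_\infty(az^{-1};q)_\infty$, $(z^{\pm N};q^{N/2})_\infty=(z^{N};q^{N/2})_\infty(z^{-N};q^{N/2})_\infty$. The parameters of $I_N$ are $a_j=q^{s_j}$ with $|a_j|<1$. Put $$\Phi(z)=\frac{z-z^{-1}}{z^{N/2}-z^{-N/2}}\,\frac{(z^{\pm N};q^{N/2})_\infty}{\prod_{j=1}^{2N}(a_jz^{\pm1};q)_\infty},\qquad I_N=I_N(a_1,\ldots,a_{2N})=\int_C\frac{dz}{2\pi\sqrt{-1}\,z}\,\Phi(z).$$ For $N$ even, $C$ is the unit circle $\mathbb T$ traversed anticlockwise. For $N$ odd, the integrand has a branch cut, conventionally taken to be $(-\infty,0)$, and $C=\mathbb T\cup\mathbb H$ is a contour of Hankel type with a tail $\mathbb H$, starting at $\infty e^{-\pi i}$ and finishing at $\infty e^{+\pi i}$; the tail contributes an integral over $[1,\infty)$, which (using an asymptotic expansion of the integrand valid for $|\arg(a_j)|\le\pi$) converges under the additional condition $\sum_{j=1}^{2N}\mathrm{Re}(s_j)<N-1$.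
   Formalization: For N odd |a_j|<1 in all integrals contradicts convergence, so T is deformed (a graph in the angle) to separate the poles a_j q^k from their inverses; a_j is off the cut; if q is not positive real the tail runs along -q^(-v), with Re(s_j) read as log|a_j|/log|q|. *)

(* Defs.v *)
From Stdlib Require Import Reals Lra Lia List Arith.
From Coquelicot Require Import Coquelicot.
Open Scope C_scope.

Definition Cexp (w : C) : C :=
  ((exp (Re w) * cos (Im w))%R, (exp (Re w) * sin (Im w))%R).

Definition Cprod (l : list nat) (f : nat -> C) : C :=
  fold_right (fun k p => f k * p) 1 l.

(* (a;p)_oo, meant for |p| < 1; the limit is taken on real and imaginary
   parts. *)
Definition qpoch (a p : C) : C :=
  let P n := Cprod (seq 0 n) (fun k => 1 - a * p ^ k) in
  (real (Lim_seq (fun n => Re (P n))), real (Lim_seq (fun n => Im (P n)))).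

(* q^x, for the branch logq of log q. *)
Definition qpow (logq x : C) : C := Cexp (x * logq).

(* |q^x| = |q|^(rexp logq x); see rexp_real for q in (0,1). *)
Definition rexp (logq x : C) : R := (Re (x * logq) / Re logq)%R.

(* Phi as a function of w = log z on the covering of the punctured plane, so
   that z^x is Cexp (x * w) and dz/z is dw.  Where z^N = 1 the quotient is read
   as 0, which is also its limit since (z^(+-N); q^(N/2))_oo has a double zero
   there. *)
Definition Phi (N : nat) (logq : C) (a : nat -> C) (w : C) : C :=
  let h := RtoC (INR N / 2) in
  let q := Cexp logq in
  let p := qpow logq h in
  let z := Cexp w in
  (z - / z) / (Cexp (h * w) - Cexp (- (h * w)))
  * (qpoch (z ^ N) p * qpoch (/ (z ^ N)) p
     / Cprod (seq 1 (2 * N)) (fun j => qpoch (a j * z) q * qpoch (a j / z) q)).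

(* log z at z = e^(i t) q^(-v).  For q in (0,1) and logq real, (t, v) are polar
   coordinates with |z| = q^(-v), and t = PI, t = -PI are the two sides of the
   cut (-oo,0); in general the cut is { - q^(-v) : v real }, the curve through
   -1 that is invariant under z |-> q z. *)
Definition logpt (logq : C) (t v : R) : C := Ci * t - v * logq.

(* The curve t |-> e^(i t) q^(-u t), t in [-PI, PI], run anticlockwise, that
   plays the role of the unit circle; the unit circle itself is u = 0. *)
Definition circuit (u : R -> R) : Prop :=
  (forall t : R, ex_derive u t /\ continuous (Derive u) t) /\ u (- PI)%R = u PI.

Definition on_circuit (logq : C) (u : R -> R) (F : C -> C) : C :=
  RInt (V := C_R_CompleteNormedModule)
    (fun t => F (logpt logq t (u t)) * (Ci - Derive u t * logq)) (- PI) PI.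

(* Integral of F dw along the side t of the cut (t = PI or t = -PI), from the
   end of the circuit out to infinity. *)
Definition on_tail (logq : C) (u : R -> R) (F : C -> C) (t : R) : C :=
  RInt_gen (V := C_R_CompleteNormedModule)
    (fun v => F (logpt logq t v) * (- logq))
    (at_point (u t)) (Rbar_locally p_infty).

(* The tail comes in along t = -PI and goes out along t = PI. *)
Definition IN (N : nat) (logq : C) (u : R -> R) (a : nat -> C) : C :=
  let F := Phi N logq a in
  (on_circuit logq u F
   + (if Nat.odd N then on_tail logq u F PI - on_tail logq u F (- PI) else 0))
  / (2 * PI * Ci).

(* The circuit has the points a_j q^k inside and the points a_j^(-1) q^(-k)
   outside, where a_j = q^(s j) and k >= 0.  On the unit circle this is
   |a_j| < 1, see separates_unit_circle. *)
Definition separates (N : nat) (logq : C) (u : R -> R) (s : nat -> C) : Prop :=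
  forall (j k : nat) (t v : R), (1 <= j <= 2 * N)%nat -> (- PI <= t <= PI)%R ->
    (Cexp (logpt logq t v) = qpow logq (s j + INR k) -> (v < u t)%R) /\
    (Cexp (logpt logq t v) = qpow logq (- (s j + INR k)) -> (u t < v)%R).

(* The parameters a_j = q^(s j) for which I_N is considered.  For N odd the
   tail must converge, and must not run through the poles a_j^(-1) q^(-k).
   Since the shifts move N-1 of the s j by 1, for N odd the integrals in one
   equation cannot all satisfy both |a_j| < 1 (i.e. rexp (s j) > 0) and
   sum_j rexp (s j) < N-1; hence the circuit is not fixed to be the unit
   circle. *)
Definition admissible (N : nat) (logq : C) (u : R -> R) (s : nat -> C) : Prop :=
  separates N logq u s /\
  (Nat.odd N = true ->
     (sum_n_m (fun j => rexp logq (s j)) 1 (2 * N) < INR N - 1)%R /\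
     (forall (j : nat) (v : R), (1 <= j <= 2 * N)%nat ->
        qpow logq (s j) <> - qpow logq v)).

Definition upd (f : nat -> C) (i : nat) (x : C) (j : nat) : C :=
  if Nat.eqb j i then x else f j.

(* x on the indices 1, ..., N-1 and y on N, ..., 2N. *)
Definition head_tail (N : nat) (x y : nat -> C) (j : nat) : C :=
  if Nat.ltb j N then x j else y j.

Definition others (N i : nat) : list nat :=
  filter (fun j => negb (Nat.eqb j i)) (seq 1 (N - 1)).

Definition b_coef (N : nat) (q : C) (a : nat -> C) (i : nat) : C :=
  Cprod (seq N (N + 1)) (fun m => 1 - / q * a i * a m)
  / ((1 - / (q ^ (N - 1)) * Cprod (seq 1 (2 * N)) a)
     * Cprod (others N i) (fun j => 1 - a i * / a j)).

Definition c_coef (N : nat) (a : nat -> C) (i : nat) : C :=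
  Cprod (seq N (N + 1)) (fun m => 1 - a i * a m)
  / ((1 - Cprod (seq 1 (2 * N)) a)
     * Cprod (others N i) (fun j => 1 - a i * / a j)).

Lemma rexp_real (logq x : C) :
  Re logq <> 0%R -> Im logq = 0%R -> rexp logq x = Re x.
Proof.
destruct logq as [l m], x as [x y]; unfold rexp, Re, Im; simpl; intros Hl ->.
now field.
Qed.

Lemma Cmod_Cexp (w : C) : Cmod (Cexp w) = exp (Re w).
Proof.
unfold Cmod, Cexp; simpl.
replace (_ + _)%R with (exp (Re w) * exp (Re w))%R.
- apply sqrt_square, Rlt_le, exp_pos.
- pose proof (sin2_cos2 (Im w)) as H; unfold Rsqr in H.
  transitivity (exp (Re w) * exp (Re w)
    * (sin (Im w) * sin (Im w) + cos (Im w) * cos (Im w)))%R; [rewrite H|]; ring.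
Qed.

Lemma separates_unit_circle (N : nat) (logq : C) (s : nat -> C) :
  Cmod (Cexp logq) < 1 ->
  (forall j, (1 <= j <= 2 * N)%nat -> Cmod (qpow logq (s j)) < 1) ->
  separates N logq (fun _ => 0%R) s.
Proof.
rewrite Cmod_Cexp; intros Hq Hs j k t v Hj _.
assert (H1 : forall x, (exp x < 1)%R -> (x < 0)%R).
{ intros x Hx; apply exp_lt_inv; now rewrite exp_0. }
apply H1 in Hq; specialize (Hs j Hj).
unfold qpow in *; rewrite Cmod_Cexp in Hs; apply H1 in Hs.
assert (Hv : Re (logpt logq t v) = (- v * Re logq)%R).
{ destruct logq; unfold logpt, Re; simpl; ring. }
assert (Hk : Re ((s j + INR k) * logq)
             = (Re (s j * logq) + INR k * Re logq)%R).
{ destruct logq, (s j); unfold Re; simpl; ring. }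
assert (Hn : Re (- (s j + INR k) * logq)
             = (- (Re (s j * logq) + INR k * Re logq))%R).
{ destruct logq, (s j); unfold Re; simpl; ring. }
assert (Hk0 := pos_INR k).
split; intros H; apply (f_equal Cmod) in H; rewrite !Cmod_Cexp in H;
  apply exp_inv in H; rewrite Hv, ?Hn, ?Hk in H; nra.
Qed.

(* Main.v *)
Require Import Defs.
From Stdlib Require Import Reals List Arith Lra Lia FunctionalExtensionality ClassicalEpsilon.
From Coquelicot Require Import Coquelicot.
Open Scope C_scope.

(** The integrand Phi and each of its versions with one a_i replaced by a_i / q differ by a
    rational factor in z, and the equation holds because the combination
    Phi - sum_i b_i Phi_i is a q-difference h(z) - h(q z) up to a constant.

    The function h comes from the quasi-periodicity of the integrand.  Write
    Phi = (z - 1/z) W.  The theta function contained in W makes W(q z) / W(z) equal to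
    q^(-N) z^(-2N) times a quotient of products of linear factors in z and 1/z.  Put c_i = a_i / q and
    h(z) = W(z) z^N prod_(m >= N) (1 - a_m / z) / prod_(i < N) (1 - c_i z).  Then the cofactor of W
    in h(q z) is that in h(z) with z replaced by 1/z.  The difference h(z) - h(q z) is thus W times
    an expression antisymmetric under z -> 1/z, and this expression divided by z - 1/z has
    a partial fraction expansion in 1 / ((1 - c_i z)(1 - c_i / z)) with constant term
    proportional to 1 - q^(1-N) a_1 ... a_2N.  The coefficients are proportional to the
    b_i with the same factor
    ([inner_factor_antisym], [integrand_difference]).

    It remains to see that the contour integral of h(z) - h(q z) vanishes ([shift_contour]).
    The separation hypotheses on the shifted parameters say that h is holomorphic
    between the circuit and its image under z -> q z, so Cauchy's theorem
    ([cauchy_strip]) reduces the circuit integral to the integrals of h across this strip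
    on the two sides of the cut.  For N even h is single-valued and these cancel.  For N odd the
    integrals of h(z) - h(q z) over the two tails telescope to the same integrals with the opposite
    sign, because h decays at infinity ([tail_difference], [integrand_decays]): its
    ratio under z -> z / q tends to a number of modulus less than 1, which is the convergence
    condition on the exponents s_j.

    The analytic input is that (x; q)_oo is holomorphic in x and vanishes only at the
    zeros of its factors ([holo_qpoch], [qpoch_neq_0]).  The second equation
    is the first one for the parameters q a_1, ..., q a_(N-1), a_N, ..., a_2N. *)

(** * The exponential, continuity and finite products *)
Lemma C_ext (x y : C) : Re x = Re y -> Im x = Im y -> x = y.
Proof. destruct x, y; simpl; intros; subst; reflexivity. Qed.

Lemma Cexp_plus (x y : C) : Cexp (x + y) = Cexp x * Cexp y.
Proof.
destruct x as [a b], y as [c d]; unfold Cexp; apply C_ext; simpl;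
  rewrite exp_plus, ?cos_plus, ?sin_plus; ring.
Qed.

Lemma Cexp_0 : Cexp 0 = 1.
Proof. unfold Cexp; apply C_ext; simpl; rewrite exp_0, ?cos_0, ?sin_0; ring. Qed.

Lemma Cexp_neq_0 (x : C) : Cexp x <> 0.
Proof. apply Cmod_gt_0; rewrite Cmod_Cexp; apply exp_pos. Qed.

Lemma Cexp_opp (x : C) : Cexp (- x) = / Cexp x.
Proof.
pose proof (Cexp_neq_0 x) as H.
assert (E : Cexp x * Cexp (- x) = 1).
{ rewrite <- Cexp_plus, Cplus_opp_r; apply Cexp_0. }
replace (Cexp (- x)) with (/ Cexp x * (Cexp x * Cexp (- x))) by (field; exact H).
rewrite E; ring.
Qed.

Lemma Cexp_INR (n : nat) (x : C) : Cexp (INR n * x) = Cexp x ^ n.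
Proof.
induction n as [|n IH].
- simpl; rewrite <- Cexp_0; f_equal; ring.
- rewrite S_INR, Cpow_S, <- IH, <- Cexp_plus; f_equal; rewrite RtoC_plus; ring.
Qed.

Lemma continuous_C_pair {T : UniformSpace} (f g : T -> R) (x : T) :
  continuous f x -> continuous g x -> continuous (fun y => (f y, g y) : C) x.
Proof. intros Hf Hg; apply (continuous_comp_2 f g (fun a b => (a, b) : C));
 auto. apply filterlim_ext with (fun p => p); [intros [a b]; reflexivity|]. apply filterlim_id. Qed.

Lemma continuous_Re {T : UniformSpace} (f : T -> C) (x : T) :
  continuous f x -> continuous (fun y => Re (f y)) x.
Proof. intros H; apply (continuous_comp f Re); [exact H|]. destruct (f x); apply continuous_fst. Qed.

Lemma continuous_Im {T : UniformSpace} (f : T -> C) (x : T) :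
  continuous f x -> continuous (fun y => Im (f y)) x.
Proof. intros H; apply (continuous_comp f Im); [exact H|]. destruct (f x); apply continuous_snd. Qed.

Lemma continuous_RtoC {T : UniformSpace} (f : T -> R) (x : T) :
  continuous f x -> continuous (fun y => RtoC (f y)) x.
Proof. intros H; apply continuous_C_pair; [exact H|apply continuous_const]. Qed.

Lemma continuous_Cplus {T : UniformSpace} (f g : T -> C) (x : T) :
  continuous f x -> continuous g x -> continuous (fun y => f y + g y) x.
Proof. exact (continuous_plus (V := C_R_NormedModule) f g x). Qed.

Lemma continuous_Copp {T : UniformSpace} (f : T -> C) (x : T) :
  continuous f x -> continuous (fun y => - f y) x.
Proof. exact (continuous_opp (V := C_R_NormedModule) f x). Qed.

Lemma continuous_Cminus {T : UniformSpace} (f g : T -> C) (x : T) :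
  continuous f x -> continuous g x -> continuous (fun y => f y - g y) x.
Proof. exact (continuous_minus (V := C_R_NormedModule) f g x). Qed.

Lemma continuous_Rmult {T : UniformSpace} (f g : T -> R) (x : T) :
  continuous f x -> continuous g x -> continuous (fun y => (f y * g y)%R) x.
Proof. exact (continuous_mult (K := R_AbsRing) f g x). Qed.

Lemma continuous_Cmult {T : UniformSpace} (f g : T -> C) (x : T) :
  continuous f x -> continuous g x -> continuous (fun y => f y * g y) x.
Proof.
intros Hf Hg.
pose proof (continuous_Re _ _ Hf). pose proof (continuous_Im _ _ Hf).
pose proof (continuous_Re _ _ Hg). pose proof (continuous_Im _ _ Hg).
apply continuous_C_pair.
- apply (continuous_minus (V := R_NormedModule)); now apply continuous_Rmult.
- apply (continuous_plus (V := R_NormedModule)); now apply continuous_Rmult.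
Qed.

Lemma continuous_Cinv {T : UniformSpace} (f : T -> C) (x : T) :
  f x <> 0 -> continuous f x -> continuous (fun y => / f y) x.
Proof.
intros H0 Hf.
pose proof (continuous_Re _ _ Hf) as H1. pose proof (continuous_Im _ _ Hf) as H2.
assert (H3 : continuous (fun y => / (Re (f y) ^ 2 + Im (f y) ^ 2))%R x).
{ apply (continuous_comp (fun y => Re (f y) ^ 2 + Im (f y) ^ 2)%R Rinv).
  - apply (continuous_plus (V := R_NormedModule)); simpl;
    repeat apply continuous_Rmult; auto; apply continuous_const.
  - apply continuous_Rinv. rewrite <- Cmod2_alt. apply Cmod_gt_0 in H0.
    apply Rgt_not_eq, pow_lt, H0. }
apply continuous_C_pair; apply continuous_Rmult; auto.
apply (continuous_opp (V := R_NormedModule)); auto.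
Qed.

Lemma continuous_Cdiv {T : UniformSpace} (f g : T -> C) (x : T) :
  g x <> 0 -> continuous f x -> continuous g x -> continuous (fun y => f y / g y) x.
Proof. intros; apply continuous_Cmult; auto; now apply continuous_Cinv. Qed.

Lemma continuous_Cexp (x : C) : continuous Cexp x.
Proof.
assert (H1 : continuous (fun y => Re y) x) by (apply (continuous_Re (fun y => y)), continuous_id).
assert (H2 : continuous (fun y => Im y) x) by (apply (continuous_Im (fun y => y)), continuous_id).
apply continuous_C_pair; apply continuous_Rmult.
- apply (continuous_comp Re exp); auto. apply continuous_exp.
- apply (continuous_comp Im cos); auto. apply continuous_cos.
- apply (continuous_comp Re exp); auto. apply continuous_exp.
- apply (continuous_comp Im sin); auto. apply continuous_sin.
Qed.

Lemma continuous_Cmod (x : C) : continuous Cmod x.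
Proof.
exact (filterlim_norm (V := C_NormedModule) x).
Qed.

Lemma locally_neq_0 {T : UniformSpace} (f : T -> C) (x : T) :
  continuous f x -> f x <> 0 -> locally x (fun y => f y <> 0).
Proof.
intros Hf H0.
assert (H : continuous (fun y => Cmod (f y)) x)
  by (apply (continuous_comp f Cmod); [exact Hf|apply continuous_Cmod]).
assert (H1 : locally x (fun y => (0 < Cmod (f y))%R)).
{ apply (H (fun r => (0 < r)%R)). apply (open_gt 0). now apply Cmod_gt_0. }
revert H1; apply filter_imp; intros y Hy; now apply Cmod_gt_0.
Qed.

Lemma locally_comp {U V : UniformSpace} (f : U -> V) (x : U) (P : V -> Prop) :
  continuous f x -> locally (f x) P -> locally x (fun y => P (f y)).
Proof. intros Hf HP; exact (Hf P HP). Qed.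

Lemma Cprod_app l1 l2 f : Cprod (l1 ++ l2) f = Cprod l1 f * Cprod l2 f.
Proof. unfold Cprod; induction l1 as [|x l1 IH]; simpl; [ring|rewrite IH; ring]. Qed.

Lemma Cprod_S m n f : Cprod (seq m (S n)) f = Cprod (seq m n) f * f (m + n)%nat.
Proof. rewrite seq_S, Cprod_app; simpl; unfold Cprod; simpl; ring. Qed.

Lemma Cprod_ext l f g : (forall i, In i l -> f i = g i) -> Cprod l f = Cprod l g.
Proof.
unfold Cprod; induction l as [|x l IH]; simpl; intros H; [reflexivity|].
rewrite (H x), IH; auto.
Qed.

Lemma Cprod_mult l f g : Cprod l (fun i => f i * g i) = Cprod l f * Cprod l g.
Proof. unfold Cprod; induction l as [|x l IH]; simpl; [ring|rewrite IH; ring]. Qed.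

Lemma Cprod_neq_0 l (f : nat -> C) : (forall i, In i l -> f i <> 0) -> Cprod l f <> 0.
Proof.
unfold Cprod; induction l as [|x l IH]; simpl; intros H.
- intros E; apply (f_equal Re) in E; simpl in E; lra.
- apply Cmult_neq_0; [apply H; now left|apply IH; intros i Hi; apply H; now right].
Qed.

Lemma Cprod_inv l (f : nat -> C) : (forall i, In i l -> f i <> 0) ->
  Cprod l (fun i => / f i) = / Cprod l f.
Proof.
unfold Cprod; induction l as [|x l IH]; simpl; intros H.
- field. 
- rewrite IH by (intros i Hi; apply H; now right). change (/ f x * / Cprod l f = / (f x * Cprod l f)).
  field; split; [apply Cprod_neq_0; intros i Hi; apply H; now right|apply H; now left].
Qed.

Lemma Cprod_const l x : Cprod l (fun _ => x) = x ^ length l.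
Proof. unfold Cprod; induction l as [|y l IH]; simpl; [|rewrite IH]; reflexivity. Qed.

Lemma continuous_Cprod {T : UniformSpace} l (f : nat -> T -> C) (x : T) :
  (forall i, In i l -> continuous (f i) x) ->
  continuous (fun y => Cprod l (fun i => f i y)) x.
Proof.
unfold Cprod; induction l as [|j l IH]; simpl; intros H.
- apply continuous_const.
- apply continuous_Cmult; auto.
Qed.

(** * Geometrically convergent sequences *)
(** Partial sums dominated by a geometric series.  The explicit remainder is
    what makes the convergence uniform in a parameter below. *)
Lemma geom_lim (x : nat -> R) (M r : R) : (0 <= r < 1)%R ->
  (forall n, Rabs (x (S n) - x n) <= M * r ^ n)%R ->
  exists l : R, is_lim_seq x l /\ forall n, (Rabs (l - x n) <= M * r ^ n / (1 - r))%R.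
Proof.
intros Hr H.
assert (HM : (0 <= M)%R).
{ specialize (H O); simpl in H. pose proof (Rabs_pos (x 1%nat - x 0%nat)); lra. }
assert (Hp : forall n, (0 <= r ^ n)%R) by (intros; apply pow_le; lra).
assert (H1 : forall n k, (Rabs (x (n + k)%nat - x n) <= M * r ^ n * (1 - r ^ k) / (1 - r))%R).
{ intros n; induction k as [|k IH].
  - rewrite Nat.add_0_r, Rminus_eq_0, Rabs_R0. simpl. right; field; lra.
  - rewrite Nat.add_succ_r.
    replace (x (S (n + k)) - x n)%R with ((x (S (n + k)) - x (n + k)%nat) + (x (n + k)%nat - x n))%R by ring.
    eapply Rle_trans; [apply Rabs_triang|].
    eapply Rle_trans; [apply Rplus_le_compat; [apply H|exact IH]|].
    rewrite pow_add; right; simpl; field; lra. }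
assert (H2 : forall n k, (Rabs (x (n + k)%nat - x n) <= M * r ^ n / (1 - r))%R).
{ intros n k; eapply Rle_trans; [apply H1|].
  apply Rmult_le_compat_r; [left; apply Rinv_0_lt_compat; lra|].
  rewrite <- (Rmult_1_r (M * r ^ n)) at 2.
  apply Rmult_le_compat_l; [apply Rmult_le_pos; auto|]. specialize (Hp k); lra. }
assert (Hg : is_lim_seq (fun n => M * r ^ n / (1 - r))%R 0).
{ replace (Finite 0) with (Rbar_mult (Finite (M / (1 - r))%R) (Finite 0)) by (simpl; f_equal; ring).
  apply is_lim_seq_ext with (fun n => (M / (1 - r)) * r ^ n)%R.
  - intros; field; lra.
  - apply is_lim_seq_scal_l, is_lim_seq_geom. rewrite Rabs_pos_eq; lra. }
assert (HC : ex_lim_seq_cauchy x).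
{ intros eps. apply is_lim_seq_spec in Hg.
  destruct (Hg (pos_div_2 eps)) as [n0 Hn0]. specialize (Hn0 n0 (le_n _)).
  rewrite Rminus_0_r in Hn0. apply Rabs_def2 in Hn0; simpl in Hn0.
  exists n0; intros n m Hn Hm.
  replace (x n - x m)%R with ((x n - x n0) - (x m - x n0))%R by ring.
  replace n with (n0 + (n - n0))%nat by lia. replace m with (n0 + (m - n0))%nat by lia.
  pose proof (H2 n0 (n - n0)%nat). pose proof (H2 n0 (m - n0)%nat).
  eapply Rle_lt_trans; [apply Rabs_triang|]. rewrite Rabs_Ropp. lra. }
apply ex_lim_seq_cauchy_corr in HC. destruct HC as [l Hl].
exists l; split; [exact Hl|]. intros n.
apply (is_lim_seq_le (fun k => Rabs (x (n + k)%nat - x n)) (fun _ => M * r ^ n / (1 - r))%R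
  (Rabs (l - x n)) (M * r ^ n / (1 - r))%R).
- apply H2.
- apply (is_lim_seq_abs _ (l - x n)%R). apply is_lim_seq_minus'; [|apply is_lim_seq_const].
  apply is_lim_seq_incr_n with (N := n) in Hl.
  eapply is_lim_seq_ext; [|exact Hl]. intros k; simpl; f_equal; lia.
- apply is_lim_seq_const.
Qed.

(** The limit is taken on real and imaginary parts so that [qpoch] is,
    by conversion, the [Clim] of its partial products. *)
Definition Clim (x : nat -> C) : C :=
  (real (Lim_seq (fun n => Re (x n))), real (Lim_seq (fun n => Im (x n)))).

Definition is_Clim (x : nat -> C) (l : C) : Prop :=
  is_lim_seq (fun n => Re (x n)) (Re l) /\ is_lim_seq (fun n => Im (x n)) (Im l).

Lemma Clim_unique x l : is_Clim x l -> Clim x = l.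
Proof.
intros [H1 H2]. unfold Clim. rewrite (is_lim_seq_unique _ _ H1), (is_lim_seq_unique _ _ H2).
destruct l; reflexivity.
Qed.

Lemma is_Clim_unique x l l' : is_Clim x l -> is_Clim x l' -> l = l'.
Proof. intros H1 H2; rewrite <- (Clim_unique _ _ H1); now apply Clim_unique. Qed.

Lemma is_Clim_ext x y l : (forall n, x n = y n) -> is_Clim x l -> is_Clim y l.
Proof.
intros H [H1 H2]; split; (eapply is_lim_seq_ext; [|eassumption]); intros; simpl; now rewrite H.
Qed.

Lemma is_Clim_const c : is_Clim (fun _ => c) c.
Proof. split; apply is_lim_seq_const. Qed.

Lemma is_Clim_S x l : is_Clim x l -> is_Clim (fun n => x (S n)) l.
Proof.
intros [H1 H2]; split; [apply (is_lim_seq_incr_1 (fun n => Re (x n)))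
 | apply (is_lim_seq_incr_1 (fun n => Im (x n)))]; assumption.
Qed.

Lemma is_Clim_minus x y l l' : is_Clim x l -> is_Clim y l' ->
  is_Clim (fun n => x n - y n) (l - l').
Proof.
intros [H1 H2] [H3 H4]; split.
- apply is_lim_seq_ext with (fun n => Re (x n) - Re (y n))%R; [intros; reflexivity|].
  now apply (is_lim_seq_minus' _ _ (Re l) (Re l')).
- apply is_lim_seq_ext with (fun n => Im (x n) - Im (y n))%R; [intros; reflexivity|].
  now apply (is_lim_seq_minus' _ _ (Im l) (Im l')).
Qed.

Lemma is_Clim_mult x y l l' : is_Clim x l -> is_Clim y l' ->
  is_Clim (fun n => x n * y n) (l * l').
Proof.
intros [H1 H2] [H3 H4]; split.
- apply is_lim_seq_ext with (fun n => Re (x n) * Re (y n) - Im (x n) * Im (y n))%R; [intros; reflexivity|].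
  apply (is_lim_seq_minus' _ _ (Re l * Re l')%R (Im l * Im l')%R); now apply is_lim_seq_mult'.
- apply is_lim_seq_ext with (fun n => Re (x n) * Im (y n) + Im (x n) * Re (y n))%R; [intros; reflexivity|].
  apply (is_lim_seq_plus' _ _ (Re l * Im l')%R (Im l * Re l')%R); now apply is_lim_seq_mult'.
Qed.

Lemma Im_le_Cmod c : (Rabs (Im c) <= Cmod c)%R.
Proof. eapply Rle_trans; [apply Rmax_r|apply Rmax_Cmod]. Qed.

Lemma geom_Clim (x : nat -> C) (M r : R) : (0 <= r < 1)%R ->
  (forall n, Cmod (x (S n) - x n) <= M * r ^ n)%R -> is_Clim x (Clim x).
Proof.
intros Hr H.
destruct (geom_lim (fun n => Re (x n)) M r Hr) as [l1 [H1 _]].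
{ intros n; eapply Rle_trans; [|apply H]. apply (re_le_Cmod (x (S n) - x n)). }
destruct (geom_lim (fun n => Im (x n)) M r Hr) as [l2 [H2 _]].
{ intros n; eapply Rle_trans; [|apply H]. apply (Im_le_Cmod (x (S n) - x n)). }
assert (Hl : is_Clim x (l1, l2)) by (split; assumption).
now rewrite (Clim_unique _ _ Hl).
Qed.

(** Uniform limits of continuous functions are continuous; uniformity is
    only asked near [x0] and enters through the geometric bound. *)
Lemma continuous_geom_lim {T : UniformSpace} (F : nat -> T -> R) (x0 : T) (M r : R) :
  (0 <= r < 1)%R ->
  locally x0 (fun x => forall n, Rabs (F (S n) x - F n x) <= M * r ^ n)%R ->
  (forall n, continuous (F n) x0) ->
  continuous (fun x => real (Lim_seq (fun n => F n x))) x0.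
Proof.
intros Hr HF Hc.
assert (HL : locally x0 (fun x => forall n,
  Rabs (real (Lim_seq (fun n => F n x)) - F n x) <= M * r ^ n / (1 - r))%R).
{ revert HF; apply filter_imp; intros x H n.
  destruct (geom_lim (fun n => F n x) M r Hr H) as [l [H1 H2]].
  rewrite (is_lim_seq_unique _ _ H1). apply H2. }
apply filterlim_locally; intros eps.
assert (Hg : is_lim_seq (fun n => M * r ^ n / (1 - r))%R 0).
{ replace (Finite 0) with (Rbar_mult (Finite (M / (1 - r))%R) (Finite 0)) by (simpl; f_equal; ring).
  apply is_lim_seq_ext with (fun n => (M / (1 - r)) * r ^ n)%R.
  - intros; field; lra.
  - apply is_lim_seq_scal_l, is_lim_seq_geom. rewrite Rabs_pos_eq; lra. }
apply is_lim_seq_spec in Hg.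
assert (He : (0 < eps / 3)%R) by (destruct eps; simpl; lra).
destruct (Hg (mkposreal _ He)) as [n Hn]. specialize (Hn n (le_n _)).
rewrite Rminus_0_r in Hn. apply Rabs_def2 in Hn; simpl in Hn.
pose proof (proj1 (filterlim_locally _ _) (Hc n) (mkposreal _ He)) as Hcn.
pose proof (locally_singleton _ _ HL n) as HL0. cbv beta in HL0.
generalize (filter_and _ _ HL Hcn); apply filter_imp; intros x [H1 H2].
specialize (H1 n).
change (Rabs (F n x - F n x0) < eps / 3)%R in H2.
change (Rabs (real (Lim_seq (fun n => F n x)) - real (Lim_seq (fun n => F n x0))) < eps)%R.
apply Rabs_def2 in H2. apply Rabs_le_between in H1. apply Rabs_le_between in HL0.
apply Rabs_def1; lra.
Qed.

Lemma continuous_geom_Clim {T : UniformSpace} (F : nat -> T -> C) (x0 : T) (M r : R) :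
  (0 <= r < 1)%R ->
  locally x0 (fun x => forall n, Cmod (F (S n) x - F n x) <= M * r ^ n)%R ->
  (forall n, continuous (F n) x0) ->
  continuous (fun x => Clim (fun n => F n x)) x0.
Proof.
intros Hr H Hc. apply continuous_C_pair; apply (continuous_geom_lim _ _ M r Hr).
- revert H; apply filter_imp; intros x H n; eapply Rle_trans; [|apply H].
  apply (re_le_Cmod (F (S n) x - F n x)).
- intros n; now apply continuous_Re.
- revert H; apply filter_imp; intros x H n; eapply Rle_trans; [|apply H].
  apply (Im_le_Cmod (F (S n) x - F n x)).
- intros n; now apply continuous_Im.
Qed.

(** * Holomorphic functions *)

Lemma Cplus_minus (a b : C) : a + (b - a) = b.
Proof. ring. Qed.

(** A difference quotient that extends continuously across the diagonal.
    This says that [f] is holomorphic near [x0].  Compared with a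
    derivative, such quotients pass through products, inverses and compositions
    by algebra and survive locally uniform limits, and they give at once
    that the derivative is continuous, which Cauchy's theorem below needs. *)
Definition holo (f : C -> C) (x0 : C) : Prop :=
  exists phi : C * C -> C, locally (x0, x0) (fun p : C * C =>
    f (snd p) - f (fst p) = (snd p - fst p) * phi p /\ continuous phi p).

Lemma continuous_proj1 {U V : UniformSpace} (p : U * V) : continuous (fun p : U * V => fst p) p.
Proof. destruct p; apply continuous_fst. Qed.
Lemma continuous_proj2 {U V : UniformSpace} (p : U * V) : continuous (fun p : U * V => snd p) p.
Proof. destruct p; apply continuous_snd. Qed.

Lemma locally_diag {T : UniformSpace} (x0 : T) (P : T * T -> Prop) :
  locally (x0, x0) P -> locally x0 (fun x => P (x, x)).
Proof.
intros H. apply (continuous_comp_2 (fun x => x) (fun x => x) (fun a b => (a, b)) x0);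
 [apply continuous_id|apply continuous_id| |exact H].
apply filterlim_ext with (fun p => p); [intros [a b]; reflexivity|]. apply filterlim_id.
Qed.

Lemma continuous_pair_r {U V : UniformSpace} (x : U) (y : V) : continuous (fun y => (x, y)) y.
Proof.
apply (continuous_comp_2 (fun _ => x) (fun y => y) (fun a b => (a, b)) y);
 [apply continuous_const|apply continuous_id|].
apply filterlim_ext with (fun p => p); [intros [a b]; reflexivity|]. apply filterlim_id.
Qed.

Lemma locally_pair {T : UniformSpace} (x0 : T) (P : T -> Prop) : locally x0 P ->
  locally (x0, x0) (fun p : T * T => P (fst p) /\ P (snd p)).
Proof.
intros H; apply filter_and.
- exact (continuous_proj1 (x0, x0) P H).
- exact (continuous_proj2 (x0, x0) P H).
Qed.

Lemma holo_locally (f : C -> C) (x0 : C) : holo f x0 -> locally x0 (holo f).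
Proof.
intros [phi H]. apply locally_locally in H. apply locally_diag in H.
revert H; apply filter_imp; intros x H; exists phi; exact H.
Qed.

Lemma holo_continuous (f : C -> C) (x0 : C) : holo f x0 -> continuous f x0.
Proof.
intros [phi H]. pose proof (locally_singleton _ _ H) as [_ Hc]. 
assert (H' : locally x0 (fun y => f y - f x0 = (y - x0) * phi (x0, y))).
{ pose proof (locally_comp (fun y => (x0, y)) x0 _ (continuous_pair_r x0 x0) H) as H'. revert H'; apply filter_imp; intros y [Hy _]; exact Hy. }
apply continuous_ext_loc with (fun y => f x0 + (y - x0) * phi (x0, y)).
- revert H'; apply filter_imp; intros y Hy.
    transitivity (f x0 + (f y - f x0)); [rewrite Hy; reflexivity|apply Cplus_minus].
- apply continuous_Cplus; [apply continuous_const|]. apply continuous_Cmult.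
  + apply continuous_Cminus; [apply continuous_id|apply continuous_const].
  + apply (continuous_comp (fun y => (x0, y)) phi); [apply continuous_pair_r|exact Hc].
Qed.

Lemma holo_continuous_loc (f : C -> C) (x0 : C) : holo f x0 -> locally x0 (fun x => continuous f x).
Proof. intros H; apply holo_locally in H; revert H; apply filter_imp, holo_continuous. Qed.

Lemma holo_pair_continuous (f : C -> C) (x0 : C) : holo f x0 ->
  locally (x0, x0) (fun p : C * C => continuous (fun p : C * C => f (fst p)) p
     /\ continuous (fun p : C * C => f (snd p)) p).
Proof.
intros H. apply holo_continuous_loc, locally_pair in H.
revert H; apply filter_imp; intros p [H1 H2]; split.
- apply (continuous_comp (fun p : C * C => fst p) f); [apply continuous_proj1|exact H1].
- apply (continuous_comp (fun p : C * C => snd p) f); [apply continuous_proj2|exact H2].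
Qed.

Lemma holo_const c x0 : holo (fun _ => c) x0.
Proof.
exists (fun _ => 0); apply filter_forall; intros p; split; [ring|apply continuous_const].
Qed.

Lemma holo_lin c x0 : holo (fun x => c * x) x0.
Proof.
exists (fun _ => c); apply filter_forall; intros p; split; [ring|apply continuous_const].
Qed.

Lemma holo_mult (f g : C -> C) (x0 : C) : holo f x0 -> holo g x0 -> holo (fun x => f x * g x) x0.
Proof.
intros Hf Hg. pose proof (holo_pair_continuous _ _ Hf) as Cf.
pose proof (holo_pair_continuous _ _ Hg) as Cg.
destruct Hf as [phi Hf], Hg as [psi Hg].
exists (fun p => phi p * g (snd p) + f (fst p) * psi p).
generalize (filter_and _ _ (filter_and _ _ Hf Hg) (filter_and _ _ Cf Cg)).
apply filter_imp; intros p [[[H1 H2] [H3 H4]] [[H5 H6] [H7 H8]]]; split.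
- assert (A : forall f1 f2 g1 g2 d r s : C, f2 - f1 = d * r -> g2 - g1 = d * s ->
    f2 * g2 - f1 * g1 = d * (r * g2 + f1 * s)).
  { intros f1 f2 g1 g2 d r s E1 E2.
    transitivity ((f2 - f1) * g2 + f1 * (g2 - g1)); [ring|rewrite E1, E2; ring]. }
  now apply A.
- apply continuous_Cplus; now apply continuous_Cmult.
Qed.

Lemma holo_inv (f : C -> C) (x0 : C) : f x0 <> 0 -> holo f x0 -> holo (fun x => / f x) x0.
Proof.
intros H0 Hf. pose proof (holo_pair_continuous _ _ Hf) as Cf.
pose proof (locally_pair _ _ (locally_neq_0 f x0 (holo_continuous _ _ Hf) H0)) as N.
destruct Hf as [phi Hf].
exists (fun p => - phi p / (f (fst p) * f (snd p))).
generalize (filter_and _ _ (filter_and _ _ Hf N) Cf).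
apply filter_imp; intros p [[[H1 H2] [H3 H4]] [H5 H6]]; split.
- assert (A : forall f1 f2 d r : C, f1 <> 0 -> f2 <> 0 -> f2 - f1 = d * r ->
    / f2 - / f1 = d * (- r / (f1 * f2))).
  { intros f1 f2 d r N1 N2 E1.
    transitivity (- (f2 - f1) / (f1 * f2)); [field; auto|rewrite E1; field; auto]. }
  now apply A.
- apply continuous_Cdiv; [now apply Cmult_neq_0|now apply continuous_Copp|now apply continuous_Cmult].
Qed.

Lemma holo_comp (f g : C -> C) (x0 : C) : holo g x0 -> holo f (g x0) -> holo (fun x => f (g x)) x0.
Proof.
intros Hg Hf. pose proof (holo_pair_continuous _ _ Hg) as Cg.
destruct Hf as [phi Hf], Hg as [psi Hg].
assert (CP : forall p : C * C, continuous (fun p : C * C => g (fst p)) p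
     /\ continuous (fun p : C * C => g (snd p)) p ->
     continuous (fun p : C * C => (g (fst p), g (snd p))) p).
{ intros p [H1 H2]. apply (continuous_comp_2 (fun p : C * C => g (fst p)) (fun p : C * C => g (snd p)) (fun a b => (a, b)) p); auto.
  apply filterlim_ext with (fun p => p); [intros [a b]; reflexivity|]. apply filterlim_id. }
exists (fun p => phi (g (fst p), g (snd p)) * psi p).
pose proof (locally_comp _ _ _ (CP _ (locally_singleton _ _ Cg)) Hf) as Hf'. 
generalize (filter_and _ _ (filter_and _ _ Hf' Hg) Cg).
apply filter_imp; intros p [[[H1 H2] [H3 H4]] H5]; split.
- assert (A : forall f1 f2 g1 g2 d r s : C, f2 - f1 = (g2 - g1) * r -> g2 - g1 = d * s ->
    f2 - f1 = d * (r * s)) by (intros f1 f2 g1 g2 d r s -> ->; ring).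
  exact (A _ _ _ _ _ _ _ H1 H3).
- apply continuous_Cmult; auto.
  apply (continuous_comp (fun p : C * C => (g (fst p), g (snd p))) phi); auto.
Qed.

Lemma holo_Cprod l (f : nat -> C -> C) x0 : (forall i, In i l -> holo (f i) x0) ->
  holo (fun x => Cprod l (fun i => f i x)) x0.
Proof.
unfold Cprod; induction l as [|j l IH]; simpl; intros H.
- apply holo_const.
- apply (holo_mult (f j)); auto.
Qed.

(** The complex derivative, computed in the real direction, so that it is a
    function of [f] and no choice is made. *)
Definition Cderive (f : C -> C) (x : C) : C :=
  (Derive (fun r : R => Re (f (x + r))) 0, Derive (fun r : R => Im (f (x + r))) 0).

Lemma is_derive_slope (f g : R -> R) (x : R) :
  locally x (fun y => f y - f x = (y - x) * g y)%R -> continuous g x ->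
  is_derive f x (g x).
Proof.
intros H Hg. apply is_derive_Reals. intros eps He.
pose proof (proj1 (filterlim_locally _ _) Hg (mkposreal _ He)) as Hg'.
destruct (filter_and _ _ H Hg') as [d Hd]. exists d. intros h Hh0 Hh.
destruct (Hd (x + h)%R) as [H1 H2].
{ assert (E : forall a b : R, (a + b - a = b)%R) by (intros; ring).
  change (Rabs (x + h - x) < d)%R; rewrite E; exact Hh. }
rewrite H1. change (Rabs (g (x + h) - g x) < eps)%R in H2.
replace ((x + h - x) * g (x + h) / h)%R with (g (x + h)%R) by (field; auto). exact H2.
Qed.

(** Caratheodory's form of the derivative, used to differentiate along curves
    without epsilon estimates. *)
Lemma is_derive_slope_ex (f : R -> R) (x d : R) : is_derive f x d ->
  exists g : R -> R, g x = d /\ continuous g x /\ forall y, (f y - f x = (y - x) * g y)%R.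
Proof.
intros H. apply is_derive_Reals in H.
exists (fun y => if Req_EM_T y x then d else (f y - f x) / (y - x))%R.
split; [|split].
- destruct (Req_EM_T x x); tauto.
- apply filterlim_locally; intros eps. destruct (H eps (cond_pos eps)) as [dl Hd].
  exists dl; intros y Hy. change (Rabs (y - x) < dl)%R in Hy.
  destruct (Req_EM_T x x) as [_|]; [|tauto].
  destruct (Req_EM_T y x) as [->|Hn].
  + apply ball_center.
  + specialize (Hd (y - x)%R (Rminus_eq_contra _ _ Hn) Hy).
    assert (E : forall a b : R, (a + (b - a) = b)%R) by (intros; ring).
    rewrite E in Hd; exact Hd.
- intros y; destruct (Req_EM_T y x) as [->|Hn]; [ring|field; lra].
Qed.

Lemma is_derive_slope_C (F G : R -> C) (t : R) :
  locally t (fun y => F y - F t = (y - t)%R * G y) -> continuous G t ->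
  is_derive (fun y => Re (F y)) t (Re (G t)) /\ is_derive (fun y => Im (F y)) t (Im (G t)).
Proof.
intros H Hc.
assert (A : forall (z : C) (d : R) (c : C), z = d * c -> Re z = (d * Re c)%R /\ Im z = (d * Im c)%R)
  by (intros z d c ->; destruct c; unfold Re, Im; split; simpl; ring).
split.
- apply (is_derive_slope _ (fun y => Re (G y))); [|now apply continuous_Re].
  revert H; apply filter_imp; intros y Hy. change (Re (F y - F t) = (y - t) * Re (G y))%R.
  exact (proj1 (A _ _ _ Hy)).
- apply (is_derive_slope _ (fun y => Im (G y))); [|now apply continuous_Im].
  revert H; apply filter_imp; intros y Hy. change (Im (F y - F t) = (y - t) * Im (G y))%R.
  exact (proj2 (A _ _ _ Hy)).
Qed.

Lemma holo_curve_slope (f : C -> C) (phi : C * C -> C) (g : R -> C) (k : R -> C) (t : R) :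
  locally (g t, g t) (fun p : C * C => f (snd p) - f (fst p) = (snd p - fst p) * phi p /\ continuous phi p) ->
  locally t (fun y => g y - g t = (y - t)%R * k y) -> continuous k t ->
  is_derive (fun y => Re (f (g y))) t (Re (phi (g t, g t) * k t)) /\
  is_derive (fun y => Im (f (g y))) t (Im (phi (g t, g t) * k t)).
Proof.
intros Hf Hg Hk.
assert (Cg : continuous g t).
{ apply continuous_ext_loc with (fun y => g t + (y - t)%R * k y).
  - revert Hg; apply filter_imp; intros y Hy.
    transitivity (g t + (g y - g t)); [rewrite Hy; reflexivity|apply Cplus_minus].
  - apply continuous_Cplus; [apply continuous_const|apply continuous_Cmult; auto].
    apply continuous_RtoC. apply (continuous_minus (V := R_NormedModule)); [apply continuous_id|apply continuous_const]. }
assert (CP : continuous (fun y => (g t, g y)) t).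
{ apply (continuous_comp g (fun z => (g t, z))); auto. apply continuous_pair_r. }
pose proof (locally_singleton _ _ Hf) as [_ Cp].
apply (is_derive_slope_C (fun y => f (g y)) (fun y => phi (g t, g y) * k y)).
- generalize (filter_and _ _ (locally_comp _ _ _ CP Hf) Hg); apply filter_imp; intros y [[H1 _] H2].
  assert (A : forall f1 f2 g1 g2 d r s : C, f2 - f1 = (g2 - g1) * r -> g2 - g1 = d * s ->
    f2 - f1 = d * (r * s)) by (intros f1 f2 g1 g2 d r s -> ->; ring).
  exact (A _ _ _ _ _ _ _ H1 H2).
- apply continuous_Cmult; auto. apply (continuous_comp (fun y => (g t, g y)) phi); auto.
Qed.

Lemma Cderive_phi (f : C -> C) (phi : C * C -> C) (x : C) :
  locally (x, x) (fun p : C * C => f (snd p) - f (fst p) = (snd p - fst p) * phi p /\ continuous phi p) ->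
  Cderive f x = phi (x, x).
Proof.
intros H.
destruct (holo_curve_slope f phi (fun r => x + r) (fun _ => 1) 0) as [H1 H2].
- rewrite Cplus_0_r; exact H.
- apply filter_forall; intros y. rewrite RtoC_minus; ring.
- apply continuous_const.
- rewrite Cplus_0_r, Cmult_1_r in H1, H2.
  apply C_ext; [exact (is_derive_unique _ _ _ H1)|exact (is_derive_unique _ _ _ H2)].
Qed.

(** Chain rule along a curve [g] with velocity [k t] at [t], on real and
    imaginary parts. *)
Lemma holo_curve (f : C -> C) (g k : R -> C) (t : R) : holo f (g t) ->
  locally t (fun y => g y - g t = (y - t)%R * k y) -> continuous k t ->
  is_derive (fun y => Re (f (g y))) t (Re (Cderive f (g t) * k t)) /\
  is_derive (fun y => Im (f (g y))) t (Im (Cderive f (g t) * k t)).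
Proof.
intros [phi H] H1 H2. rewrite (Cderive_phi _ _ _ H). now apply holo_curve_slope.
Qed.

(** Near [x0] the derivative is the restriction to the diagonal of one
    continuous difference quotient. *)
Lemma continuous_Cderive (f : C -> C) (x0 : C) : holo f x0 -> continuous (Cderive f) x0.
Proof.
intros [phi H]. pose proof (locally_singleton _ _ H) as [_ Cp].
apply continuous_ext_loc with (fun x => phi (x, x)).
- apply locally_locally in H. apply locally_diag in H. revert H; apply filter_imp.
  intros x Hx; symmetry; now apply Cderive_phi.
- apply (continuous_comp (fun x => (x, x)) phi); [|exact Cp].
  intros P HP. apply locally_diag, HP.
Qed.

(** * The infinite q-shifted factorial *)
Definition qpoch_part (a p : C) (n : nat) : C := Cprod (seq 0 n) (fun k => 1 - a * p ^ k).

Lemma qpoch_part_S a p n : qpoch_part a p (S n) = qpoch_part a p n * (1 - a * p ^ n).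
Proof. unfold qpoch_part; now rewrite Cprod_S. Qed.

Lemma qpoch_part_S_l a p n : qpoch_part a p (S n) = (1 - a) * qpoch_part (a * p) p n.
Proof.
induction n as [|n IH].
- rewrite qpoch_part_S; unfold qpoch_part; simpl; ring.
- rewrite qpoch_part_S, IH, qpoch_part_S, Cpow_S; ring.
Qed.

(** The divided difference of the partial product, which is a polynomial in both
    arguments and satisfies the product rule for the last factor. *)
Fixpoint qpoch_slope (p : C) (n : nat) (xy : C * C) : C :=
  match n with
  | O => 0
  | S n => qpoch_slope p n xy * (1 - snd xy * p ^ n) - qpoch_part (fst xy) p n * p ^ n
  end.

Lemma qpoch_slope_spec p n x y :
  qpoch_part y p n - qpoch_part x p n = (y - x) * qpoch_slope p n (x, y).
Proof.
induction n as [|n IH].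
- unfold qpoch_part; simpl; ring.
- rewrite !qpoch_part_S; simpl qpoch_slope; cbn [fst snd].
  transitivity ((qpoch_part y p n - qpoch_part x p n) * (1 - y * p ^ n) - (y - x) * qpoch_part x p n * p ^ n);
   [ring|rewrite IH; ring].
Qed.

Definition geosum (r : R) (n : nat) : R := ((1 - r ^ n) / (1 - r))%R.

Lemma geosum_S r n : (r < 1)%R -> geosum r (S n) = (geosum r n + r ^ n)%R.
Proof. intros; unfold geosum; simpl; field; lra. Qed.

Lemma geosum_bounds r n : (0 <= r < 1)%R -> (0 <= geosum r n <= / (1 - r))%R.
Proof.
intros Hr; unfold geosum, Rdiv.
assert (0 < / (1 - r))%R by (apply Rinv_0_lt_compat; lra).
assert (0 <= r ^ n)%R by (apply pow_le; lra).
assert (r ^ n <= 1)%R by (rewrite <- (pow1 n); apply pow_incr; lra).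
split; [apply Rmult_le_pos; lra|]. rewrite <- (Rmult_1_l (/ (1 - r))) at 2.
apply Rmult_le_compat_r; lra.
Qed.

Lemma qfactor_bound (B : R) (x p : C) (n : nat) : (Cmod x <= B)%R ->
  (Cmod (1 - x * p ^ n) <= exp (B * Cmod p ^ n))%R.
Proof.
intros Hx.
assert (0 <= Cmod p ^ n)%R by (apply pow_le, Cmod_ge_0).
apply Rle_trans with (1 + B * Cmod p ^ n)%R; [|apply exp_ineq1_le].
eapply Rle_trans; [apply Cmod_triangle|]. rewrite Cmod_1, Cmod_opp, Cmod_mult, Cmod_pow.
apply Rplus_le_compat_l, Rmult_le_compat_r; auto.
Qed.

Lemma qpoch_part_bound (B : R) (p : C) : (Cmod p < 1)%R -> (0 <= B)%R ->
  forall x n, (Cmod x <= B)%R -> (Cmod (qpoch_part x p n) <= exp (B * geosum (Cmod p) n))%R.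
Proof.
intros Hp HB x n Hx; induction n as [|n IH].
- unfold qpoch_part; simpl; rewrite Cmod_1. unfold geosum; simpl.
  replace (B * _)%R with 0%R by (field; lra). rewrite exp_0; lra.
- rewrite qpoch_part_S, Cmod_mult, geosum_S, Rmult_plus_distr_l, exp_plus by auto.
  apply Rmult_le_compat; auto using Cmod_ge_0. now apply qfactor_bound.
Qed.

Lemma exp_le_mono (x y : R) : (x <= y)%R -> (exp x <= exp y)%R.
Proof. intros [H| ->]; [left; now apply exp_increasing|right; reflexivity]. Qed.

Lemma qpoch_part_unif_bound (B : R) (p : C) : (Cmod p < 1)%R -> (0 <= B)%R ->
  forall x n, (Cmod x <= B)%R -> (Cmod (qpoch_part x p n) <= exp (B / (1 - Cmod p)))%R.
Proof.
intros Hp HB x n Hx. eapply Rle_trans; [now apply (qpoch_part_bound B)|].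
apply exp_le_mono, Rmult_le_compat_l; auto.
apply geosum_bounds; split; auto using Cmod_ge_0.
Qed.

(** The induction multiplies the bound by [exp (B * r^n)] and adds a term of size
    [r^n] at each step, whence a product of an exponential and of a partial
    geometric sum. *)
Lemma qpoch_slope_bound (B : R) (p : C) : (Cmod p < 1)%R -> (0 <= B)%R ->
  forall x y n, (Cmod x <= B)%R -> (Cmod y <= B)%R ->
  (Cmod (qpoch_slope p n (x, y)) <=
    exp (B * geosum (Cmod p) n) * (exp (B / (1 - Cmod p)) * geosum (Cmod p) n))%R.
Proof.
intros Hp HB x y n Hx Hy.
assert (Hpn : forall n, (0 <= Cmod p ^ n)%R) by (intros; apply pow_le, Cmod_ge_0).
induction n as [|n IH].
- simpl; rewrite Cmod_0. unfold geosum; simpl.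
  replace ((1 - 1) / (1 - Cmod p))%R with 0%R by (field; lra). lra.
- simpl qpoch_slope; cbn [fst snd]. rewrite geosum_S by auto.
  set (M := exp (B / (1 - Cmod p))) in *. set (g := geosum (Cmod p) n) in *.
  assert (Hg : (0 <= g)%R) by (apply geosum_bounds; split; auto using Cmod_ge_0).
  assert (HM : (0 < M)%R) by apply exp_pos.
  eapply Rle_trans; [apply Cmod_triangle|].
  rewrite Cmod_opp, !Cmod_mult, Cmod_pow, (Rmult_plus_distr_l M).
  rewrite (Rmult_plus_distr_l (exp _)). apply Rplus_le_compat.
  + rewrite Rmult_plus_distr_l, exp_plus.
    apply Rle_trans with ((exp (B * g) * (M * g)) * exp (B * Cmod p ^ n))%R; [|right; ring].
    apply Rmult_le_compat; auto using Cmod_ge_0. now apply qfactor_bound.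
  + rewrite <- (Rmult_1_l (_ * Cmod p ^ n)). apply Rmult_le_compat; [lra| | |].
    * apply Rmult_le_pos; auto using Cmod_ge_0.
    * rewrite <- exp_0. apply exp_le_mono. apply Rmult_le_pos; auto.
      apply Rplus_le_le_0_compat; auto.
    * apply Rmult_le_compat_r; auto. now apply qpoch_part_unif_bound.
Qed.

Lemma qpoch_part_step (B : R) (p : C) : (Cmod p < 1)%R -> (0 <= B)%R ->
  forall x n, (Cmod x <= B)%R ->
  (Cmod (qpoch_part x p (S n) - qpoch_part x p n) <= exp (B / (1 - Cmod p)) * B * Cmod p ^ n)%R.
Proof.
intros Hp HB x n Hx. rewrite qpoch_part_S.
replace (_ - _) with (- (qpoch_part x p n * x * p ^ n)) by ring.
rewrite Cmod_opp, !Cmod_mult, Cmod_pow.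
apply Rmult_le_compat_r; [apply pow_le, Cmod_ge_0|].
apply Rmult_le_compat; auto using Cmod_ge_0. now apply qpoch_part_unif_bound.
Qed.

Lemma qpoch_slope_step (B : R) (p : C) : (Cmod p < 1)%R -> (0 <= B)%R ->
  exists M, forall x y n, (Cmod x <= B)%R -> (Cmod y <= B)%R ->
  (Cmod (qpoch_slope p (S n) (x, y) - qpoch_slope p n (x, y)) <= M * Cmod p ^ n)%R.
Proof.
intros Hp HB. set (K := exp (B / (1 - Cmod p))).
exists (K * (K * / (1 - Cmod p)) * B + K)%R. intros x y n Hx Hy.
simpl qpoch_slope; cbn [fst snd].
replace (_ - _ - _) with (- (qpoch_slope p n (x, y) * y * p ^ n) - qpoch_part x p n * p ^ n) by ring.
eapply Rle_trans; [apply Cmod_triangle|].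
rewrite !Cmod_opp, !Cmod_mult, Cmod_pow, Rmult_plus_distr_r.
assert (Hpn : (0 <= Cmod p ^ n)%R) by (apply pow_le, Cmod_ge_0).
assert (Hg := geosum_bounds (Cmod p) n (conj (Cmod_ge_0 p) Hp)).
apply Rplus_le_compat; apply Rmult_le_compat_r; auto; [|now apply qpoch_part_unif_bound].
apply Rmult_le_compat; auto using Cmod_ge_0.
eapply Rle_trans; [now apply (qpoch_slope_bound B)|].
apply Rmult_le_compat.
- left; apply exp_pos.
- apply Rmult_le_pos; [left; apply exp_pos|lra].
- apply exp_le_mono, Rmult_le_compat_l; lra.
- apply Rmult_le_compat_l; [left; apply exp_pos|lra].
Qed.

Lemma qpoch_lim (p : C) : (Cmod p < 1)%R -> forall x, is_Clim (qpoch_part x p) (qpoch x p).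
Proof.
intros Hp x. change (qpoch x p) with (Clim (qpoch_part x p)).
apply (geom_Clim _ (exp (Cmod x / (1 - Cmod p)) * Cmod x) (Cmod p)); [split; auto using Cmod_ge_0|].
intros n; apply (qpoch_part_step (Cmod x)); auto using Cmod_ge_0. right; reflexivity.
Qed.

Lemma qpoch_step (x p : C) : (Cmod p < 1)%R -> qpoch x p = (1 - x) * qpoch (x * p) p.
Proof.
intros Hp. apply (is_Clim_unique (fun n => qpoch_part x p (S n))).
- now apply is_Clim_S, qpoch_lim.
- apply (is_Clim_ext (fun n => (1 - x) * qpoch_part (x * p) p n)).
  + intros n; now rewrite qpoch_part_S_l.
  + apply is_Clim_mult; [apply is_Clim_const|now apply qpoch_lim].
Qed.

Lemma qpoch_0 (p : C) : (Cmod p < 1)%R -> qpoch 0 p = 1.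
Proof.
intros Hp. apply (is_Clim_unique (qpoch_part 0 p)); [now apply qpoch_lim|].
apply (is_Clim_ext (fun _ => 1)); [|apply is_Clim_const].
intros n; induction n as [|n IH]; [reflexivity|]. rewrite qpoch_part_S, <- IH; ring.
Qed.

Lemma qpoch_1 (p : C) : (Cmod p < 1)%R -> qpoch 1 p = 0.
Proof. intros Hp; rewrite qpoch_step by auto; ring. Qed.

Lemma qpoch_iter (x p : C) : (Cmod p < 1)%R -> forall n,
  qpoch x p = qpoch_part x p n * qpoch (x * p ^ n) p.
Proof.
intros Hp n; induction n as [|n IH].
- unfold qpoch_part; simpl. rewrite Cmult_1_r, Cmult_1_l; reflexivity.
- rewrite IH, (qpoch_step (x * p ^ n)), qpoch_part_S, Cpow_S by auto.
  replace (x * p ^ n * p) with (x * (p * p ^ n)) by ring. ring.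
Qed.

Lemma locally_Cmod_le (x0 : C) : locally x0 (fun x => (Cmod x <= Cmod x0 + 1)%R).
Proof.
assert (H : locally x0 (fun x => (Cmod x < Cmod x0 + 1)%R)).
{ apply (locally_comp Cmod x0 (fun r => (r < Cmod x0 + 1)%R)); [apply continuous_Cmod|].
  apply open_lt; lra. }
revert H; apply filter_imp; intros x H; lra.
Qed.

Lemma continuous_qpoch_part (p : C) n x : continuous (fun x => qpoch_part x p n) x.
Proof.
unfold qpoch_part. apply (continuous_Cprod (seq 0 n) (fun k x => 1 - x * p ^ k)).
intros k _. apply continuous_Cminus; [apply continuous_const|].
apply continuous_Cmult; [apply continuous_id|apply continuous_const].
Qed.

Lemma continuous_qpoch_slope (p : C) n xy : continuous (qpoch_slope p n) xy.
Proof.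
induction n as [|n IH]; simpl.
- apply continuous_const.
- apply continuous_Cminus; apply continuous_Cmult; auto; try apply continuous_const.
  + apply continuous_Cminus; [apply continuous_const|].
    apply continuous_Cmult; [apply continuous_proj2|apply continuous_const].
  + apply (continuous_comp (fun xy : C * C => fst xy) (fun x => qpoch_part x p n));
     [apply continuous_proj1|apply continuous_qpoch_part].
Qed.

(** The divided differences of the partial products converge geometrically, hence
    locally uniformly, to a divided difference of the infinite product. *)
Lemma holo_qpoch (p : C) : (Cmod p < 1)%R -> forall x, holo (fun x => qpoch x p) x.
Proof.
intros Hp x. exists (fun xy => Clim (fun n => qpoch_slope p n xy)).
assert (L : forall B, (0 <= B)%R -> exists M, forall xy, (Cmod (fst xy) <= B /\ Cmod (snd xy) <= B)%R ->
  forall n, (Cmod (qpoch_slope p (S n) xy - qpoch_slope p n xy) <= M * Cmod p ^ n)%R).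
{ intros B HB; destruct (qpoch_slope_step B p Hp HB) as [M HM]; exists M.
  intros [a b] [Ha Hb] n; now apply HM. }
apply filter_forall; intros [a b]; split; cbn [fst snd].
- apply (is_Clim_unique (fun n => qpoch_part b p n - qpoch_part a p n)).
  + apply is_Clim_minus; now apply qpoch_lim.
  + apply (is_Clim_ext (fun n => (b - a) * qpoch_slope p n (a, b))).
    * intros n; now rewrite qpoch_slope_spec.
    * apply is_Clim_mult; [apply is_Clim_const|].
      destruct (L (Rmax (Cmod a) (Cmod b))) as [M HM].
      { eapply Rle_trans; [apply (Cmod_ge_0 a)|apply Rmax_l]. }
      apply (geom_Clim _ M (Cmod p)); [split; auto using Cmod_ge_0|].
      apply HM; split; [apply Rmax_l|apply Rmax_r].
- destruct (L (Rmax (Cmod a + 1) (Cmod b + 1))%R) as [M HM].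
  { pose proof (Cmod_ge_0 a); pose proof (Rmax_l (Cmod a + 1) (Cmod b + 1)); lra. }
  apply (continuous_geom_Clim (qpoch_slope p) _ M (Cmod p)); [split; auto using Cmod_ge_0| |].
  + generalize (filter_and _ _
      (locally_comp (fun xy : C * C => fst xy) (a, b) _ (continuous_proj1 _) (locally_Cmod_le a))
      (locally_comp (fun xy : C * C => snd xy) (a, b) _ (continuous_proj2 _) (locally_Cmod_le b))).
    apply filter_imp; intros xy [H1 H2]; apply HM; split.
    * eapply Rle_trans; [exact H1|apply Rmax_l].
    * eapply Rle_trans; [exact H2|apply Rmax_r].
  + intros n; apply continuous_qpoch_slope.
Qed.

(** After finitely many factors the remaining product (x q^n; q) has its argument
    close to 0, where it is close to 1 by continuity. *)
Lemma qpoch_neq_0 (x p : C) : (Cmod p < 1)%R ->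
  (forall k, 1 - x * p ^ k <> 0) -> qpoch x p <> 0.
Proof.
intros Hp H.
assert (Hc : continuous (fun x => qpoch x p) (RtoC 0)) by now apply holo_continuous, holo_qpoch.
assert (HN : locally (RtoC 0) (fun y => qpoch y p <> 0)).
{ apply (locally_neq_0 (fun y => qpoch y p)); auto. rewrite qpoch_0 by auto.
  intros E; apply (f_equal Re) in E; simpl in E; lra. }
destruct HN as [d Hd].
assert (Hg : is_lim_seq (fun n => (Cmod x * Cmod p ^ n))%R 0).
{ replace (Finite 0) with (Rbar_mult (Finite (Cmod x)) (Finite 0)) by (simpl; f_equal; ring).
  apply is_lim_seq_scal_l, is_lim_seq_geom. rewrite Rabs_pos_eq; auto using Cmod_ge_0. }
apply is_lim_seq_spec in Hg. destruct (Hg d) as [n Hn]. specialize (Hn n (le_n _)).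
rewrite Rminus_0_r in Hn. apply Rabs_def2 in Hn.
rewrite (qpoch_iter x p Hp n). apply Cmult_neq_0.
- unfold qpoch_part; apply Cprod_neq_0; auto.
- apply Hd. apply C_NormedModule_mixin_compat1.
  change (Cmod (x * p ^ n - 0) < d)%R.
  replace (x * p ^ n - 0) with (x * p ^ n) by ring. rewrite Cmod_mult, Cmod_pow. tauto.
Qed.

(** * Holomorphy of the exponential *)

Definition exp_quotient (h : C) : C := if Req_EM_T (Cmod h) 0 then 1 else (Cexp h - 1) / h.

Lemma exp_quotient_spec h : Cexp h - 1 = h * exp_quotient h.
Proof.
unfold exp_quotient; destruct (Req_EM_T (Cmod h) 0) as [E|E].
- apply Cmod_eq_0 in E; subst; rewrite Cexp_0; ring.
- field. intros E'; apply E; rewrite E'; apply Cmod_0.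
Qed.

(** Only the origin needs an argument.  There, with h = x + i y, the slopes of exp,
    cos and sin at 0 write e^h - 1 - h as x X + y Y with X and Y tending to 0,
    and |x|, |y| are at most |h|. *)
Lemma continuous_exp_quotient h : continuous exp_quotient h.
Proof.
destruct (Req_EM_T (Cmod h) 0) as [E|E].
- apply Cmod_eq_0 in E; subst h.
  destruct (is_derive_slope_ex exp 0 1) as [f [f0 [fc fs]]].
  { pose proof (is_derive_exp 0) as D; rewrite exp_0 in D; exact D. }
  destruct (is_derive_slope_ex cos 0 0) as [g [g0 [gc gs]]].
  { pose proof (is_derive_cos 0) as D; rewrite sin_0, Ropp_0 in D; exact D. }
  destruct (is_derive_slope_ex sin 0 1) as [k [k0 [kc ks]]].
  { pose proof (is_derive_sin 0) as D; rewrite cos_0 in D; exact D. }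
  set (X := fun h : C => RtoC (f (Re h) - 1)%R).
  set (Y := fun h : C => ((g (Im h) * (1 + Re h * f (Re h)))%R,
     (k (Im h) - 1 + Re h * f (Re h) * k (Im h))%R) : C).
  assert (HXY : forall h, (Cmod (exp_quotient h - 1) <= Cmod (X h) + Cmod (Y h))%R).
  { intros h. assert (HXY0 : (0 <= Cmod (X h) + Cmod (Y h))%R)
      by (apply Rplus_le_le_0_compat; apply Cmod_ge_0).
    unfold exp_quotient. destruct (Req_EM_T (Cmod h) 0) as [E|E].
    - replace (1 - 1) with (RtoC 0) by ring. rewrite Cmod_0; exact HXY0.
    - assert (Hh : h <> 0) by (intros ->; apply E, Cmod_0).
      assert (Hp : (0 < Cmod h)%R) by now apply Cmod_gt_0.
      replace ((Cexp h - 1) / h - 1) with ((Re h * X h + Im h * Y h) / h).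
      + rewrite Cmod_div by auto. apply Rmult_le_reg_r with (Cmod h); auto.
        unfold Rdiv; rewrite Rmult_assoc, Rinv_l, Rmult_1_r, Rmult_plus_distr_r by auto.
        eapply Rle_trans; [apply Cmod_triangle|]. rewrite !Cmod_mult, !Cmod_R.
        apply Rplus_le_compat; rewrite Rmult_comm; apply Rmult_le_compat_l;
          auto using Cmod_ge_0, re_le_Cmod, Im_le_Cmod.
      + assert (A : Re h * X h + Im h * Y h = Cexp h - 1 - h).
        { specialize (fs (Re h)); specialize (gs (Im h)); specialize (ks (Im h)).
          rewrite exp_0 in fs; rewrite cos_0 in gs; rewrite sin_0 in ks.
          unfold Cexp. replace (exp (Re h)) with (1 + Re h * f (Re h))%R by lra.
          replace (cos (Im h)) with (1 + Im h * g (Im h))%R by lra.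
          replace (sin (Im h)) with (Im h * k (Im h))%R by lra.
          unfold X, Y; apply C_ext; destruct h; unfold Re, Im; simpl; ring. }
        rewrite A; field; auto. }
  apply filterlim_locally; intros eps.
  assert (H0 : continuous (fun h => Cmod (X h) + Cmod (Y h))%R (RtoC 0)).
  { assert (cRe : continuous Re (RtoC 0)) by (apply (continuous_Re (fun y => y)), continuous_id).
    assert (cIm : continuous Im (RtoC 0)) by (apply (continuous_Im (fun y => y)), continuous_id).
    assert (cf : continuous (fun h : C => f (Re h)) (RtoC 0)) by (apply (continuous_comp Re f); assumption).
    assert (cg : continuous (fun h : C => g (Im h)) (RtoC 0)) by (apply (continuous_comp Im g); assumption).
    assert (ck : continuous (fun h : C => k (Im h)) (RtoC 0)) by (apply (continuous_comp Im k); assumption).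
    apply (continuous_plus (V := R_NormedModule)).
    - apply (continuous_comp X Cmod); [|apply continuous_Cmod]. apply continuous_RtoC.
      apply (continuous_minus (V := R_NormedModule)); [assumption|apply continuous_const].
    - apply (continuous_comp Y Cmod); [|apply continuous_Cmod]. apply continuous_C_pair.
      + apply continuous_Rmult; auto.
        apply (continuous_plus (V := R_NormedModule)); [apply continuous_const|now apply continuous_Rmult].
      + apply (continuous_plus (V := R_NormedModule)); [|repeat apply continuous_Rmult; assumption].
        apply (continuous_minus (V := R_NormedModule)); [assumption|apply continuous_const]. }
  assert (E0 : (Cmod (X 0) + Cmod (Y 0) = 0)%R).
  { unfold X, Y. cbn [Re Im RtoC fst snd]. rewrite f0, g0, k0.
    replace (_, _) with (RtoC 0) by (apply C_ext; simpl; ring).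
    rewrite Rminus_diag, Cmod_0; ring. }
  pose proof (proj1 (filterlim_locally _ _) H0 eps) as H1.
  revert H1; apply filter_imp; intros h Hh.
  change (Rabs ((Cmod (X h) + Cmod (Y h)) - (Cmod (X 0) + Cmod (Y 0))) < eps)%R in Hh.
  rewrite E0, Rminus_0_r in Hh. apply Rabs_def2 in Hh.
  apply C_NormedModule_mixin_compat1.
  change (Cmod (exp_quotient h - exp_quotient 0) < eps)%R.
  replace (exp_quotient 0) with (RtoC 1). 2:{ unfold exp_quotient; destruct (Req_EM_T (Cmod 0) 0) as [|E]; auto. now rewrite Cmod_0 in E. }
  specialize (HXY h); lra.
- apply continuous_ext_loc with (fun h => (Cexp h - 1) / h).
  + assert (H : locally h (fun h : C => h <> RtoC 0)).
    { apply (locally_neq_0 (fun h : C => h)); [apply continuous_id|]. intros ->; apply E, Cmod_0. }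
    revert H; apply filter_imp; intros y Hy. unfold exp_quotient; destruct (Req_EM_T (Cmod y) 0) as [E'|E']; auto.
    now apply Cmod_eq_0 in E'.
  + apply continuous_Cdiv; [intros ->; apply E, Cmod_0| |apply continuous_id].
    apply continuous_Cminus; [apply continuous_Cexp|apply continuous_const].
Qed.

Lemma holo_Cexp x : holo Cexp x.
Proof.
exists (fun p => Cexp (fst p) * exp_quotient (snd p - fst p)).
apply filter_forall; intros p; split.
- destruct p as [a b]; cbn [fst snd].
  replace (Cexp b) with (Cexp a * Cexp (b - a)) by (rewrite <- Cexp_plus; f_equal; ring).
  transitivity (Cexp a * (Cexp (b - a) - 1)); [ring|rewrite exp_quotient_spec; ring].
- apply continuous_Cmult.
  + apply (continuous_comp (fun p : C * C => fst p) Cexp); [apply continuous_proj1|apply continuous_Cexp].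
  + apply (continuous_comp (fun p : C * C => snd p - fst p) exp_quotient); [|apply continuous_exp_quotient].
    apply continuous_Cminus; [apply continuous_proj2|apply continuous_proj1].
Qed.

Lemma holo_Cexp_lin c x : holo (fun w => Cexp (c * w)) x.
Proof. apply (holo_comp Cexp (fun w => c * w)); [apply holo_lin|apply holo_Cexp]. Qed.

(** * Complex-valued integrals and Cauchy's theorem on a strip *)
Definition is_CInt (f : R -> C) (a b : R) (l : C) : Prop :=
  is_RInt (V := C_R_NormedModule) f a b l.

Lemma is_CInt_pair f a b l :
  is_RInt (fun t => Re (f t)) a b (Re l) -> is_RInt (fun t => Im (f t)) a b (Im l) ->
  is_CInt f a b l.
Proof.
intros H1 H2; destruct l as [l1 l2].
exact (is_RInt_fct_extend_pair (U := R_NormedModule) (V := R_NormedModule) f a b l1 l2 H1 H2).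
Qed.

Lemma is_CInt_Re f a b l : is_CInt f a b l -> is_RInt (fun t => Re (f t)) a b (Re l).
Proof. exact (is_RInt_fct_extend_fst (U := R_NormedModule) (V := R_NormedModule) f a b l). Qed.

Lemma is_CInt_Im f a b l : is_CInt f a b l -> is_RInt (fun t => Im (f t)) a b (Im l).
Proof. exact (is_RInt_fct_extend_snd (U := R_NormedModule) (V := R_NormedModule) f a b l). Qed.

Lemma is_CInt_scal c f a b l : is_CInt f a b l -> is_CInt (fun t => c * f t) a b (c * l).
Proof.
intros H. pose proof (is_CInt_Re _ _ _ _ H) as H1. pose proof (is_CInt_Im _ _ _ _ H) as H2.
apply is_CInt_pair.
- apply (is_RInt_minus (V := R_NormedModule)); now apply (is_RInt_scal (V := R_NormedModule)).
- apply (is_RInt_plus (V := R_NormedModule)); now apply (is_RInt_scal (V := R_NormedModule)).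
Qed.

Lemma is_CInt_minus f g a b l m : is_CInt f a b l -> is_CInt g a b m ->
  is_CInt (fun t => f t - g t) a b (l - m).
Proof. exact (is_RInt_minus (V := C_R_NormedModule) f g a b l m). Qed.

Lemma is_CInt_ext f g a b l : (a <= b)%R -> (forall t, (a <= t <= b)%R -> f t = g t) ->
  is_CInt f a b l -> is_CInt g a b l.
Proof.
intros Hab H; apply is_RInt_ext. rewrite Rmin_left, Rmax_right by auto.
intros t Ht; apply H; lra.
Qed.

Lemma is_CInt_continuous (f : R -> C) a b : (a <= b)%R -> 
  (forall t, (a <= t <= b)%R -> continuous f t) ->
  is_CInt f a b (RInt (V := C_R_CompleteNormedModule) f a b).
Proof.
intros Hab H. apply (RInt_correct (V := C_R_CompleteNormedModule)).
apply ex_RInt_continuous. rewrite Rmin_left, Rmax_right by auto. exact H.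
Qed.

Lemma is_CInt_unique f a b l : is_CInt f a b l -> RInt (V := C_R_CompleteNormedModule) f a b = l.
Proof. apply (is_RInt_unique (V := C_R_CompleteNormedModule)). Qed.

Lemma is_CInt_derive (f df : R -> C) a b : (a <= b)%R ->
  (forall t, (a <= t <= b)%R -> is_derive (fun y => Re (f y)) t (Re (df t)) /\
     is_derive (fun y => Im (f y)) t (Im (df t)) /\ continuous df t) ->
  is_CInt df a b (f b - f a).
Proof.
intros Hab H. apply is_CInt_pair.
- apply (is_RInt_derive (V := R_CompleteNormedModule) (fun t => Re (f t)) (fun t => Re (df t)));
  rewrite Rmin_left, Rmax_right by auto; intros t Ht; [now apply H|now apply continuous_Re, H].
- apply (is_RInt_derive (V := R_CompleteNormedModule) (fun t => Im (f t)) (fun t => Im (df t)));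
  rewrite Rmin_left, Rmax_right by auto; intros t Ht; [now apply H|now apply continuous_Im, H].
Qed.

(** By compactness of the segment, one neighbourhood of [t0] serves all [s]; parametric
    differentiation asks for this. *)
Lemma locally_tube (P : R -> R -> Prop) (t0 a b : R) :
  (forall s, (a <= s <= b)%R -> locally (t0, s) (fun z : R * R => P (fst z) (snd z))) ->
  locally t0 (fun t => forall s, (a <= s <= b)%R -> P t s).
Proof.
intros H.
assert (H' : forall s, exists d : posreal, (a <= s <= b)%R ->
  forall t s', (Rabs (t - t0) < d)%R -> (Rabs (s' - s) < d)%R -> P t s').
{ intros s. destruct (Rle_dec a s) as [Ha|Ha]; [destruct (Rle_dec s b) as [Hb|Hb]|].
  - destruct (H s (conj Ha Hb)) as [d Hd]. exists d; intros _ t s' Ht Hs.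
    apply (Hd (t, s')); split; assumption.
  - exists (mkposreal 1 Rlt_0_1); intros; lra.
  - exists (mkposreal 1 Rlt_0_1); intros; lra. }
set (delta := fun s => proj1_sig (constructive_indefinite_description _ (H' s))).
destruct (compactness_value_1d a b delta) as [d Hd].
exists d; intros t Ht s Hs. change (Rabs (t - t0) < d)%R in Ht.
destruct (classic (P t s)) as [|Hn]; [assumption|exfalso].
apply (Hd s Hs); intros [s1 [Hs1 [H1 H2]]]. apply Hn.
unfold delta in H1, H2.
destruct (constructive_indefinite_description _ (H' s1)) as [e He]; simpl in *.
apply (He Hs1); [lra|exact H1].
Qed.

Lemma continuous_comp_fst (f : R -> R) (z : R * R) : continuous f (fst z) ->
  continuous (fun z : R * R => f (fst z)) z.
Proof. intros; apply (continuous_comp (fun z : R * R => fst z) f); [apply continuous_proj1|assumption]. Qed.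

Lemma continuous_logpt {T : UniformSpace} (logq : C) (t v : T -> R) (x : T) :
  continuous t x -> continuous v x -> continuous (fun y => logpt logq (t y) (v y)) x.
Proof.
intros Ht Hv; unfold logpt. apply continuous_Cminus; apply continuous_Cmult;
 try apply continuous_const; now apply continuous_RtoC.
Qed.

Lemma continuous_section (f : R * R -> C) (t s : R) :
  continuous f (t, s) -> continuous (fun s => f (t, s)) s.
Proof. intros H; apply (continuous_comp (fun s => (t, s)) f); [apply continuous_pair_r|exact H]. Qed.

(** Differentiation under the integral sign; [part] is the real or the imaginary
    part, since the theorem on parametric integrals is about real functions. *)
Lemma is_derive_RInt_holo (part : C -> R) (F Ft : R -> R -> C) (t0 a b : R) : (a <= b)%R ->
  (forall x, continuous part x) ->
  (forall s, (a <= s <= b)%R -> locally (t0, s) (fun z : R * R =>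
    is_derive (fun t => part (F t (snd z))) (fst z) (part (Ft (fst z) (snd z))) /\
    continuous (fun z : R * R => F (fst z) (snd z)) z /\
    continuous (fun z : R * R => Ft (fst z) (snd z)) z)) ->
  is_derive (fun t => RInt (fun s => part (F t s)) a b) t0
    (RInt (fun s => part (Ft t0 s)) a b).
Proof.
intros Hab Cp H.
set (P := fun t s => is_derive (fun t => part (F t s)) t (part (Ft t s)) /\
    continuous (fun z : R * R => F (fst z) (snd z)) (t, s) /\
    continuous (fun z : R * R => Ft (fst z) (snd z)) (t, s)).
assert (HP : forall s, (a <= s <= b)%R -> locally (t0, s) (fun z : R * R => P (fst z) (snd z))).
{ intros s Hs; generalize (H s Hs); apply filter_imp; intros [t s']; exact (fun x => x). }
pose proof (locally_tube P t0 a b HP) as HT.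
assert (HT0 := locally_singleton _ _ HT).
replace (RInt (fun s => part (Ft t0 s)) a b) with
  (RInt (fun s => Derive (fun t => part (F t s)) t0) a b).
2:{ apply RInt_ext. rewrite Rmin_left, Rmax_right by auto. intros s Hs.
    apply is_derive_unique, HT0; lra. }
apply is_derive_RInt_param; rewrite ?Rmin_left, ?Rmax_right by auto.
- revert HT; apply filter_imp; intros t Ht s Hs. eexists; apply (Ht s Hs).
- intros s Hs. apply continuity_2d_pt_ext_loc with (fun t s => part (Ft t s)).
  + apply locally_2d_locally. generalize (HP s Hs); apply filter_imp; intros z Hz.
    symmetry; apply is_derive_unique, Hz.
  + apply continuity_2d_pt_filterlim.
    apply (continuous_comp (fun z : R * R => Ft (fst z) (snd z)) part); [apply (HT0 s Hs)|apply Cp].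
- revert HT; apply filter_imp; intros t Ht.
  apply (ex_RInt_continuous (V := R_CompleteNormedModule)).
  rewrite Rmin_left, Rmax_right by auto. intros s Hs.
  apply (continuous_comp (fun s => F t s) part); [|apply Cp].
  apply (continuous_section (fun z => F (fst z) (snd z)) t s), (Ht s Hs).
Qed.

(** Cauchy's theorem for the strip between the curve v = u t and its translate
    v = u t - 1.  Let g t be the integral of f across the strip at abscissa t.
    With gamma t s = log z at the point (t, u t - 1 + s), both partial derivatives of
    f (gamma t s) are multiples of f': the t-derivative has the factor Ci - u' logq and the
    s-derivative the factor -logq.  Hence g' is -(Ci - u' logq) / logq times the difference of
    the values of f on the two sides, and it remains to integrate g'. *)
Lemma cauchy_strip (f : C -> C) (logq : C) (u : R -> R) (a b : R) : (a <= b)%R ->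
  logq <> 0 ->
  (forall t, ex_derive u t /\ continuous (Derive u) t) ->
  (forall t s, (a <= t <= b)%R -> (0 <= s <= 1)%R -> holo f (logpt logq t (u t - 1 + s))) ->
  is_CInt (fun t => (f (logpt logq t (u t)) - f (logpt logq t (u t - 1)))
     * (Ci - Derive u t * logq)) a b
   (- logq * (RInt (V := C_R_CompleteNormedModule) (fun s => f (logpt logq b (u b - 1 + s))) 0 1
    - RInt (V := C_R_CompleteNormedModule) (fun s => f (logpt logq a (u a - 1 + s))) 0 1)).
Proof.
intros Hab Hq Hu Hf.
set (gam := fun t s => logpt logq t (u t - 1 + s)).
set (kap := fun t => Ci - Derive u t * logq).
assert (Cu : forall t, continuous u t) by (intros t; apply (ex_derive_continuous u), Hu).
assert (Cgam : forall z, continuous (fun z : R * R => gam (fst z) (snd z)) z).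
{ intros z; apply continuous_logpt; [apply continuous_proj1|].
  apply (continuous_plus (V := R_NormedModule)); [|apply continuous_proj2].
  apply (continuous_minus (V := R_NormedModule)); [|apply continuous_const].
  now apply continuous_comp_fst. }
assert (Ckap : forall t, continuous kap t).
{ intros t; apply continuous_Cminus; [apply continuous_const|].
  apply continuous_Cmult; [|apply continuous_const]. now apply continuous_RtoC, Hu. }
assert (Dt : forall t s, holo f (gam t s) ->
  is_derive (fun t => Re (f (gam t s))) t (Re (Cderive f (gam t s) * kap t)) /\
  is_derive (fun t => Im (f (gam t s))) t (Im (Cderive f (gam t s) * kap t))).
{ intros t s H. destruct (is_derive_slope_ex u t (Derive u t)) as [U [U0 [Uc Us]]].
  { apply Derive_correct, Hu. }
  unfold kap; rewrite <- U0.
  apply (holo_curve f (fun t => gam t s) (fun t => Ci - U t * logq)); auto.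
  - apply filter_forall; intros y. unfold gam, logpt.
    specialize (Us y). replace (u y) with (u t + (y - t) * U y)%R by lra.
    rewrite !RtoC_plus, !RtoC_minus, !RtoC_plus, RtoC_mult, RtoC_minus; ring.
  - apply continuous_Cminus; [apply continuous_const|].
    apply continuous_Cmult; [now apply continuous_RtoC|apply continuous_const]. }
assert (Ds : forall t s, holo f (gam t s) ->
  is_derive (fun s => Re (f (gam t s))) s (Re (Cderive f (gam t s) * - logq)) /\
  is_derive (fun s => Im (f (gam t s))) s (Im (Cderive f (gam t s) * - logq))).
{ intros t s H.
  apply (holo_curve f (fun s => gam t s) (fun s => - logq)); auto.
  - apply filter_forall; intros y. unfold gam, logpt.
    rewrite !RtoC_plus, !RtoC_minus; ring.
  - apply continuous_const. }
assert (Hloc : forall t s, (a <= t <= b)%R -> (0 <= s <= 1)%R ->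
  locally (t, s) (fun z : R * R => holo f (gam (fst z) (snd z)))).
{ intros t s Ht Hs. apply (locally_comp (fun z : R * R => gam (fst z) (snd z)) (t, s) (holo f)); auto.
  now apply holo_locally, Hf. }
set (g := fun t => RInt (V := C_R_CompleteNormedModule) (fun s => f (gam t s)) 0 1).
set (dg := fun t => - kap t / logq * (f (gam t 1) - f (gam t 0))).
assert (Cs : forall t s, (a <= t <= b)%R -> (0 <= s <= 1)%R -> continuous (fun s => f (gam t s)) s).
{ intros t s Ht Hs. apply (continuous_comp (fun s => gam t s) f).
  - apply (continuous_section (fun z => gam (fst z) (snd z))), Cgam.
  - now apply holo_continuous, Hf. }
assert (Ig : forall t, (a <= t <= b)%R -> is_CInt (fun s => f (gam t s)) 0 1 (g t)).
{ intros t Ht; apply is_CInt_continuous; [lra|]. auto. }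
assert (Idg : forall t, (a <= t <= b)%R ->
   is_CInt (fun s => Cderive f (gam t s) * kap t) 0 1 (dg t)).
{ intros t Ht. unfold dg.
  apply is_CInt_ext with (fun s => - kap t / logq * (Cderive f (gam t s) * - logq)); [lra| |].
  - intros s Hs; field; auto.
  - apply is_CInt_scal, (is_CInt_derive (fun s => f (gam t s))); [lra|].
    intros s Hs. split; [|split]; try (apply Ds, Hf; assumption).
    apply continuous_Cmult; [|apply continuous_const].
    apply (continuous_comp (fun s => gam t s) (Cderive f)).
    + apply (continuous_section (fun z => gam (fst z) (snd z))), Cgam.
    + now apply continuous_Cderive, Hf. }
assert (Hparam : forall part : C -> R, (forall x, continuous part x) ->
  (forall t s, holo f (gam t s) -> 
   is_derive (fun t => part (f (gam t s))) t (part (Cderive f (gam t s) * kap t))) ->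
  forall t, (a <= t <= b)%R ->
   is_derive (fun t => RInt (fun s => part (f (gam t s))) 0 1) t
    (RInt (fun s => part (Cderive f (gam t s) * kap t)) 0 1)).
{ intros part Cp Dp t Ht.
  apply (is_derive_RInt_holo part (fun t s => f (gam t s)) (fun t s => Cderive f (gam t s) * kap t));
   [lra|exact Cp|].
  intros s Hs. generalize (Hloc t s Ht Hs); apply filter_imp; intros z Hz.
  split; [|split].
  - now apply Dp.
  - apply (continuous_comp (fun z : R * R => gam (fst z) (snd z)) f); auto. now apply holo_continuous.
  - apply continuous_Cmult.
    + apply (continuous_comp (fun z : R * R => gam (fst z) (snd z)) (Cderive f)); auto.
      now apply continuous_Cderive.
    + apply (continuous_comp (fun z : R * R => fst z) kap); auto. apply continuous_proj1. }
assert (Hg : is_CInt dg a b (g b - g a)).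
{ set (g' := fun t => (RInt (fun s => Re (f (gam t s))) 0 1, RInt (fun s => Im (f (gam t s))) 0 1) : C).
  assert (Eg : forall t, (a <= t <= b)%R -> g t = g' t).
  { intros t Ht; apply C_ext; symmetry; apply is_RInt_unique;
    [apply (is_CInt_Re (fun s => f (gam t s)))|apply (is_CInt_Im (fun s => f (gam t s)))]; now apply Ig. }
  rewrite (Eg b), (Eg a) by lra.
  apply is_CInt_derive; [exact Hab|]. intros t Ht. split; [|split].
  - replace (Re (dg t)) with (RInt (fun s => Re (Cderive f (gam t s) * kap t)) 0 1).
    + apply (Hparam Re); auto; [|intros; now apply Dt].
      intros x; apply (continuous_Re (fun y => y)), continuous_id.
    + apply is_RInt_unique, (is_CInt_Re (fun s => Cderive f (gam t s) * kap t)); auto.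
  - replace (Im (dg t)) with (RInt (fun s => Im (Cderive f (gam t s) * kap t)) 0 1).
    + apply (Hparam Im); auto; [|intros; now apply Dt].
      intros x; apply (continuous_Im (fun y => y)), continuous_id.
    + apply is_RInt_unique, (is_CInt_Im (fun s => Cderive f (gam t s) * kap t)); auto.
  - assert (Cf : forall s, (0 <= s <= 1)%R -> continuous (fun t => f (gam t s)) t).
    { intros s Hs. apply (continuous_comp (fun t => gam t s) f); [|now apply holo_continuous, Hf].
      apply continuous_logpt; [apply continuous_id|].
      apply (continuous_plus (V := R_NormedModule)); [|apply continuous_const].
      apply (continuous_minus (V := R_NormedModule)); [apply Cu|apply continuous_const]. }
    apply continuous_Cmult.
    + apply continuous_Cmult; [now apply continuous_Copp|apply continuous_const].
    + apply continuous_Cminus; apply Cf; lra. }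
apply is_CInt_ext with (fun t => - logq * dg t); [exact Hab| |].
- intros t Ht. unfold dg, kap, gam.
  replace (u t - 1 + 1)%R with (u t) by ring. replace (u t - 1 + 0)%R with (u t - 1)%R by ring.
  field; auto.
- now apply is_CInt_scal.
Qed.

(** * A partial fraction identity *)
Lemma Csum_S (f : nat -> C) (n : nat) :
  sum_n_m f 1 (S n) = sum_n_m f 1 n + f (S n).
Proof. rewrite sum_n_Sm by lia; reflexivity. Qed.

Lemma Csum_0 (f : nat -> C) : sum_n_m f 1 0 = RtoC 0.
Proof. rewrite sum_n_m_zero by lia; reflexivity. Qed.

Lemma Csum_scal (k : C) (f : nat -> C) n :
  k * sum_n_m f 1 n = sum_n_m (fun i => k * f i) 1 n.
Proof. symmetry; exact (sum_n_m_mult_l (K := C_Ring) k f 1 n). Qed.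

Lemma Csum_minus (f g : nat -> C) n :
  sum_n_m f 1 n - sum_n_m g 1 n = sum_n_m (fun i => f i - g i) 1 n.
Proof.
induction n as [|n IH]; [rewrite !Csum_0; ring|]. rewrite !Csum_S, <- IH; ring.
Qed.

Lemma Csum_ext (f g : nat -> C) n : (forall i, (1 <= i <= n)%nat -> f i = g i) ->
  sum_n_m f 1 n = sum_n_m g 1 n.
Proof. intros H; apply sum_n_m_ext_loc; exact H. Qed.

Definition indices_except (n i : nat) : list nat :=
  filter (fun j => negb (Nat.eqb j i)) (seq 1 n).

Lemma indices_except_S n i : i <> S n -> indices_except (S n) i = indices_except n i ++ S n :: nil.
Proof.
intros H. unfold indices_except. rewrite seq_S, filter_app. cbn [filter Nat.add].
destruct (Nat.eqb_spec (S n) i); [congruence|reflexivity].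
Qed.

Lemma indices_except_last n : indices_except (S n) (S n) = seq 1 n.
Proof.
unfold indices_except. rewrite seq_S, filter_app. cbn [filter Nat.add]. rewrite Nat.eqb_refl; cbn [negb].
rewrite app_nil_r. apply forallb_filter_id. apply forallb_forall; intros x Hx.
apply in_seq in Hx. destruct (Nat.eqb_spec x (S n)); [lia|reflexivity].
Qed.

Lemma in_indices_except n i j : In j (indices_except n i) -> (1 <= j <= n)%nat /\ j <> i.
Proof.
unfold indices_except; rewrite filter_In, in_seq; intros [H1 H2]; split; [lia|].
destruct (Nat.eqb_spec j i); [discriminate|assumption].
Qed.

(** The coefficient of 1 / (1 - c_i z) in the expansion below, up to sign. *)
Definition pfcoef (n : nat) (c a : nat -> C) (i : nat) : C :=
  Cprod (seq 1 n) (fun j => 1 - c i * a j) / Cprod (indices_except n i) (fun j => 1 - c i * / c j).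

Lemma one_minus_div_neq_0 (x y : C) : y <> 0 -> x <> y -> 1 - x * / y <> 0.
Proof.
intros Hy Hxy E. apply Hxy.
replace x with (y - (1 - x * / y) * y) by (field; auto). rewrite E; ring.
Qed.

Lemma sub_neq_0 (x y : C) : x <> y -> y - x <> 0.
Proof. intros H E. apply H. replace x with (y - (y - x)) by ring. rewrite E; ring. Qed.

(** Induction on the number of factors.  Multiplying 1 / (1 - c_i z) by the new factor gives a
    combination of 1 / (1 - c_i z) and 1 / (1 - c z); the total coefficient of the latter
    is the old product evaluated at z = 1 / c, which the induction hypothesis
    turns back into a product. *)
Lemma partial_fractions (n : nat) (c a : nat -> C) :
  (forall i, (1 <= i <= n)%nat -> c i <> 0) ->
  (forall i j, (1 <= i <= n)%nat -> (1 <= j <= n)%nat -> i <> j -> c i <> c j) ->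
  forall z, (forall i, (1 <= i <= n)%nat -> 1 - c i * z <> 0) ->
  Cprod (seq 1 n) (fun j => c j * (a j - z) / (1 - c j * z)) =
  1 - sum_n_m (fun i => pfcoef n c a i / (1 - c i * z)) 1 n.
Proof.
induction n as [|n IH]; intros Hc Hd z Hz.
- rewrite Csum_0; simpl; ring.
- assert (IH' := IH (fun i Hi => Hc i ltac:(lia)) (fun i j Hi Hj => Hd i j ltac:(lia) ltac:(lia))).
  clear IH. rewrite Cprod_S, Csum_S. change (1 + n)%nat with (S n).
  set (cc := c (S n)) in *. set (aa := a (S n)).
  assert (Hcc : cc <> 0) by (apply Hc; lia).
  assert (Hzz : 1 - cc * z <> 0) by (apply Hz; lia).
  assert (Hic : forall i, (1 <= i <= n)%nat -> 1 - c i * / cc <> 0).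
  { intros i Hi; apply one_minus_div_neq_0; auto. apply (Hd i (S n)); lia. }
  (* up to the factor 1 - cc * aa, the new coefficient is the old product at z = 1 / cc *)
  assert (Elast : pfcoef (S n) c a (S n) = (1 - cc * aa) *
    (1 - sum_n_m (fun i => pfcoef n c a i / (1 - c i * / cc)) 1 n)).
  { rewrite <- IH' by auto. unfold pfcoef. rewrite indices_except_last, Cprod_S.
    change (1 + n)%nat with (S n). fold cc aa. unfold Cdiv at 1.
    rewrite (Cmult_comm (Cprod _ _)), <- Cmult_assoc. f_equal.
    rewrite <- Cprod_inv, <- Cprod_mult.
    - apply Cprod_ext; intros j Hj; apply in_seq in Hj.
      assert (c j <> 0) by (apply Hc; lia).
      assert (cc <> c j) by (apply not_eq_sym; apply (Hd j (S n)); lia).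
      field. repeat split; auto using sub_neq_0.
    - intros j Hj; apply in_seq in Hj. apply one_minus_div_neq_0; [apply Hc; lia|].
      apply (Hd (S n) j); lia. }
  rewrite Elast, IH' by (intros; apply Hz; lia).
  assert (E : sum_n_m (fun i => pfcoef (S n) c a i / (1 - c i * z)) 1 n =
    cc * (aa - z) / (1 - cc * z) * sum_n_m (fun i => pfcoef n c a i / (1 - c i * z)) 1 n
    - - ((1 - cc * aa) / (1 - cc * z)) * sum_n_m (fun i => pfcoef n c a i / (1 - c i * / cc)) 1 n).
  { rewrite !Csum_scal, Csum_minus. apply Csum_ext; intros i Hi.
    assert (Hi' : 1 - c i * z <> 0) by (apply Hz; lia).
    unfold pfcoef. rewrite indices_except_S, Cprod_S, Cprod_app by lia.
    change (1 + n)%nat with (S n). fold aa.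
    replace (Cprod (S n :: nil) (fun j => 1 - c i * / c j)) with (1 - c i * / cc)
      by (unfold Cprod, cc; simpl; ring).
    assert (Ho : Cprod (indices_except n i) (fun j => 1 - c i * / c j) <> 0).
    { apply Cprod_neq_0; intros j Hj; apply in_indices_except in Hj. apply one_minus_div_neq_0.
      - apply Hc; lia.
      - apply Hd; lia. }
    pose proof (Hic i Hi) as Hi2.
    assert (c i <> cc) by (apply (Hd i (S n)); lia).
    field. repeat split; auto using sub_neq_0. }
  rewrite E. field; auto.
Qed.

(** The factor by which the function whose q-difference is taken differs from the
    common part of the integrands; see [integrand_difference]. *)
Definition inner_factor (n : nat) (c a : nat -> C) (z : C) : C :=
  z ^ S n * Cprod (seq (S n) (S n + 1)) (fun m => 1 - a m / z)
  / Cprod (seq 1 n) (fun i => 1 - c i * z).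

Lemma Cprod_shift k n f : Cprod (seq (k + 1) n) f = Cprod (seq 1 n) (fun j => f (k + j)%nat).
Proof.
induction n as [|n IH]; [reflexivity|]. rewrite !Cprod_S, IH. f_equal; f_equal; lia.
Qed.

Lemma Cprod_tail n f : Cprod (seq (S n) (S n + 1)) f =
  Cprod (seq 1 n) (fun j => f (n + j)%nat) * f (2 * n + 1)%nat * f (2 * n + 2)%nat.
Proof.
replace (S n + 1)%nat with (S (S n)) by lia. rewrite !Cprod_S.
replace (S n) with (n + 1)%nat by lia. rewrite Cprod_shift. f_equal; [f_equal|]; f_equal; lia.
Qed.

(** All but two of the N + 1 numerator factors are paired with the N - 1
    denominator factors, so that [partial_fractions] applies; the last two numerator
    factors and 1 / z remain. *)
Lemma inner_factor_eq (n : nat) (c a : nat -> C) (z : C) :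
  (forall i, (1 <= i <= n)%nat -> c i <> 0) ->
  z <> 0 -> (forall i, (1 <= i <= n)%nat -> 1 - c i * z <> 0) ->
  inner_factor n c a z = / Cprod (seq 1 n) (fun j => - c j) *
   ((z - a (2 * n + 1)%nat) * (z - a (2 * n + 2)%nat) / z *
    Cprod (seq 1 n) (fun j => c j * (a (n + j)%nat - z) / (1 - c j * z))).
Proof.
intros Hc H0 Hz. unfold inner_factor. rewrite Cprod_tail.
assert (E : Cprod (seq 1 n) (fun j => c j * (a (n + j)%nat - z) / (1 - c j * z)) =
  Cprod (seq 1 n) (fun j => - c j) * z ^ n * Cprod (seq 1 n) (fun j => 1 - a (n + j)%nat / z)
  * / Cprod (seq 1 n) (fun i => 1 - c i * z)).
{ rewrite <- Cprod_inv by (intros i Hi; apply in_seq in Hi; apply Hz; lia).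
  replace (z ^ n) with (Cprod (seq 1 n) (fun _ => z)) by (rewrite Cprod_const, length_seq; reflexivity).
  rewrite <- !Cprod_mult. apply Cprod_ext; intros j Hj; apply in_seq in Hj.
  assert (1 - c j * z <> 0) by (apply Hz; lia). field; auto. }
rewrite E, Cpow_S.
assert (Cprod (seq 1 n) (fun j => - c j) <> 0).
{ apply Cprod_neq_0; intros j Hj E'; apply in_seq in Hj. apply (Hc j); [lia|].
  replace (c j) with (- - c j) by ring. rewrite E'; ring. }
assert (Cprod (seq 1 n) (fun i => 1 - c i * z) <> 0).
{ apply Cprod_neq_0; intros i Hi; apply in_seq in Hi; apply Hz; lia. }
field; auto.
Qed.

(** The antisymmetric part of an expansion A z + B + D / z + sum E_i / (1 - c_i z) is
    (A - D) (z - 1/z) + sum E_i c_i (z - 1/z) / ((1 - c_i z)(1 - c_i / z)), so B drops out.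
    The constant A - D comes from the value of the partial fractions at z = 0. *)
Lemma inner_factor_antisym (n : nat) (c a : nat -> C) (z : C) :
  (forall i, (1 <= i <= n)%nat -> c i <> 0) ->
  (forall i j, (1 <= i <= n)%nat -> (1 <= j <= n)%nat -> i <> j -> c i <> c j) ->
  z <> 0 ->
  (forall i, (1 <= i <= n)%nat -> 1 - c i * z <> 0) ->
  (forall i, (1 <= i <= n)%nat -> 1 - c i / z <> 0) ->
  inner_factor n c a z - inner_factor n c a (/ z) =
  / Cprod (seq 1 n) (fun j => - c j) * (z - / z) *
  (1 - Cprod (seq 1 n) c * Cprod (seq (S n) (S n + 1)) a
   - sum_n_m (fun i => Cprod (seq (S n) (S n + 1)) (fun m => 1 - c i * a m)
        / Cprod (indices_except n i) (fun j => 1 - c i * / c j)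
        / ((1 - c i * z) * (1 - c i / z))) 1 n).
Proof.
intros Hc Hd H0 Hz Hz'.
assert (H0' : / z <> 0) by (intros E; apply (f_equal (Cmult z)) in E; rewrite Cinv_r in E by auto;
  apply (f_equal Re) in E; rewrite Cmult_0_r in E; simpl in E; lra).
set (a' := fun j => a (n + j)%nat).
rewrite !inner_factor_eq by auto.
pose proof (partial_fractions n c a' Hc Hd) as PF.
assert (P0 := PF 0).
assert (PZ : forall x, Cprod (seq 1 n) (fun j => c j * (a (n + j)%nat - x) / (1 - c j * x)) =
  Cprod (seq 1 n) (fun j => c j * (a' j - x) / (1 - c j * x))) by reflexivity.
rewrite (PZ z), (PZ (/ z)), (PF z Hz), (PF (/ z) Hz').
set (x := a (2 * n + 1)%nat). set (y := a (2 * n + 2)%nat).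
set (S1 := sum_n_m (fun i => pfcoef n c a' i / (1 - c i * z)) 1 n : C).
set (S2 := sum_n_m (fun i => pfcoef n c a' i / (1 - c i * / z)) 1 n : C).
assert (ES : sum_n_m (pfcoef n c a') 1 n = 1 - Cprod (seq 1 n) c * Cprod (seq 1 n) a').
{ rewrite <- Cprod_mult.
  assert (A : forall x y : C, x = 1 - y -> y = 1 - x) by (intros x0 y0 ->; ring).
  assert (N0 : forall k, 1 - k * 0 <> 0).
  { intros k. rewrite Cmult_0_r. intros E; apply (f_equal Re) in E; simpl in E; lra. }
  apply A. transitivity (Cprod (seq 1 n) (fun j => c j * (a' j - 0) / (1 - c j * 0))).
  - apply Cprod_ext; intros j Hj. field.
  - rewrite P0 by auto. apply (f_equal (fun y => 1 - y)).
    apply Csum_ext; intros i Hi; field. }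
rewrite Cprod_tail. fold x y. change (Cprod (seq 1 n) (fun j => a (n + j)%nat)) with (Cprod (seq 1 n) a').
replace (1 - Cprod (seq 1 n) c * (Cprod (seq 1 n) a' * x * y)) with
  (1 - x * y * (1 - sum_n_m (pfcoef n c a') 1 n)) by (rewrite ES; ring).
assert (E : sum_n_m (fun i => Cprod (seq (S n) (S n + 1)) (fun m => 1 - c i * a m)
        / Cprod (indices_except n i) (fun j => 1 - c i * / c j) / ((1 - c i * z) * (1 - c i / z))) 1 n =
  sum_n_m (fun i => (1 - c i * x) * (1 - c i * y) * pfcoef n c a' i / ((1 - c i * z) * (1 - c i / z))) 1 n).
{ apply Csum_ext; intros i Hi. rewrite Cprod_tail. unfold pfcoef. fold x y.
  change (Cprod (seq 1 n) (fun j => 1 - c i * a (n + j)%nat)) with (Cprod (seq 1 n) (fun j => 1 - c i * a' j)).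
  unfold Cdiv; ring. }
rewrite E. clear E.
set (S3 := sum_n_m (fun i => (1 - c i * x) * (1 - c i * y) * pfcoef n c a' i / ((1 - c i * z) * (1 - c i / z))) 1 n : C).
set (S0 := sum_n_m (pfcoef n c a') 1 n : C).
assert (E : (z - x) * (z - y) / z * S1 - (/ z - x) * (/ z - y) / (/ z) * S2 =
  (z - / z) * S3 - (z - / z) * (x * y) * S0).
{ unfold S0, S1, S2, S3. rewrite !Csum_scal, !Csum_minus.
  apply Csum_ext; intros i Hi. specialize (Hz i Hi); specialize (Hz' i Hi).
  assert (z - c i <> 0).
  { intros E; apply Hz'. replace (1 - c i / z) with ((z - c i) / z) by (field; auto). rewrite E; field; auto. }
  field; auto. }
unfold Cdiv in *.
replace ((z - x) * (z - y) * / z * (1 - S1)) with ((z - x) * (z - y) * / z - (z - x) * (z - y) * / z * S1) by ring.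
assert (F : forall K A1 A2 B1 B2 D : C, A2 - B2 = D -> K * (A1 - A2) - K * (B1 - B2) = K * (A1 - B1 - D))
  by (intros K A1 A2 B1 B2 D <-; ring).
replace ((/ z - x) * (/ z - y) * / / z * (1 - S2)) with
  ((/ z - x) * (/ z - y) * / / z - (/ z - x) * (/ z - y) * / / z * S2) by ring.
rewrite (F _ _ _ _ _ _ E). rewrite <- (Cmult_assoc (/ Cprod (seq 1 n) (fun j => - c j))).
apply (f_equal (Cmult _)). field; auto.
Qed.

(** * The integrand and its q-shift *)
Definition theta (p x : C) : C := qpoch x p * qpoch (p / x) p.

Lemma theta_shift (p x : C) : (Cmod p < 1)%R -> p <> 0 -> x <> 0 ->
  theta p (p * x) = - theta p x / x.
Proof.
intros Hp Hp0 Hx. unfold theta.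
replace (p / (p * x)) with (/ x) by (field; auto).
rewrite (qpoch_step (/ x)), (qpoch_step x) by auto.
replace (/ x * p) with (p / x) by (field; auto).
replace (x * p) with (p * x) by ring. field; auto.
Qed.

Definition half (N : nat) : C := RtoC (INR N / 2).
Definition nome (N : nat) (logq : C) : C := qpow logq (half N).

Lemma half_double N : half N + half N = RtoC (INR N).
Proof. unfold half; rewrite <- RtoC_plus; f_equal; field. Qed.

(** The part of the integrand that does not depend on the parameters.
    With y = z^(N/2), the theta function
    theta (y^2) / y equals (z^N; p)(z^(-N); p) / (y - 1/y) away from z^N = 1, and it is
    holomorphic there too. *)
Definition theta_factor (N : nat) (logq w : C) : C :=
  let y := Cexp (half N * w) in theta (nome N logq) (y * y) / y.

Definition polar_product (N : nat) (logq : C) (al ga : nat -> C) (w : C) : C :=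
  Cprod (seq 1 (2 * N)) (fun j =>
    qpoch (al j * Cexp w) (Cexp logq) * qpoch (ga j / Cexp w) (Cexp logq)).

(** A common shape for everything that is integrated: [Phi] is the difference of the
    cases beta = 1 and beta = -1, and the function whose q-difference is taken is the case
    beta = N, with parameters [ga j = q * al j]. *)
Definition integrand (N : nat) (logq : C) (beta : R) (al ga : nat -> C) (w : C) : C :=
  theta_factor N logq w * Cexp (beta * w) / polar_product N logq al ga w.

Lemma Re_logq_neg logq : (Cmod (Cexp logq) < 1)%R -> (Re logq < 0)%R.
Proof. rewrite Cmod_Cexp; intros H. apply exp_lt_inv. now rewrite exp_0. Qed.

Lemma Re_scal (r : R) (z : C) : Re (r * z) = (r * Re z)%R.
Proof. destruct z; unfold Re; simpl; ring. Qed.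

Lemma Cmod_nome N logq : (1 <= N)%nat -> (Cmod (Cexp logq) < 1)%R -> (Cmod (nome N logq) < 1)%R.
Proof.
intros HN Hq. apply Re_logq_neg in Hq. unfold nome, qpow, half.
rewrite Cmod_Cexp, Re_scal, <- exp_0. apply exp_increasing.
apply le_INR in HN; simpl in HN. nra.
Qed.

Lemma Cexp_half_square N w : Cexp (half N * w) * Cexp (half N * w) = Cexp w ^ N.
Proof.
rewrite <- Cexp_plus, <- Cexp_INR, <- half_double; f_equal; ring.
Qed.

Lemma Phi_eq (N : nat) (logq : C) (a : nat -> C) (w : C) :
  (1 <= N)%nat -> (Cmod (Cexp logq) < 1)%R ->
  Phi N logq a w = (Cexp w - / Cexp w) * (theta_factor N logq w / polar_product N logq a a w).
Proof.
intros HN Hq. unfold Phi, theta_factor. cbv zeta. fold (half N). fold (nome N logq).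
change (Cprod (seq 1 (2 * N)) _) with (polar_product N logq a a w).
rewrite <- Cexp_half_square, Cexp_opp. set (y := Cexp (half N * w)). set (z := Cexp w).
assert (Hy : y <> 0) by apply Cexp_neq_0. 
assert (Hp := Cmod_nome N logq HN Hq). set (p := nome N logq) in *.
unfold theta, Cdiv. generalize (/ polar_product N logq a a w); intros D.
rewrite (qpoch_step (/ (y * y))) by auto.
replace (/ (y * y) * p) with (p * / (y * y)) by (field; auto).
destruct (Req_EM_T (Cmod (y - / y)) 0) as [E|E].
(* At z^N = 1 both sides vanish, whatever the value of the quotient, because
   (z^N; p)_oo and theta have a zero there. *)
- apply Cmod_eq_0 in E.
  assert (E1 : y * y = 1).
  { replace (y * y) with (y * (y - / y) + 1) by (field; auto). rewrite E; ring. }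
  rewrite E1, qpoch_1 by auto. ring.
- assert (H : y - / y <> 0) by (intros E'; apply E; rewrite E'; apply Cmod_0).
  assert (Hz : z <> 0) by apply Cexp_neq_0.
  field. repeat split; auto. intros E'; apply H.
  replace (y - / y) with ((y * y - 1) / y) by (field; auto). rewrite E'; field; auto.
Qed.

Lemma Phi_integrand (N : nat) (logq : C) (a : nat -> C) (w : C) :
  (1 <= N)%nat -> (Cmod (Cexp logq) < 1)%R ->
  Phi N logq a w = integrand N logq 1 a a w - integrand N logq (-1) a a w.
Proof.
intros HN Hq. rewrite Phi_eq by auto. unfold integrand.
replace (RtoC (-1) * w) with (- w) by (destruct w; apply C_ext; simpl; ring).
rewrite Cmult_1_l, Cexp_opp. unfold Cdiv; ring.
Qed.

Lemma holo_integrand N logq beta al ga w : (1 <= N)%nat -> (Cmod (Cexp logq) < 1)%R ->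
  polar_product N logq al ga w <> 0 -> holo (integrand N logq beta al ga) w.
Proof.
intros HN Hq HD.
assert (Hp := Cmod_nome N logq HN Hq).
assert (Hy : holo (fun w => Cexp (half N * w)) w) by apply holo_Cexp_lin.
assert (Hyy : holo (fun w => Cexp (half N * w) * Cexp (half N * w)) w) by now apply holo_mult.
unfold integrand, Cdiv. apply holo_mult; [apply holo_mult|].
- unfold theta_factor, theta, Cdiv. apply holo_mult; [apply holo_mult|].
  + apply (holo_comp (fun x => qpoch x (nome N logq)) _ w Hyy). now apply holo_qpoch.
  + apply (holo_comp (fun x => qpoch x (nome N logq))
      (fun w => nome N logq * / (Cexp (half N * w) * Cexp (half N * w))) w); [|now apply holo_qpoch].
    apply holo_mult; [apply holo_const|]. apply holo_inv; auto.
    apply Cmult_neq_0; apply Cexp_neq_0.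
  + apply holo_inv; auto. apply Cexp_neq_0.
- apply holo_Cexp_lin.
- apply holo_inv; auto. unfold polar_product.
  apply (holo_Cprod (seq 1 (2 * N)) (fun j w => qpoch (al j * Cexp w) (Cexp logq) * qpoch (ga j / Cexp w) (Cexp logq))).
  intros j _. apply holo_mult.
  + apply (holo_comp (fun x => qpoch x (Cexp logq)) (fun w => al j * Cexp w)); [|now apply holo_qpoch].
    apply holo_mult; [apply holo_const|apply holo_Cexp].
  + apply (holo_comp (fun x => qpoch x (Cexp logq)) (fun w => ga j * / Cexp w)); [|now apply holo_qpoch].
    apply holo_mult; [apply holo_const|]. apply holo_inv; [apply Cexp_neq_0|apply holo_Cexp].
Qed.

Lemma polar_product_neq_0 N logq al ga w : (Cmod (Cexp logq) < 1)%R ->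
  (forall j k, (1 <= j <= 2 * N)%nat -> 1 - al j * Cexp w * Cexp logq ^ k <> 0 /\
     1 - ga j / Cexp w * Cexp logq ^ k <> 0) -> polar_product N logq al ga w <> 0.
Proof.
intros Hq H. apply Cprod_neq_0; intros j Hj; apply in_seq in Hj.
apply Cmult_neq_0; apply qpoch_neq_0; auto; intros k; apply H; lia.
Qed.

(** The shift by log q multiplies y^2 by p^2, so it is two steps of the quasi-period of
    theta. *)
Lemma theta_factor_shift N logq w : (1 <= N)%nat -> (Cmod (Cexp logq) < 1)%R ->
  theta_factor N logq (w + logq) = theta_factor N logq w / (Cexp logq ^ N * (Cexp w ^ N * Cexp w ^ N)).
Proof.
intros HN Hq. assert (Hp := Cmod_nome N logq HN Hq).
assert (Hp0 : nome N logq <> 0) by apply Cexp_neq_0.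
unfold theta_factor. rewrite Cmult_plus_distr_l, Cexp_plus.
change (Cexp (half N * logq)) with (nome N logq).
rewrite <- (Cexp_half_square N w), <- (Cexp_half_square N logq).
change (Cexp (half N * logq)) with (nome N logq).
assert (Hy : Cexp (half N * w) <> 0) by apply Cexp_neq_0.
set (y := Cexp (half N * w)) in *. set (p := nome N logq) in *.
replace (y * p * (y * p)) with (p * (p * (y * y))) by ring.
rewrite !theta_shift; auto; repeat apply Cmult_neq_0; auto. field; auto.
Qed.

Lemma polar_product_shift N logq al ga w : (Cmod (Cexp logq) < 1)%R ->
  polar_product N logq al ga (w + logq) * Cprod (seq 1 (2 * N)) (fun j => 1 - al j * Cexp w) =
  polar_product N logq al ga w * Cprod (seq 1 (2 * N)) (fun j => 1 - ga j / (Cexp logq * Cexp w)).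
Proof.
intros Hq. unfold polar_product. rewrite <- !Cprod_mult. apply Cprod_ext; intros j _.
rewrite Cexp_plus.
assert (Hw : Cexp w <> 0) by apply Cexp_neq_0.
assert (Hl : Cexp logq <> 0) by apply Cexp_neq_0.
rewrite (qpoch_step (al j * Cexp w)), (qpoch_step (ga j / (Cexp w * Cexp logq))) by auto.
replace (ga j / (Cexp w * Cexp logq) * Cexp logq) with (ga j / Cexp w) by (field; auto).
replace (al j * (Cexp w * Cexp logq)) with (al j * Cexp w * Cexp logq) by ring.
rewrite (Cmult_comm (Cexp logq) (Cexp w)). ring.
Qed.

(** The two finite products are written in powers of 1 / z: both have a limit as z tends to
    infinity, and the quotient of these limits governs the decay of the integrand. *)
Lemma integrand_shift N logq beta al ga w : (1 <= N)%nat -> (Cmod (Cexp logq) < 1)%R ->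
  polar_product N logq al ga w <> 0 -> polar_product N logq al ga (w + logq) <> 0 ->
  integrand N logq beta al ga w * Cprod (seq 1 (2 * N)) (fun j => / Cexp w - al j) =
  integrand N logq beta al ga (w + logq) * (Cexp ((INR N - beta)%R * logq) *
     Cprod (seq 1 (2 * N)) (fun j => 1 - ga j / Cexp logq * / Cexp w)).
Proof.
intros HN Hq H1 H2. pose proof (polar_product_shift N logq al ga w Hq) as E.
unfold integrand. rewrite theta_factor_shift by auto.
rewrite Cmult_plus_distr_l, Cexp_plus.
replace (Cexp ((INR N - beta)%R * logq)) with (Cexp logq ^ N / Cexp (beta * logq)).
2:{ rewrite <- Cexp_INR. unfold Cdiv; rewrite <- Cexp_opp, <- Cexp_plus; f_equal.
    rewrite RtoC_minus; ring. }
assert (Hw : Cexp w <> 0) by apply Cexp_neq_0.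
assert (Hl : Cexp logq <> 0) by apply Cexp_neq_0.
assert (Hb : Cexp (beta * logq) <> 0) by apply Cexp_neq_0.
assert (E1 : Cprod (seq 1 (2 * N)) (fun j => 1 - ga j / (Cexp logq * Cexp w)) =
  Cprod (seq 1 (2 * N)) (fun j => 1 - ga j / Cexp logq * / Cexp w)).
{ apply Cprod_ext; intros j _; field; auto. }
assert (E2 : Cprod (seq 1 (2 * N)) (fun j => 1 - al j * Cexp w) =
  (Cexp w ^ N * Cexp w ^ N) * Cprod (seq 1 (2 * N)) (fun j => / Cexp w - al j)).
{ rewrite <- Cpow_add_r. replace (N + N)%nat with (length (seq 1 (2 * N))) by (rewrite length_seq; lia).
  rewrite <- (Cprod_const (seq 1 (2 * N)) (Cexp w)), <- Cprod_mult.
  apply Cprod_ext; intros j _; field; auto. }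
rewrite E1, E2 in E.
set (P := Cprod _ (fun j => / Cexp w - al j)) in *.
set (Q := Cprod _ (fun j => 1 - ga j / Cexp logq * / Cexp w)) in *.
set (D := polar_product N logq al ga w) in *. set (D' := polar_product N logq al ga (w + logq)) in *.
assert (Hw' : Cexp w ^ N <> 0) by now apply Cpow_nz.
assert (Hl' : Cexp logq ^ N <> 0) by now apply Cpow_nz.
replace Q with (D' * (Cexp w ^ N * Cexp w ^ N * P) / D) by (rewrite E; field; auto).
field; auto.
Qed.

Lemma Cexp_2PI (n : nat) : Cexp (INR n * (2 * PI * Ci)) = 1.
Proof.
rewrite Cexp_INR. replace (Cexp (2 * PI * Ci)) with (RtoC 1); [apply Cpow_1_l|].
apply C_ext; unfold Cexp, Ci, Re, Im; simpl.
- replace (_ * 0 - _ * 1)%R with 0%R by ring.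
  replace (_ + _)%R with (2 * PI)%R by ring. rewrite exp_0, cos_2PI; ring.
- replace (_ * 0 - _ * 1)%R with 0%R by ring.
  replace (_ + _)%R with (2 * PI)%R by ring. rewrite sin_2PI; ring.
Qed.

Lemma Cexp_period (n : nat) w : Cexp (INR n * (w + 2 * PI * Ci)) = Cexp (INR n * w).
Proof. rewrite Cmult_plus_distr_l, Cexp_plus, Cexp_2PI; ring. Qed.

(** z^(N/2) is a single-valued function of z exactly when N is even. *)
Lemma integrand_period N logq n al ga w : Nat.even N = true ->
  integrand N logq (INR n) al ga (w + 2 * PI * Ci) = integrand N logq (INR n) al ga w.
Proof.
intros HN. apply Nat.even_spec in HN. destruct HN as [m ->].
assert (E1 : Cexp (w + 2 * PI * Ci) = Cexp w).
{ pose proof (Cexp_period 1 w) as H. simpl INR in H. now rewrite !Cmult_1_l in H. }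
assert (Eh : half (2 * m) = RtoC (INR m)).
{ unfold half; f_equal; rewrite mult_INR; simpl; field. }
unfold integrand, theta_factor, polar_product. now rewrite E1, Eh, !Cexp_period.
Qed.

(** The parameters of the function h whose q-difference is taken. *)
Definition lowered_head (n : nat) (q : C) (a : nat -> C) : nat -> C :=
  head_tail (S n) (fun j => / q * a j) a.

Lemma seq_split n : seq 1 (2 * S n) = seq 1 n ++ seq (S n) (S n + 1).
Proof. rewrite <- seq_app. f_equal; lia. Qed.

Lemma head_tail_lt N x y j : (j < N)%nat -> head_tail N x y j = x j.
Proof. intros H; unfold head_tail. now rewrite (proj2 (Nat.ltb_lt j N) H). Qed.

Lemma head_tail_ge N x y j : (N <= j)%nat -> head_tail N x y j = y j.
Proof. intros H; unfold head_tail. now rewrite (proj2 (Nat.ltb_ge j N) H). Qed.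

Lemma polar_product_lowered n logq a w : (Cmod (Cexp logq) < 1)%R ->
  let q := Cexp logq in let c := fun j => / q * a j in let al := lowered_head n q a in
  polar_product (S n) logq al (fun j => q * al j) w * Cprod (seq (S n) (S n + 1)) (fun m => 1 - a m / Cexp w) =
  polar_product (S n) logq a a w * Cprod (seq 1 n) (fun i => 1 - c i * Cexp w).
Proof.
intros Hq q c al. unfold polar_product. rewrite seq_split, !Cprod_app.
assert (Hw : Cexp w <> 0) by apply Cexp_neq_0.
assert (Hl : q <> 0) by apply Cexp_neq_0.
assert (E1 : Cprod (seq 1 n) (fun j => qpoch (al j * Cexp w) (Cexp logq) * qpoch (q * al j / Cexp w) (Cexp logq)) =
  Cprod (seq 1 n) (fun j => qpoch (a j * Cexp w) (Cexp logq) * qpoch (a j / Cexp w) (Cexp logq)) *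
  Cprod (seq 1 n) (fun i => 1 - c i * Cexp w)).
{ rewrite <- Cprod_mult. apply Cprod_ext; intros j Hj; apply in_seq in Hj.
  unfold al, lowered_head. rewrite head_tail_lt by lia. fold q.
  rewrite (qpoch_step (/ q * a j * Cexp w)) by auto.
  replace (/ q * a j * Cexp w * q) with (a j * Cexp w) by (field; auto).
  replace (q * (/ q * a j) / Cexp w) with (a j / Cexp w) by (field; auto). unfold c; ring. }
assert (E2 : Cprod (seq (S n) (S n + 1)) (fun j => qpoch (a j * Cexp w) (Cexp logq) * qpoch (a j / Cexp w) (Cexp logq)) =
  Cprod (seq (S n) (S n + 1)) (fun j => qpoch (al j * Cexp w) (Cexp logq) * qpoch (q * al j / Cexp w) (Cexp logq)) *
  Cprod (seq (S n) (S n + 1)) (fun m => 1 - a m / Cexp w)).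
{ rewrite <- Cprod_mult. apply Cprod_ext; intros j Hj; apply in_seq in Hj.
  unfold al, lowered_head. rewrite head_tail_ge by lia. fold q.
  rewrite (qpoch_step (a j / Cexp w)) by auto.
  replace (a j / Cexp w * q) with (q * a j / Cexp w) by (field; auto). ring. }
rewrite E1, E2. ring.
Qed.

(** The previous identity under z -> 1 / z. *)
Lemma polar_product_lowered_inv n logq a w : (Cmod (Cexp logq) < 1)%R ->
  let q := Cexp logq in let c := fun j => / q * a j in let al := lowered_head n q a in
  polar_product (S n) logq (fun j => q * al j) al w * Cprod (seq (S n) (S n + 1)) (fun m => 1 - a m / / Cexp w) =
  polar_product (S n) logq a a w * Cprod (seq 1 n) (fun i => 1 - c i * / Cexp w).
Proof.
intros Hq q c al.
assert (S1 : forall x y w, polar_product (S n) logq x y (- w) = polar_product (S n) logq y x w).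
{ intros x y v; unfold polar_product; apply Cprod_ext; intros j _. rewrite Cexp_opp. unfold Cdiv.
  replace (/ / Cexp v) with (Cexp v) by (field; apply Cexp_neq_0). ring. }
pose proof (polar_product_lowered n logq a (- w) Hq) as E; cbv zeta in E.
rewrite !S1, Cexp_opp in E. exact E.
Qed.

(** The heart of the proof.  Put K / D for the part common to all integrands.  The function h is
    K / D times [inner_factor] at z, and its q-shift is K / D times [inner_factor] at 1 / z,
    because the shift exchanges the arguments [al j * z] and [q * al j / z] of the
    denominator with [q * al j * z] and [al j / z].  So the
    difference is antisymmetric under z -> 1 / z up to K / D, and its partial fractions are
    the integrand and its N - 1 contiguous versions. *)
Lemma integrand_difference (n : nat) (logq : C) (a : nat -> C) (w : C) : (Cmod (Cexp logq) < 1)%R ->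
  (forall j, a j <> 0) ->
  (forall i j, (1 <= i <= n)%nat -> (1 <= j <= n)%nat -> i <> j -> a i <> a j) ->
  let q := Cexp logq in let c := fun j => / q * a j in let al := lowered_head n q a in
  let h := integrand (S n) logq (INR (S n)) al (fun j => q * al j) in
  let B := 1 - Cprod (seq 1 n) c * Cprod (seq (S n) (S n + 1)) a in
  B <> 0 ->
  polar_product (S n) logq a a w <> 0 ->
  polar_product (S n) logq al (fun j => q * al j) w <> 0 ->
  polar_product (S n) logq al (fun j => q * al j) (w + logq) <> 0 ->
  (forall i, (1 <= i <= n)%nat -> 1 - c i * Cexp w <> 0 /\ 1 - c i / Cexp w <> 0) ->
  h w - h (w + logq) = / Cprod (seq 1 n) (fun j => - c j) * B *
   (Phi (S n) logq a w - sum_n_m (fun i => 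
      Cprod (seq (S n) (S n + 1)) (fun m => 1 - c i * a m)
        / (B * Cprod (indices_except n i) (fun j => 1 - c i * / c j))
      * Phi (S n) logq (upd a i (c i)) w) 1 n).
Proof.
intros Hq Ha Hd q c al h B HB HD H1 H2 Hc.
assert (HN : (1 <= S n)%nat) by lia.
assert (Hl : q <> 0) by apply Cexp_neq_0.
assert (Hw : Cexp w <> 0) by apply Cexp_neq_0.
assert (Hcn : forall i, c i <> 0).
{ intros i E; apply (Ha i). replace (a i) with (q * c i) by (unfold c; field; auto). rewrite E; ring. }
assert (Hcd : forall i j, (1 <= i <= n)%nat -> (1 <= j <= n)%nat -> i <> j -> c i <> c j).
{ intros i j Hi Hj Hij E. apply (Hd i j Hi Hj Hij).
  replace (a i) with (q * c i) by (unfold c; field; auto). rewrite E. unfold c; field; auto. }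
assert (P1 : Cprod (seq 1 n) (fun i => 1 - c i * Cexp w) <> 0).
{ apply Cprod_neq_0; intros i Hi; apply in_seq in Hi; apply Hc; lia. }
assert (P2 : Cprod (seq 1 n) (fun i => 1 - c i * / Cexp w) <> 0).
{ apply Cprod_neq_0; intros i Hi; apply in_seq in Hi; apply (Hc i); lia. }
set (D := polar_product (S n) logq a a w) in *. set (K := theta_factor (S n) logq w).
set (z := Cexp w) in *.
assert (Hzn : z ^ S n <> 0) by now apply Cpow_nz.
assert (Ew : h w = K / D * inner_factor n c a z).
{ unfold h, integrand, inner_factor. rewrite Cexp_INR. fold z K.
  pose proof (polar_product_lowered n logq a w Hq) as E. cbv zeta in E. fold q al c z D in E.
  set (D1 := polar_product (S n) logq al (fun j => q * al j) w) in *.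
  set (X := Cprod _ (fun m => 1 - a m / z)) in *. 
  change (Cprod (seq 1 n) (fun i => 1 - / q * a i * z)) with (Cprod (seq 1 n) (fun i => 1 - c i * z)) in E.
  set (Y := Cprod _ (fun i => 1 - c i * z)) in *.
  replace X with (D * Y / D1) by (rewrite <- E; field; auto). field; auto. }
assert (Esw : h (w + logq) = K / D * inner_factor n c a (/ z)).
{ unfold h, integrand, inner_factor. rewrite theta_factor_shift, Cexp_INR, Cexp_plus, Cpow_mult_l by auto. fold z K q.
  pose proof (polar_product_lowered_inv n logq a w Hq) as E. cbv zeta in E. fold q al c z D in E.
  assert (E3 : polar_product (S n) logq al (fun j => q * al j) (w + logq) = polar_product (S n) logq (fun j => q * al j) al w).
  { unfold polar_product; apply Cprod_ext; intros j _. rewrite Cexp_plus. fold q z. f_equal; f_equal; field; auto. }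
  rewrite E3 in *. set (D1 := polar_product (S n) logq (fun j => q * al j) al w) in *.
  set (X := Cprod _ (fun m => 1 - a m / / z)) in *.
  change (Cprod (seq 1 n) (fun i => 1 - / q * a i * / z)) with (Cprod (seq 1 n) (fun i => 1 - c i * / z)) in E.
  set (Y := Cprod _ (fun i => 1 - c i * / z)) in *.
  assert (Hqn : q ^ S n <> 0) by now apply Cpow_nz.
  rewrite Cpow_inv by auto.
  replace X with (D * Y / D1) by (rewrite <- E; field; auto). field; auto. }
rewrite Ew, Esw.
assert (EK : forall x y, K / D * x - K / D * y = K / D * (x - y)) by (intros; ring).
rewrite EK, inner_factor_antisym; auto; [|intros i Hi; apply Hc; auto|intros i Hi; apply (Hc i); auto].
fold B. rewrite Phi_eq by auto. fold z K D.
assert (Es : sum_n_m (fun i => Cprod (seq (S n) (S n + 1)) (fun m => 1 - c i * a m)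
        / (B * Cprod (indices_except n i) (fun j => 1 - c i * / c j)) * Phi (S n) logq (upd a i (c i)) w) 1 n =
  (z - / z) * (K / D) / B * sum_n_m (fun i => Cprod (seq (S n) (S n + 1)) (fun m => 1 - c i * a m)
        / Cprod (indices_except n i) (fun j => 1 - c i * / c j) / ((1 - c i * z) * (1 - c i / z))) 1 n).
{ rewrite Csum_scal. apply Csum_ext; intros i Hi. rewrite Phi_eq by auto. fold z K.
  destruct (Hc i Hi) as [C1 C2].
  assert (ED : polar_product (S n) logq (upd a i (c i)) (upd a i (c i)) w = D * ((1 - c i * z) * (1 - c i / z))).
  { unfold D, polar_product.
    assert (Hin : In i (seq 1 (2 * S n))) by (apply in_seq; lia).
    apply in_split in Hin. destruct Hin as [l1 [l2 Hs]].
    pose proof (seq_NoDup (2 * S n) 1) as ND. rewrite Hs in ND. apply NoDup_remove_2 in ND.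
    rewrite Hs, !Cprod_app.
    assert (EL : forall l, ~ In i l -> forall f : C -> C, Cprod l (fun j => f (upd a i (c i) j)) = Cprod l (fun j => f (a j))).
    { intros l Hl' f; apply Cprod_ext; intros j Hj. unfold upd. destruct (Nat.eqb_spec j i); [congruence|reflexivity]. }
    rewrite (EL l1) with (f := fun x => qpoch (x * Cexp w) (Cexp logq) * qpoch (x / Cexp w) (Cexp logq))
      by (intros Hx; apply ND, in_or_app; now left).
    change (Cprod (i :: l2) ?f) with (f i * Cprod l2 f). cbv beta.
    rewrite (EL l2) with (f := fun x => qpoch (x * Cexp w) (Cexp logq) * qpoch (x / Cexp w) (Cexp logq))
      by (intros Hx; apply ND, in_or_app; now right).
    unfold upd. rewrite Nat.eqb_refl.
    rewrite (qpoch_step (c i * Cexp w)), (qpoch_step (c i / Cexp w)) by auto.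
    replace (c i * Cexp w * Cexp logq) with (a i * Cexp w) by (unfold c; fold q; field; auto).
    replace (c i / Cexp w * Cexp logq) with (a i / Cexp w) by (unfold c; fold q; field; auto).
    fold z. ring. }
  rewrite ED.
  assert (Cprod (indices_except n i) (fun j => 1 - c i * / c j) <> 0).
  { apply Cprod_neq_0; intros j Hj; apply in_indices_except in Hj. apply one_minus_div_neq_0; auto.
    apply Hcd; lia. }
  assert (z - c i <> 0).
  { intros E; apply C2. replace (1 - c i / z) with ((z - c i) / z) by (field; auto). rewrite E; field; auto. }
  field; repeat split; auto. }
rewrite Es.
assert (Cprod (seq 1 n) (fun j => - c j) <> 0).
{ apply Cprod_neq_0; intros j _ E'. apply (Hcn j).
  replace (c j) with (- - c j) by ring. rewrite E'; ring. }
set (SS := sum_n_m _ 1 n : C). field; auto.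
Qed.

(** * Exponentially decaying integrands on a half-line *)
Notation CInt f a b := (RInt (V := C_R_CompleteNormedModule) f a b).

Lemma norm_CR (z : C) : norm (z : C_R_NormedModule) = Cmod z.
Proof.
destruct z as [x y]. unfold Cmod; cbn [fst snd].
change (norm ((x, y) : C_R_NormedModule)) with (sqrt (Rabs x ^ 2 + Rabs y ^ 2)).
now rewrite !pow2_abs.
Qed.

Lemma is_CInt_cont (f : R -> C) a b : (forall v, continuous f v) -> is_CInt f a b (CInt f a b).
Proof.
intros H. apply (RInt_correct (V := C_R_CompleteNormedModule)).
apply ex_RInt_continuous; auto.
Qed.

(** With r = exp (-k), the function |f v| exp (k v) does not increase along unit steps, so
    it is bounded by its maximum on one unit interval. *)
Lemma ratio_decay (f : R -> C) (r V : R) : (forall v, continuous f v) -> (0 < r < 1)%R ->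
  (forall v, (V <= v)%R -> (Cmod (f v) <= r * Cmod (f (v - 1)%R))%R) ->
  exists M k, (0 <= M)%R /\ (0 < k)%R /\
    forall v, (V <= v)%R -> (Cmod (f v) <= M * exp (- k * v))%R.
Proof.
intros Hc Hr H. set (k := (- ln r)%R).
assert (Hk : (0 < k)%R) by (unfold k; pose proof (ln_increasing r 1 (proj1 Hr) (proj2 Hr)); rewrite ln_1 in *; lra).
assert (Ek : exp (- k) = r) by (unfold k; rewrite Ropp_involutive; apply exp_ln; lra).
set (g := fun v => (Cmod (f v) * exp (k * v))%R).
assert (Hg : forall v, continuous g v).
{ intros v. apply continuous_Rmult.
  - apply (continuous_comp f Cmod); [apply Hc|apply continuous_Cmod].
  - apply (continuous_comp (fun v => k * v)%R exp); [|apply continuous_exp].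
    apply continuous_Rmult; [apply continuous_const|apply continuous_id]. }
destruct (bounded_continuity (V := R_NormedModule) g (V - 1) V (fun v _ => Hg v)) as [M HM].
assert (Hn : forall n v, (V - 1 <= v <= V + INR n)%R -> (g v <= M)%R).
{ induction n as [|n IH]; intros v Hv.
  - simpl in Hv. assert (Hv' : (V - 1 <= v <= V)%R) by lra. specialize (HM v Hv').
    change (Rabs (g v) < M)%R in HM. apply Rabs_def2 in HM; lra.
  - rewrite S_INR in Hv. destruct (Rle_dec v V) as [Hle|Hle].
    + apply IH. pose proof (pos_INR n); lra.
    + apply Rle_trans with (g (v - 1)%R); [|apply IH; lra].
      unfold g. specialize (H v ltac:(lra)).
      replace (exp (k * (v - 1))) with (r * exp (k * v))%R.
      2:{ rewrite <- Ek, <- exp_plus; f_equal; ring. }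
      rewrite <- Rmult_assoc, (Rmult_comm _ r). apply Rmult_le_compat_r; [left; apply exp_pos|exact H]. }
exists M, k. split; [|split; [exact Hk|]].
- specialize (Hn O V ltac:(simpl; lra)). eapply Rle_trans; [|exact Hn].
  apply Rmult_le_pos; [apply Cmod_ge_0|left; apply exp_pos].
- intros v Hv. destruct (INR_unbounded (v - V)) as [n Hn'].
  specialize (Hn n v ltac:(lra)). unfold g in Hn.
  replace (- k * v)%R with (- (k * v))%R by ring. rewrite exp_Ropp.
  apply Rmult_le_reg_r with (exp (k * v)); [apply exp_pos|].
  rewrite Rmult_assoc, Rinv_l, Rmult_1_r; [exact Hn|]. apply Rgt_not_eq, exp_pos.
Qed.

Lemma decay_integral (f : R -> C) (M k V x y : R) (l : C) : (0 <= M)%R -> (0 < k)%R ->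
  (forall v, (V <= v)%R -> (Cmod (f v) <= M * exp (- k * v))%R) ->
  (V <= x <= y)%R -> is_CInt f x y l -> (Cmod l <= M / k * exp (- k * x))%R.
Proof.
intros HM Hk H Hxy Hl.
assert (HI : is_RInt (fun v => M * exp (- k * v))%R x y
  (M / k * exp (- k * x) - M / k * exp (- k * y))%R).
{ replace (M / k * exp (- k * x) - M / k * exp (- k * y))%R with
    (minus (- (M / k) * exp (- k * y)) (- (M / k) * exp (- k * x)))%R
    by (unfold minus, plus, opp; simpl; ring).
  apply (is_RInt_derive (V := R_CompleteNormedModule) (fun v => - (M / k) * exp (- k * v))%R).
  - intros v _. auto_derive; auto. field; lra.
  - intros v _. apply continuous_Rmult; [apply continuous_const|].
    apply (continuous_comp (fun v => - k * v)%R exp); [|apply continuous_exp].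
    apply continuous_Rmult; [apply continuous_const|apply continuous_id]. }
rewrite <- norm_CR.
eapply Rle_trans; [apply (norm_RInt_le (V := C_R_NormedModule) f (fun v => M * exp (- k * v))%R x y l); [lra| |exact Hl|exact HI]|].
- intros v Hv. rewrite norm_CR. apply H; lra.
- assert (0 <= M / k * exp (- k * y))%R; [|lra].
  apply Rmult_le_pos; [|left; apply exp_pos].
  apply Rmult_le_pos; auto. left; now apply Rinv_0_lt_compat.
Qed.

Lemma exp_decay_eventually (K k eps : R) : (0 < k)%R -> (0 < eps)%R -> (0 <= K)%R ->
  exists X, forall x, (X <= x)%R -> (K * exp (- k * x) < eps)%R.
Proof.
intros Hk He HK. exists (- ln (eps / (K + 1)) / k)%R. intros x Hx.
assert (H1 : (0 < eps / (K + 1))%R) by (apply Rdiv_lt_0_compat; lra).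
assert (H2 : (exp (- k * x) <= eps / (K + 1))%R).
{ rewrite <- (exp_ln _ H1). apply exp_le_mono.
  apply (Rmult_le_compat_l k) in Hx; [|lra].
  replace (k * (- ln (eps / (K + 1)) / k))%R with (- ln (eps / (K + 1)))%R in Hx by (field; lra). lra. }
apply Rle_lt_trans with (K * (eps / (K + 1)))%R; [now apply Rmult_le_compat_l|].
replace (K * (eps / (K + 1)))%R with (eps - eps / (K + 1))%R by (field; lra). lra.
Qed.

Definition is_tail (f : R -> C) (a : R) (l : C) : Prop :=
  (forall v, continuous f v) /\
  filterlim (fun b => CInt f a b) (Rbar_locally p_infty) (locally l).

Definition decays (f : R -> C) : Prop :=
  exists M k V, (0 <= M)%R /\ (0 < k)%R /\
    forall v, (V <= v)%R -> (Cmod (f v) <= M * exp (- k * v))%R.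

Lemma ball_Cmod (x y : C) (eps : R) : (Cmod (y - x) < eps)%R -> ball (x : C_UniformSpace) eps y.
Proof. apply C_NormedModule_mixin_compat1. Qed.

Lemma decays_tail (f : R -> C) (a : R) : (forall v, continuous f v) -> decays f ->
  exists l, is_tail f a l.
Proof.
intros Hc [M [k [V [HM [Hk H]]]]].
assert (Hf : exists l : C_R_CompleteNormedModule,
  filterlim (fun b => CInt f a b) (Rbar_locally p_infty) (locally l)).
{ apply (filterlim_locally_cauchy (U := C_R_CompleteNormedModule)).
  intros eps.
  destruct (exp_decay_eventually (M / k) k eps Hk (cond_pos eps)) as [X HX].
  { apply Rmult_le_pos; auto. left; now apply Rinv_0_lt_compat. }
  exists (fun b => (Rmax X V < b)%R). split; [exists (Rmax X V); auto|].
  assert (Hw : forall x y, (Rmax X V < x)%R -> (x <= y)%R -> (Cmod (CInt f a y - CInt f a x) < eps)%R).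
  { intros x y Hx Hxy. pose proof (Rmax_l X V). pose proof (Rmax_r X V).
    replace (CInt f a y - CInt f a x) with (CInt f x y).
    - eapply Rle_lt_trans; [apply (decay_integral f M k V x y); auto; [lra|now apply is_CInt_cont]|].
      apply HX; lra.
    - rewrite <- (RInt_Chasles (V := C_R_CompleteNormedModule) f a x y);
        [|eexists; now apply is_CInt_cont|eexists; now apply is_CInt_cont].
      unfold plus; simpl. set (A1 := CInt f a x : C). set (A2 := CInt f x y : C).
      change (A2 = A1 + A2 - A1). ring. }
  intros x y Hx Hy. apply ball_Cmod.
  destruct (Rle_dec x y) as [Hxy|Hxy].
  - now apply Hw.
  - rewrite <- Cmod_opp. replace (- (CInt f a y - CInt f a x)) with (CInt f a x - CInt f a y).
    + apply Hw; auto; lra.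
    + set (A1 := CInt f a x : C). set (A2 := CInt f a y : C). change (A1 - A2 = - (A2 - A1)). ring. }
destruct Hf as [l Hl]; exists l; split; assumption.
Qed.

Lemma is_tail_unique f a l : is_tail f a l ->
  RInt_gen (V := C_R_CompleteNormedModule) f (at_point a) (Rbar_locally p_infty) = l.
Proof.
intros [Hc H]. apply (is_RInt_gen_unique (V := C_R_CompleteNormedModule)).
intros P HP. specialize (H P HP).
apply (Filter_prod _ _ _ (fun x => x = a) (fun b => P (CInt f a b))); [reflexivity|exact H|].
intros x b -> Hb. exists (CInt f a b); split; [now apply is_CInt_cont|exact Hb].
Qed.

Lemma is_tail_ext f g a l : (forall v, f v = g v) -> is_tail f a l -> is_tail g a l.
Proof. intros H. replace g with f; auto. now apply functional_extensionality. Qed.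

Lemma is_tail_scal c f a l : is_tail f a l -> is_tail (fun v => c * f v) a (c * l).
Proof.
intros [Hc H]. split.
- intros v; apply continuous_Cmult; [apply continuous_const|auto].
- apply filterlim_ext with (fun b => c * CInt f a b).
  + intros b; symmetry; apply is_CInt_unique, is_CInt_scal; now apply is_CInt_cont.
  + eapply filterlim_comp; [exact H|].
    apply (continuous_Cmult (fun _ => c) (fun x => x) l); [apply continuous_const|apply continuous_id].
Qed.

Lemma is_tail_minus f g a l m : is_tail f a l -> is_tail g a m ->
  is_tail (fun v => f v - g v) a (l - m).
Proof.
intros [Hc H] [Hc' H']. split.
- intros v; apply continuous_Cminus; auto.
- apply filterlim_ext with (fun b => CInt f a b - CInt g a b).
  + intros b; symmetry; apply is_CInt_unique, is_CInt_minus; now apply is_CInt_cont.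
  + apply (filterlim_comp_2 (G := locally l) (H := locally (- m)) (fun b => CInt f a b) (fun b => - CInt g a b) Cplus); auto.
    * eapply filterlim_comp; [exact H'|].
      apply (continuous_Copp (fun x => x) m), continuous_id.
    * apply (filterlim_plus (V := C_R_NormedModule)).
Qed.

Lemma is_CInt_0 a b : is_CInt (fun _ => 0) a b 0.
Proof.
pose proof (is_RInt_const (V := C_R_NormedModule) a b (RtoC 0)) as H.
pose proof (scal_zero_r (V := C_R_NormedModule) (b - a)%R) as E.
exact (eq_ind _ (fun l => is_RInt (V := C_R_NormedModule) (fun _ => RtoC 0) a b l) H _ E).
Qed.

Lemma is_tail_0 a : is_tail (fun _ => 0) a 0.
Proof.
split; [intros; apply continuous_const|].
apply filterlim_ext with (fun _ => RtoC 0); [|apply filterlim_const].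
intros b; symmetry; apply is_CInt_unique, is_CInt_0.
Qed.

Lemma CInt_shift (f : R -> C) (a b : R) : (forall v, continuous f v) ->
  is_CInt (fun v => f (v - 1)%R) a b (CInt f (a - 1) (b - 1)).
Proof.
intros Hc.
assert (Hcc : forall v, continuous (fun v => f (v - 1)%R) v).
{ intros v; apply (continuous_comp (fun v => v - 1)%R f); auto.
  apply (continuous_minus (V := R_NormedModule)); [apply continuous_id|apply continuous_const]. }
pose proof (RInt_comp_lin (V := C_R_CompleteNormedModule) f 1 (-1) a b) as E.
replace (1 * a + -1)%R with (a - 1)%R in E by ring.
replace (1 * b + -1)%R with (b - 1)%R in E by ring.
assert (E2 : CInt (fun v => f (v - 1)%R) a b = CInt f (a - 1) (b - 1)).
{ rewrite <- E by (eexists; now apply is_CInt_cont).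
  apply RInt_ext. intros v _. replace (1 * v + -1)%R with (v - 1)%R by ring.
  symmetry; exact (scal_one (V := C_R_NormedModule) (f (v - 1)%R)). }
rewrite <- E2. now apply (is_CInt_cont (fun v => f (v - 1)%R)).
Qed.

(** The integral over [a, b] telescopes to the integral over [b - 1, b], which tends to 0,
    minus the integral over [a - 1, a]. *)
Lemma tail_difference (f : R -> C) (a : R) : (forall v, continuous f v) -> decays f ->
  is_tail (fun v => f v - f (v - 1)%R) a (- CInt f (a - 1) a).
Proof.
intros Hc [M [k [V [HM [Hk H]]]]].
assert (Hcc : forall v, continuous (fun v => f (v - 1)%R) v).
{ intros v; apply (continuous_comp (fun v => v - 1)%R f); auto.
  apply (continuous_minus (V := R_NormedModule)); [apply continuous_id|apply continuous_const]. }
split; [intros v; now apply continuous_Cminus|].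
assert (Ch : forall x y z, CInt f x y + CInt f y z = CInt f x z).
{ intros x y z. apply (RInt_Chasles (V := C_R_CompleteNormedModule)); eexists; now apply is_CInt_cont. }
apply filterlim_ext with (fun b => CInt f (b - 1) b - CInt f (a - 1) a).
{ intros b. symmetry. apply is_CInt_unique.
  replace (CInt f (b - 1) b - CInt f (a - 1) a) with (CInt f a b - CInt f (a - 1) (b - 1)).
  - apply is_CInt_minus; [now apply is_CInt_cont|now apply CInt_shift].
  - pose proof (Ch (a - 1)%R a b) as E1. pose proof (Ch (a - 1)%R (b - 1)%R b) as E2.
    revert E1 E2. generalize (CInt f (a - 1) a) (CInt f a b) (CInt f (a - 1) b)
      (CInt f (a - 1) (b - 1)) (CInt f (b - 1) b).
    intros x1 x2 x3 x4 x5 E1 E2.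
    assert (A : forall y1 y2 y3 y4 y5 : C, y1 + y2 = y3 -> y4 + y5 = y3 -> y2 - y4 = y5 - y1).
    { intros y1 y2 y3 y4 y5 <- F2. replace y5 with (y1 + y2 - y4) by (rewrite <- F2; ring). ring. }
    exact (A x1 x2 x3 x4 x5 E1 E2). }
apply filterlim_locally; intros eps.
destruct (exp_decay_eventually (M / k) k eps Hk (cond_pos eps)) as [X HX].
{ apply Rmult_le_pos; auto. left; now apply Rinv_0_lt_compat. }
exists (Rmax X V + 1)%R; intros b Hb. apply ball_Cmod.
pose proof (Rmax_l X V). pose proof (Rmax_r X V).
replace (CInt f (b - 1) b - CInt f (a - 1) a - - CInt f (a - 1) a) with (CInt f (b - 1) b).
- eapply Rle_lt_trans; [apply (decay_integral f M k V (b - 1) b); auto; [lra|now apply is_CInt_cont]|].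
  apply HX; lra.
- assert (A : forall y1 y2 : C, y1 = y1 - y2 - - y2) by (intros; ring). apply A.
Qed.

Lemma decays_of_ratio (f : R -> C) (r V : R) : (forall v, continuous f v) -> (0 < r < 1)%R ->
  (forall v, (V <= v)%R -> (Cmod (f v) <= r * Cmod (f (v - 1)%R))%R) -> decays f.
Proof.
intros Hc Hr H. destruct (ratio_decay f r V Hc Hr H) as [M [k [HM [Hk HB]]]].
now exists M, k, V.
Qed.

Lemma Re_logpt logq t v : Re (logpt logq t v) = (- v * Re logq)%R.
Proof. destruct logq; unfold logpt, Re; simpl; ring. Qed.

Lemma logpt_shift logq t v : logpt logq t v + logq = logpt logq t (v - 1).
Proof. unfold logpt. rewrite RtoC_minus; ring. Qed.

Lemma Cmod_Cprod_opp l (f : nat -> C) : Cmod (Cprod l (fun j => 0 - f j)) = Cmod (Cprod l f).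
Proof.
unfold Cprod; induction l as [|x l IH]; simpl; [reflexivity|].
rewrite !Cmod_mult, IH. f_equal. replace (0 - f x) with (- f x) by ring. apply Cmod_opp.
Qed.

(** By [integrand_shift] the ratio of the values at v and v - 1 tends, as z tends to infinity, to
    q^(N - beta) / (al_1 ... al_2N), and the hypothesis says that this limit has modulus
    less than 1. *)
Lemma integrand_decays N logq beta al ga t : (1 <= N)%nat -> (Cmod (Cexp logq) < 1)%R ->
  (forall v, polar_product N logq al ga (logpt logq t v) <> 0) ->
  (Cmod (Cexp ((INR N - beta)%R * logq)) < Cmod (Cprod (seq 1 (2 * N)) al))%R ->
  (forall v, continuous (fun v => integrand N logq beta al ga (logpt logq t v)) v) /\
  decays (fun v => integrand N logq beta al ga (logpt logq t v)).
Proof.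
intros HN Hq HD HL.
assert (Hc : forall v, continuous (fun v => integrand N logq beta al ga (logpt logq t v)) v).
{ intros v. apply (continuous_comp (fun v => logpt logq t v) (integrand N logq beta al ga)).
  - apply continuous_logpt; [apply continuous_const|apply continuous_id].
  - now apply holo_continuous, holo_integrand. }
split; [exact Hc|].
set (K := Cexp ((INR N - beta)%R * logq)) in *.
set (L := Cprod (seq 1 (2 * N)) al) in *.
assert (HK : (0 < Cmod K)%R) by (apply Cmod_gt_0, Cexp_neq_0).
(* any r strictly between the limit of the ratio and 1 *)
set (r := ((Cmod K / Cmod L + 1) / 2)%R).
assert (H1 : (0 < Cmod K / Cmod L < 1)%R).
{ split; [apply Rdiv_lt_0_compat; lra|].
  apply Rmult_lt_reg_r with (Cmod L); [lra|]. unfold Rdiv; rewrite Rmult_assoc, Rinv_l; lra. }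
assert (Hr : (0 < r < 1)%R) by (unfold r; lra).
assert (HrL : (Cmod K < r * Cmod L)%R).
{ unfold r. replace (_ * Cmod L)%R with ((Cmod K + Cmod L) / 2)%R by (field; lra). lra. }
set (P := fun x => Cprod (seq 1 (2 * N)) (fun j => x - al j)).
set (Q := fun x => Cprod (seq 1 (2 * N)) (fun j => 1 - ga j / Cexp logq * x)).
set (psi := fun x => (Cmod (K * Q x) - r * Cmod (P x))%R).
assert (Hpsi : continuous psi (RtoC 0)).
{ apply (continuous_minus (V := R_NormedModule)).
  - apply (continuous_comp (fun x => K * Q x) Cmod); [|apply continuous_Cmod].
    apply continuous_Cmult; [apply continuous_const|].
    apply (continuous_Cprod (seq 1 (2 * N)) (fun j x => 1 - ga j / Cexp logq * x)); intros j _.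
    apply continuous_Cminus; [apply continuous_const|].
    apply continuous_Cmult; [apply continuous_const|apply continuous_id].
  - apply continuous_Rmult; [apply continuous_const|].
    apply (continuous_comp P Cmod); [|apply continuous_Cmod].
    apply (continuous_Cprod (seq 1 (2 * N)) (fun j x => x - al j)); intros j _.
    apply continuous_Cminus; [apply continuous_id|apply continuous_const]. }
assert (Hpsi0 : (psi 0 < 0)%R).
{ unfold psi, P, Q. rewrite Cmod_Cprod_opp. fold L.
  replace (Cprod _ (fun j => 1 - ga j / Cexp logq * 0)) with (RtoC 1).
  - rewrite Cmult_1_r; lra.
  - transitivity (Cprod (seq 1 (2 * N)) (fun _ => 1)); [now rewrite Cprod_const, Cpow_1_l|].
    apply Cprod_ext; intros j _; ring. }
destruct (locally_comp psi (RtoC 0) (fun y => (y < 0)%R) Hpsi (open_lt 0 _ Hpsi0)) as [d Hd].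
apply Re_logq_neg in Hq as HRe.
apply (decays_of_ratio _ r (ln d / Re logq + 1) Hc Hr).
intros v Hv.
set (w := logpt logq t v).
assert (Hx : (Cmod (/ Cexp w) < d)%R).
{ rewrite Cmod_inv by apply Cexp_neq_0. rewrite Cmod_Cexp. unfold w. rewrite Re_logpt.
  rewrite <- exp_Ropp, <- (exp_ln d) by apply cond_pos. apply exp_increasing.
  replace (- (- v * Re logq))%R with (v * Re logq)%R by ring.
  apply Rle_lt_trans with ((ln d / Re logq + 1) * Re logq)%R.
  - apply Rmult_le_compat_neg_l with (r := Re logq) in Hv; [|lra]. lra.
  - replace ((ln d / Re logq + 1) * Re logq)%R with (ln d + Re logq)%R by (field; lra). lra. }
assert (Hneg : (psi (/ Cexp w)%C < 0)%R).
{ apply Hd, ball_Cmod. now replace (/ Cexp w - 0) with (/ Cexp w) by ring. }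
pose proof (integrand_shift N logq beta al ga w HN Hq) as E.
unfold w in E at 4. unfold w in E. rewrite !logpt_shift in E.
specialize (E (HD v) (HD (v - 1)%R)). fold w in E.
change (Cprod _ (fun j => / Cexp w - al j)) with (P (/ Cexp w)) in E.
change (Cprod _ (fun j => 1 - ga j / Cexp logq * / Cexp w)) with (Q (/ Cexp w)) in E.
fold K in E. apply (f_equal Cmod) in E. rewrite (Cmod_mult _ (P _)), (Cmod_mult _ (K * _)) in E.
unfold psi in Hneg. set (p := Cmod (P (/ Cexp w))) in *.
set (kq := Cmod (K * Q (/ Cexp w))) in *.
assert (0 <= kq)%R by apply Cmod_ge_0.
assert (Hp : (0 < p)%R) by nra.
set (g0 := Cmod (integrand N logq beta al ga w)) in *.
set (g1 := Cmod (integrand N logq beta al ga (logpt logq t (v - 1)))) in *.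
assert (0 <= g1)%R by apply Cmod_ge_0.
apply Rmult_le_reg_r with p; [exact Hp|]. rewrite E.
apply Rle_trans with (g1 * (r * p))%R; [apply Rmult_le_compat_l; lra|right; ring].
Qed.

(** * Integrals over the contour *)
(** This is the numerator in [IN], for an arbitrary integrand. *)
Definition Contour (N : nat) (logq : C) (u : R -> R) (F : C -> C) : C :=
  on_circuit logq u F
  + (if Nat.odd N then on_tail logq u F PI - on_tail logq u F (- PI) else 0).

(** [Contour] with convergence; unlike [Contour], this is linear in [F] without side
    conditions. *)
Definition is_contour (N : nat) (logq : C) (u : R -> R) (F : C -> C) (l : C) : Prop :=
  exists c tp tm : C,
  is_CInt (fun t => F (logpt logq t (u t)) * (Ci - Derive u t * logq)) (- PI) PI c /\
  (Nat.odd N = true ->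
    is_tail (fun v => F (logpt logq PI v) * (- logq)) (u PI) tp /\
    is_tail (fun v => F (logpt logq (- PI) v) * (- logq)) (u (- PI)%R) tm) /\
  l = c + (if Nat.odd N then tp - tm else 0).

Lemma is_contour_unique N logq u F l : is_contour N logq u F l -> Contour N logq u F = l.
Proof.
intros [c [tp [tm [H1 [H2 ->]]]]]. unfold Contour, on_circuit, on_tail.
rewrite (is_CInt_unique _ _ _ _ H1). destruct (Nat.odd N); [|reflexivity].
destruct (H2 eq_refl) as [H3 H4].
now rewrite (is_tail_unique _ _ _ H3), (is_tail_unique _ _ _ H4).
Qed.

Lemma PI_le : (- PI <= PI)%R.
Proof. pose proof PI_RGT_0; lra. Qed.

Lemma is_contour_ext N logq u F F' l :
  (forall t, (- PI <= t <= PI)%R -> F (logpt logq t (u t)) = F' (logpt logq t (u t))) ->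
  (Nat.odd N = true -> forall t v, t = PI \/ t = (- PI)%R ->
     F (logpt logq t v) = F' (logpt logq t v)) ->
  is_contour N logq u F l -> is_contour N logq u F' l.
Proof.
intros E1 E2 [c [tp [tm [H1 [H2 H3]]]]]. exists c, tp, tm. split; [|split; [|exact H3]].
- revert H1; apply is_CInt_ext; [apply PI_le|]. intros t Ht; now rewrite E1.
- intros Ho; destruct (H2 Ho) as [H4 H5]; split.
  + revert H4; apply is_tail_ext; intros v; rewrite E2; auto.
  + revert H5; apply is_tail_ext; intros v; rewrite E2; auto.
Qed.

Lemma is_contour_scal N logq u F l k :
  is_contour N logq u F l -> is_contour N logq u (fun w => k * F w) (k * l).
Proof.
intros [c [tp [tm [H1 [H2 ->]]]]]. exists (k * c), (k * tp), (k * tm). split; [|split].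
- apply is_CInt_ext with (fun t => k * (F (logpt logq t (u t)) * (Ci - Derive u t * logq)));
   [apply PI_le|intros; ring|now apply is_CInt_scal].
- intros Ho; destruct (H2 Ho) as [H4 H5]; split.
  + apply is_tail_ext with (fun v => k * (F (logpt logq PI v) * (- logq))); [intros; ring|now apply is_tail_scal].
  + apply is_tail_ext with (fun v => k * (F (logpt logq (- PI) v) * (- logq))); [intros; ring|now apply is_tail_scal].
- destruct (Nat.odd N); ring.
Qed.

Lemma is_contour_minus N logq u F F' l l' :
  is_contour N logq u F l -> is_contour N logq u F' l' ->
  is_contour N logq u (fun w => F w - F' w) (l - l').
Proof.
intros [c [tp [tm [H1 [H2 ->]]]]] [c' [tp' [tm' [H1' [H2' ->]]]]].
exists (c - c'), (tp - tp'), (tm - tm'). split; [|split].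
- eapply is_CInt_ext; [apply PI_le| |apply is_CInt_minus; [exact H1|exact H1']].
  intros t Ht; cbv beta; ring.
- intros Ho; destruct (H2 Ho) as [H4 H5]; destruct (H2' Ho) as [H4' H5']; split.
  + eapply is_tail_ext; [|apply is_tail_minus; [exact H4|exact H4']]. intros v; cbv beta; ring.
  + eapply is_tail_ext; [|apply is_tail_minus; [exact H5|exact H5']]. intros v; cbv beta; ring.
- destruct (Nat.odd N); ring.
Qed.

Lemma is_contour_0 N logq u : is_contour N logq u (fun _ => 0) 0.
Proof.
exists 0, 0, 0. split; [|split].
- apply is_CInt_ext with (fun _ => RtoC 0); [apply PI_le|intros; ring|apply is_CInt_0].
- intros _; split; (apply is_tail_ext with (fun _ => RtoC 0); [intros; ring|apply is_tail_0]).
- destruct (Nat.odd N); ring.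
Qed.

Lemma is_contour_sum N logq u (F : nat -> C -> C) (l : nat -> C) n :
  (forall i, (1 <= i <= n)%nat -> is_contour N logq u (F i) (l i)) ->
  is_contour N logq u (fun w => sum_n_m (fun i => F i w) 1 n) (sum_n_m l 1 n).
Proof.
induction n as [|n IH]; intros H.
- rewrite Csum_0. apply is_contour_ext with (fun _ => RtoC 0); [| |apply is_contour_0];
   intros; now rewrite Csum_0.
- rewrite Csum_S.
  assert (A : forall x y : C, x + y = x - (-1)%R * y).
  { intros [x1 x2] [y1 y2]; apply C_ext; simpl; ring. }
  assert (H1 := IH (fun i Hi => H i ltac:(lia))).
  assert (H2 := is_contour_scal _ _ _ _ _ (-1)%R (H (S n) ltac:(lia))).
  rewrite A. generalize (is_contour_minus _ _ _ _ _ _ _ H1 H2); apply is_contour_ext.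
  + intros t Ht; cbv beta. now rewrite Csum_S, A.
  + intros _ t v Ht; cbv beta. now rewrite Csum_S, A.
Qed.

(** * Zeros of the denominators and the contour *)

Lemma qpow_plus logq x y : qpow logq (x + y) = qpow logq x * qpow logq y.
Proof. unfold qpow. rewrite <- Cexp_plus; f_equal; ring. Qed.

Lemma qpow_INR logq k : qpow logq (INR k) = Cexp logq ^ k.
Proof. apply Cexp_INR. Qed.

Lemma qpow_opp logq x : qpow logq (- x) = / qpow logq x.
Proof. unfold qpow. rewrite <- Cexp_opp; f_equal; ring. Qed.

Lemma qpow_1 logq : qpow logq 1 = Cexp logq.
Proof. unfold qpow; f_equal; ring. Qed.

Lemma Cexp_logpt logq t v : Cexp (logpt logq t v) = Cexp (Ci * t) * qpow logq (- v)%R.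
Proof. unfold qpow. rewrite <- Cexp_plus. f_equal. unfold logpt. rewrite RtoC_opp; ring. Qed.

Lemma separates_outside N logq u s j k t v : separates N logq u s ->
  (1 <= j <= 2 * N)%nat -> (- PI <= t <= PI)%R -> (u t <= v)%R ->
  1 - qpow logq (s j) / Cexp (logpt logq t v) * Cexp logq ^ k <> 0.
Proof.
intros Hs Hj Ht Hv E. destruct (Hs j k t v Hj Ht) as [H _].
assert (v < u t)%R; [|lra]. apply H. rewrite qpow_plus, qpow_INR.
set (z := Cexp (logpt logq t v)) in *. assert (Hz : z <> 0) by apply Cexp_neq_0.
set (x := qpow logq (s j)) in *. set (y := Cexp logq ^ k) in *.
replace z with (z * (1 - x / z * y) + x * y) by (field; auto). rewrite E; ring.
Qed.

Lemma separates_inside N logq u s j k t v : separates N logq u s ->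
  (1 <= j <= 2 * N)%nat -> (- PI <= t <= PI)%R -> (v <= u t)%R ->
  1 - qpow logq (s j) * Cexp (logpt logq t v) * Cexp logq ^ k <> 0.
Proof.
intros Hs Hj Ht Hv E. destruct (Hs j k t v Hj Ht) as [_ H].
assert (u t < v)%R; [|lra]. apply H. rewrite qpow_opp, qpow_plus, qpow_INR.
set (z := Cexp (logpt logq t v)) in *.
assert (Hx : qpow logq (s j) <> 0) by apply Cexp_neq_0.
assert (Hy : Cexp logq ^ k <> 0) by apply Cpow_nz, Cexp_neq_0.
set (x := qpow logq (s j)) in *. set (y := Cexp logq ^ k) in *.
replace z with ((1 - (1 - x * z * y)) / (x * y)) by (field; auto). rewrite E; field; auto.
Qed.

Lemma polar_product_circuit N logq u s t : (Cmod (Cexp logq) < 1)%R -> separates N logq u s ->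
  (- PI <= t <= PI)%R ->
  let a := fun j => qpow logq (s j) in polar_product N logq a a (logpt logq t (u t)) <> 0.
Proof.
intros Hq Hs Ht a. apply polar_product_neq_0; auto. intros j k Hj; split.
- apply (separates_inside N logq u s); auto; lra.
- apply (separates_outside N logq u s); auto; lra.
Qed.

(** The function whose q-difference is taken has no pole in the closed strip swept
    by the circuit when it is multiplied by q: its inner poles start at
    [q * a j], one step further in than those of an integrand with parameters a. *)
Lemma polar_product_strip N logq u s t v : (Cmod (Cexp logq) < 1)%R -> separates N logq u s ->
  (- PI <= t <= PI)%R -> (u t - 1 <= v <= u t)%R ->
  let a := fun j => qpow logq (s j) in
  polar_product N logq a (fun j => Cexp logq * a j) (logpt logq t v) <> 0.
Proof.
intros Hq Hs Ht Hv a. apply polar_product_neq_0; auto. intros j k Hj; split.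
- apply (separates_inside N logq u s); auto; lra.
- replace (Cexp logq * a j / Cexp (logpt logq t v)) with (a j / Cexp (logpt logq t (v + 1))).
  + apply (separates_outside N logq u s); auto; lra.
  + replace v with (v + 1 - 1)%R at 2 by ring. rewrite <- logpt_shift, Cexp_plus.
    field; split; apply Cexp_neq_0.
Qed.

(** The complement of the cut, along which the tails run. *)
Definition off_tail (logq x : C) : Prop := forall v : R, x <> - qpow logq v.

Lemma off_tail_mult logq x : off_tail logq x -> off_tail logq (Cexp logq * x).
Proof.
intros H v E. apply (H (v - 1)%R).
replace (RtoC (v - 1)) with (v + - (1)) by (rewrite RtoC_minus; ring).
rewrite qpow_plus, qpow_opp, qpow_1.
replace x with (/ Cexp logq * (Cexp logq * x)) by (field; apply Cexp_neq_0).
rewrite E; field; apply Cexp_neq_0.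
Qed.

Lemma Cexp_Ci_PI t : t = PI \/ t = (- PI)%R -> Cexp (Ci * t) = - (1).
Proof.
intros [-> | ->]; apply C_ext; unfold Cexp, Ci, Re, Im; simpl;
  repeat match goal with |- context [exp ?x] => replace x with 0%R by ring; rewrite exp_0 end.
- replace (0 * 0 + 1 * PI)%R with PI by ring. rewrite cos_PI; ring.
- replace (0 * 0 + 1 * PI)%R with PI by ring. rewrite sin_PI; ring.
- replace (0 * 0 + 1 * - PI)%R with (- PI)%R by ring. rewrite cos_neg, cos_PI; ring.
- replace (0 * 0 + 1 * - PI)%R with (- PI)%R by ring. rewrite sin_neg, sin_PI; ring.
Qed.

Lemma off_tail_factor logq x t v k : t = PI \/ t = (- PI)%R -> off_tail logq x ->
  1 - x * Cexp (logpt logq t v) * Cexp logq ^ k <> 0 /\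
  1 - x / Cexp (logpt logq t v) * Cexp logq ^ k <> 0.
Proof.
intros Ht H.
rewrite Cexp_logpt, (Cexp_Ci_PI t Ht), <- qpow_INR, RtoC_opp, qpow_opp.
assert (Hk : qpow logq (INR k) <> 0) by apply Cexp_neq_0.
assert (Hv : qpow logq v <> 0) by apply Cexp_neq_0.
split; intros E.
- apply (H (v - INR k)%R).
  replace (RtoC (v - INR k)) with (v + - INR k) by (rewrite RtoC_minus; ring).
  rewrite qpow_plus, qpow_opp.
  set (y := qpow logq v) in *. set (r := qpow logq (INR k)) in *.
  replace x with (- (y * / r) * (1 - (1 - x * (- (1) * / y) * r))) by (field; auto).
  rewrite E; ring.
- apply (H (- v - INR k)%R).
  replace (RtoC (- v - INR k)) with (- v + - INR k) by (rewrite RtoC_minus, RtoC_opp; ring).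
  rewrite qpow_plus, !qpow_opp.
  set (y := qpow logq v) in *. set (r := qpow logq (INR k)) in *.
  replace x with (- (/ y * / r) * (1 - (1 - x / (- (1) * / y) * r))).
  + rewrite E; ring.
  + field; repeat split; auto.
Qed.

Lemma polar_product_tail N logq al ga t v : (Cmod (Cexp logq) < 1)%R -> t = PI \/ t = (- PI)%R ->
  (forall j, (1 <= j <= 2 * N)%nat -> off_tail logq (al j) /\ off_tail logq (ga j)) ->
  polar_product N logq al ga (logpt logq t v) <> 0.
Proof.
intros Hq Ht H. apply polar_product_neq_0; auto. intros j k Hj. destruct (H j Hj) as [Ha Hg].
split; now apply off_tail_factor.
Qed.

Lemma Cmod_qpow logq x : Re logq <> 0%R -> Cmod (qpow logq x) = exp (Re logq * rexp logq x).
Proof. intros H; unfold qpow, rexp; rewrite Cmod_Cexp. f_equal. field; auto. Qed.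

Lemma Cmod_Cprod_qpow logq s n : Re logq <> 0%R ->
  Cmod (Cprod (seq 1 n) (fun j => qpow logq (s j))) =
  exp (Re logq * sum_n_m (fun j => rexp logq (s j)) 1 n).
Proof.
intros H; induction n as [|n IH].
- rewrite sum_n_m_zero by lia. change (zero : R) with 0%R. rewrite Rmult_0_r, exp_0.
  simpl. apply Cmod_1.
- rewrite Cprod_S, Cmod_mult, IH, sum_n_Sm by lia. change (1 + n)%nat with (S n).
  rewrite Cmod_qpow by auto. rewrite <- exp_plus. f_equal.
  unfold plus; simpl; ring.
Qed.

(** Both sides are powers of |q| < 1, so the inequality of exponents is reversed. *)
Lemma decay_condition N logq beta s : (Re logq < 0)%R ->
  (sum_n_m (fun j => rexp logq (s j)) 1 (2 * N) < INR N - beta)%R ->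
  (Cmod (Cexp ((INR N - beta)%R * logq)) <
   Cmod (Cprod (seq 1 (2 * N)) (fun j => qpow logq (s j))))%R.
Proof.
intros HL H. rewrite Cmod_Cprod_qpow by lra. rewrite Cmod_Cexp, Re_scal.
apply exp_increasing. rewrite (Rmult_comm (Re logq)). now apply Rmult_lt_gt_compat_neg_l with (r := Re logq) in H; lra.
Qed.

(** * The q-difference equation *)
Lemma continuous_speed (logq : C) (u : R -> R) (t : R) : circuit u ->
  continuous (fun t => Ci - Derive u t * logq) t.
Proof.
intros [Hu _]. apply continuous_Cminus; [apply continuous_const|].
apply continuous_Cmult; [|apply continuous_const]. now apply continuous_RtoC, Hu.
Qed.

Lemma continuous_circuit (logq : C) (u : R -> R) (t : R) : circuit u ->
  continuous (fun t => logpt logq t (u t)) t.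
Proof.
intros [Hu _]. apply continuous_logpt; [apply continuous_id|].
now apply (ex_derive_continuous u), Hu.
Qed.

Lemma Phi_contour N logq u s : (1 <= N)%nat -> (Cmod (Cexp logq) < 1)%R -> circuit u ->
  admissible N logq u s ->
  let F := Phi N logq (fun j => qpow logq (s j)) in
  is_contour N logq u F (Contour N logq u F).
Proof.
intros HN Hq Hu [Hs Ho] F. set (a := fun j => qpow logq (s j)) in *.
assert (HRe := Re_logq_neg logq Hq).
assert (HF : forall w, F w = integrand N logq 1 a a w - integrand N logq (-1) a a w) by (intros; now apply Phi_integrand).
assert (Hex : exists l, is_contour N logq u F l).
{ assert (Hc : exists c0, is_CInt (fun t => F (logpt logq t (u t)) * (Ci - Derive u t * logq)) (- PI) PI c0).
  { eexists; apply is_CInt_continuous; [apply PI_le|]. intros t Ht. apply continuous_Cmult; [|now apply continuous_speed].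
    apply (continuous_comp (fun t => logpt logq t (u t)) F); [now apply continuous_circuit|].
    apply continuous_ext with (fun w => integrand N logq 1 a a w - integrand N logq (-1) a a w); [intros; now rewrite HF|].
    apply continuous_Cminus; apply holo_continuous, holo_integrand; auto; now apply (polar_product_circuit N logq u s). }
  destruct Hc as [c0 Hc]. destruct (Nat.odd N) eqn:Eo.
  - destruct (Ho eq_refl) as [Hsum Hoff].
    assert (HT : forall t b, t = PI \/ t = (- PI)%R ->
      exists l, is_tail (fun v => F (logpt logq t v) * (- logq)) b l).
    { intros t b Ht.
      assert (HD : forall v, polar_product N logq a a (logpt logq t v) <> 0).
      { intros v; apply polar_product_tail; auto. intros j Hj; split; intros v'; now apply Hoff. }
      destruct (integrand_decays N logq 1 a a t HN Hq HD) as [C1 D1]; [apply decay_condition; lra|].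
      destruct (integrand_decays N logq (-1) a a t HN Hq HD) as [C2 D2]; [apply decay_condition; lra|].
      destruct (decays_tail _ b C1 D1) as [l1 T1]. destruct (decays_tail _ b C2 D2) as [l2 T2].
      exists (- logq * (l1 - l2)).
      eapply is_tail_ext; [|apply is_tail_scal, is_tail_minus; [exact T1|exact T2]].
      intros v; cbv beta; rewrite HF; ring. }
    destruct (HT PI (u PI) (or_introl eq_refl)) as [tp Hp].
    destruct (HT (- PI)%R (u (- PI)%R) (or_intror eq_refl)) as [tm Hm].
    exists (c0 + (tp - tm)), c0, tp, tm. split; [exact Hc|]. split; [auto|]. rewrite Eo; reflexivity.
  - exists (c0 + 0), c0, 0, 0. split; [exact Hc|]. split; [rewrite Eo; discriminate|]. rewrite Eo; reflexivity. }
destruct Hex as [l Hl]. now rewrite (is_contour_unique _ _ _ _ _ Hl).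
Qed.

Lemma CInt_unit (f : R -> C) (a : R) : (forall v, continuous f v) ->
  CInt (fun s => f (a - 1 + s)%R) 0 1 = CInt f (a - 1) a.
Proof.
intros Hc.
pose proof (RInt_comp_lin (V := C_R_CompleteNormedModule) f 1 (a - 1) 0 1) as E.
replace (1 * 0 + (a - 1))%R with (a - 1)%R in E by ring.
replace (1 * 1 + (a - 1))%R with a in E by ring.
rewrite <- E by (eexists; now apply is_CInt_cont).
apply RInt_ext. intros v _. replace (1 * v + (a - 1))%R with (a - 1 + v)%R by ring.
symmetry; exact (scal_one (V := C_R_NormedModule) (f (a - 1 + v)%R)).
Qed.

Lemma logpt_sides logq v : logpt logq PI v = logpt logq (- PI) v + 2 * PI * Ci.
Proof. unfold logpt. rewrite RtoC_opp; ring. Qed.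

(** By Cauchy's theorem on the strip, the circuit contributes minus log q times the
    difference of the integrals of h across the strip at t = PI and t = - PI.  For N even
    these agree by periodicity; for N odd the two tails contribute the opposite,
    since each telescopes to the integral across the strip at its own end. *)
Lemma shift_contour N logq u s : (1 <= N)%nat -> (Cmod (Cexp logq) < 1)%R -> circuit u ->
  separates N logq u s ->
  (Nat.odd N = true ->
    (sum_n_m (fun j => rexp logq (s j)) 1 (2 * N) < 0)%R /\
    forall j, (1 <= j <= 2 * N)%nat -> off_tail logq (qpow logq (s j))) ->
  let al := fun j => qpow logq (s j) in
  let h := integrand N logq (INR N) al (fun j => Cexp logq * al j) in
  is_contour N logq u (fun w => h w - h (w + logq)) 0.
Proof.
intros HN Hq Hu Hs Ho al h. assert (HRe := Re_logq_neg logq Hq).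
assert (Hl : logq <> 0) by (intros E; rewrite E in HRe; simpl in HRe; lra).
set (g := fun t => CInt (fun s => h (logpt logq t (u t - 1 + s))) 0 1).
assert (Hc : is_CInt (fun t => (h (logpt logq t (u t)) - h (logpt logq t (u t) + logq))
    * (Ci - Derive u t * logq)) (- PI) PI (- logq * (g PI - g (- PI)%R))).
{ apply is_CInt_ext with (fun t => (h (logpt logq t (u t)) - h (logpt logq t (u t - 1)))
    * (Ci - Derive u t * logq)); [apply PI_le|intros t Ht; now rewrite logpt_shift|].
  apply cauchy_strip; [apply PI_le|exact Hl|apply Hu|].
  intros t x Ht Hx. apply holo_integrand; auto. apply (polar_product_strip N logq u s); auto. lra. }
destruct (Nat.odd N) eqn:Eo.
- destruct (Ho eq_refl) as [Hsum Hoff].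
  assert (HT : forall t, t = PI \/ t = (- PI)%R ->
    is_tail (fun v => (h (logpt logq t v) - h (logpt logq t v + logq)) * (- logq)) (u t)
      (- logq * - g t)).
  { intros t Ht.
    assert (HD : forall v, polar_product N logq al (fun j => Cexp logq * al j) (logpt logq t v) <> 0).
    { intros v; apply polar_product_tail; auto. intros j Hj; split; [now apply Hoff|].
      apply off_tail_mult; now apply Hoff. }
    destruct (integrand_decays N logq (INR N) al _ t HN Hq HD) as [C1 D1].
    { apply decay_condition; auto. now rewrite Rminus_diag. }
    unfold g. rewrite (CInt_unit (fun v => h (logpt logq t v))) by exact C1.
    eapply is_tail_ext; [|apply is_tail_scal, tail_difference; [exact C1|exact D1]].
    intros v; cbv beta. rewrite logpt_shift. unfold h; ring. }
  exists (- logq * (g PI - g (- PI)%R)), (- logq * - g PI), (- logq * - g (- PI)%R).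
  split; [exact Hc|]. split; [intros _; split; apply HT; auto|]. rewrite Eo; ring.
- exists (- logq * (g PI - g (- PI)%R)), 0, 0. split; [exact Hc|]. split; [rewrite Eo; discriminate|].
  rewrite Eo.
  assert (E : g PI = g (- PI)%R).
  { unfold g. destruct Hu as [_ Hu]. rewrite <- Hu. apply RInt_ext; intros x _.
    rewrite logpt_sides. apply integrand_period. rewrite <- Nat.negb_odd, Eo; reflexivity. }
  rewrite E; ring.
Qed.

Lemma rexp_minus_1 logq x : Re logq <> 0%R -> rexp logq (x - 1) = (rexp logq x - 1)%R.
Proof.
intros H; unfold rexp. replace ((x - 1) * logq) with (x * logq - logq) by ring.
destruct (x * logq), logq; unfold Re in *; simpl in *; field; auto.
Qed.

(** Lowering N - 1 exponents by 1 turns the convergence condition on the s_j into the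
    decay condition for beta = N. *)
Lemma sum_rexp_head logq s n m : Re logq <> 0%R ->
  sum_n_m (fun j => rexp logq (head_tail (S n) (fun j => s j - 1) s j)) 1 m =
  (sum_n_m (fun j => rexp logq (s j)) 1 m - INR (Nat.min m n))%R.
Proof.
intros H; induction m as [|m IH].
- rewrite !sum_n_m_zero by lia. change (zero : R) with 0%R. simpl; ring.
- rewrite !sum_n_Sm, IH by lia. unfold plus; simpl AbelianMonoid.sort.
  destruct (le_lt_dec (S m) n).
  + rewrite head_tail_lt, rexp_minus_1, !Nat.min_l by (auto; lia). rewrite S_INR.
    cbn. ring.
  + rewrite head_tail_ge by lia. rewrite !Nat.min_r by lia. cbn. ring.
Qed.

Lemma b_coef_eq n (q : C) (a : nat -> C) i : q <> 0 -> (forall j, a j <> 0) ->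
  let c := fun j => / q * a j in
  b_coef (S n) q a i =
  Cprod (seq (S n) (S n + 1)) (fun m => 1 - c i * a m)
  / ((1 - Cprod (seq 1 n) c * Cprod (seq (S n) (S n + 1)) a) * Cprod (indices_except n i) (fun j => 1 - c i * / c j)).
Proof.
intros Hq Ha c. unfold b_coef, others. change (filter _ _) with (indices_except (S n - 1) i).
replace (S n - 1)%nat with n by lia.
f_equal. f_equal.
- rewrite seq_split, Cprod_app. unfold c. rewrite Cprod_mult, Cprod_const, length_seq.
  rewrite Cpow_inv by auto. f_equal. ring.
- apply (f_equal (Cprod (indices_except n i))). apply functional_extensionality; intros j. unfold c.
  field. auto.
Qed.

(** Integrate [integrand_difference] over the contour: the left side gives 0 by
    [shift_contour], and the constant on the right is not 0.  The exponents [sg] of the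
    difference function are taken, one index at a time, from tuples that are
    admissible by hypothesis, so its poles are on the right sides of the contour. *)
Lemma contiguous_relation (n : nat) (logq : C) (u : R -> R) (s : nat -> C) :
  let N := S n in let q := Cexp logq in let a := fun j => qpow logq (s j) in
  (Cmod q < 1)%R -> circuit u ->
  (forall i j, (1 <= i <= n)%nat -> (1 <= j <= n)%nat -> i <> j -> a i <> a j) ->
  admissible N logq u s ->
  (forall i, (1 <= i <= n)%nat -> admissible N logq u (upd s i (s i - 1))) ->
  1 - / (q ^ n) * Cprod (seq 1 (2 * N)) a <> 0 ->
  IN N logq u a =
  sum_n_m (fun i => b_coef N q a i * IN N logq u (upd a i (/ q * a i))) 1 n.
Proof.
intros N q a Hq Hu Hd Ha Hai HB.
assert (HN : (1 <= N)%nat) by (unfold N; lia).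
assert (HRe := Re_logq_neg logq Hq).
assert (Hl : q <> 0) by apply Cexp_neq_0.
set (c := fun j => / q * a j).
set (B := 1 - Cprod (seq 1 n) c * Cprod (seq (S n) (S n + 1)) a).
(* B is the factor 1 - q^(1-N) a_1 ... a_2N of the coefficients b_i *)
assert (HB' : B <> 0).
{ intros E; apply HB. rewrite <- E. unfold B, N. rewrite seq_split, Cprod_app. unfold c.
  rewrite Cprod_mult, Cprod_const, length_seq, Cpow_inv by auto. ring. }
assert (Ec : forall x, qpow logq (x - 1) = / q * qpow logq x).
{ intros x. unfold q. rewrite <- qpow_1, <- qpow_opp, <- qpow_plus. f_equal; ring. }
assert (Eupd : forall i, upd a i (c i) = fun j => qpow logq (upd s i (s i - 1) j)).
{ intros i; apply functional_extensionality; intros j. unfold upd, c.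
  destruct (Nat.eqb j i); [now rewrite Ec|reflexivity]. }
set (sg := head_tail N (fun j => s j - 1) s).
assert (Eal : lowered_head n q a = fun j => qpow logq (sg j)).
{ apply functional_extensionality; intros j. unfold lowered_head, sg.
  destruct (le_lt_dec N j).
  - now rewrite !head_tail_ge.
  - rewrite !head_tail_lt by auto. now rewrite Ec. }
assert (Hsg : forall j, (1 <= j <= 2 * N)%nat ->
  exists s', admissible N logq u s' /\ s' j = sg j).
{ intros j Hj. unfold sg. destruct (le_lt_dec N j).
  - exists s; split; [exact Ha|now rewrite head_tail_ge].
  - exists (upd s j (s j - 1)). split; [apply Hai; unfold N in *; lia|].
    rewrite head_tail_lt by auto. unfold upd; now rewrite Nat.eqb_refl. }
assert (Ssg : separates N logq u sg).
{ intros j k t v Hj Ht. destruct (Hsg j Hj) as [s' [[Hs' _] Es']].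
  rewrite <- Es'. now apply (Hs' j k t v). }
assert (Osg : Nat.odd N = true ->
    (sum_n_m (fun j => rexp logq (sg j)) 1 (2 * N) < 0)%R /\
    forall j, (1 <= j <= 2 * N)%nat -> off_tail logq (qpow logq (sg j))).
{ intros Eo; split.
  - destruct Ha as [_ Ha]. destruct (Ha Eo) as [Hsum _]. unfold sg, N.
    rewrite sum_rexp_head by lra. rewrite Nat.min_r by lia. fold N. unfold N at 2 in Hsum. rewrite S_INR in Hsum. lra.
  - intros j Hj v. destruct (Hsg j Hj) as [s' [[_ Hs'] Es']]. rewrite <- Es'.
    now apply (Hs' Eo). }
assert (Oc : Nat.odd N = true -> forall i, (1 <= i <= n)%nat -> off_tail logq (c i)).
{ intros Eo i Hi. destruct (Osg Eo) as [_ H]. specialize (H i ltac:(unfold N; lia)).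
  unfold sg in H. rewrite head_tail_lt, Ec in H by (unfold N; lia). exact H. }
pose proof (shift_contour N logq u sg HN Hq Hu Ssg Osg) as Hshift. cbv zeta in Hshift.
rewrite <- Eal in Hshift. fold q in Hshift.
set (K := / Cprod (seq 1 n) (fun j => - c j) * B).
assert (Hcn : forall j, c j <> 0) by (intros j; change (/ q * qpow logq (s j) <> 0); rewrite <- Ec; apply Cexp_neq_0).
assert (HP : Cprod (seq 1 n) (fun j => - c j) <> 0).
{ apply Cprod_neq_0; intros j _ E'. apply (Hcn j).
  replace (c j) with (- - c j) by ring. rewrite E'; ring. }
set (F0 := Phi N logq a). set (Fi := fun i => Phi N logq (upd a i (c i))).
assert (C0 : is_contour N logq u F0 (Contour N logq u F0)) by now apply Phi_contour.
assert (CI : forall i, (1 <= i <= n)%nat -> is_contour N logq u (Fi i) (Contour N logq u (Fi i))).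
{ intros i Hi. unfold Fi. rewrite Eupd. apply Phi_contour; auto. }
assert (Hcomb : is_contour N logq u
  (fun w => K * (F0 w - sum_n_m (fun i => b_coef N q a i * Fi i w) 1 n))
  (K * (Contour N logq u F0 - sum_n_m (fun i => b_coef N q a i * Contour N logq u (Fi i)) 1 n))).
{ apply is_contour_scal, is_contour_minus; [exact C0|].
  apply (is_contour_sum N logq u (fun i w => b_coef N q a i * Fi i w)).
  intros i Hi. now apply is_contour_scal, CI. }
assert (Hpt : forall w, polar_product N logq a a w <> 0 ->
  polar_product N logq (lowered_head n q a) (fun j => q * lowered_head n q a j) w <> 0 ->
  polar_product N logq (lowered_head n q a) (fun j => q * lowered_head n q a j) (w + logq) <> 0 ->
  (forall i, (1 <= i <= n)%nat -> 1 - c i * Cexp w <> 0 /\ 1 - c i / Cexp w <> 0) ->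
  K * (F0 w - sum_n_m (fun i => b_coef N q a i * Fi i w) 1 n) =
  integrand N logq (INR N) (lowered_head n q a) (fun j => q * lowered_head n q a j) w -
  integrand N logq (INR N) (lowered_head n q a) (fun j => q * lowered_head n q a j) (w + logq)).
{ intros w H1 H2 H3 H4. symmetry. unfold K, F0, Fi.
  rewrite (Csum_ext _ (fun i => Cprod (seq (S n) (S n + 1)) (fun m => 1 - c i * a m)
        / (B * Cprod (indices_except n i) (fun j => 1 - c i * / c j)) * Phi (S n) logq (upd a i (c i)) w)).
  - apply integrand_difference; auto. intros j; apply Cexp_neq_0.
  - intros i Hi. apply (f_equal (fun x => x * _)).
    exact (b_coef_eq n q a i Hl (fun j => Cexp_neq_0 _)). }
assert (Hzero : is_contour N logq u
  (fun w => K * (F0 w - sum_n_m (fun i => b_coef N q a i * Fi i w) 1 n)) 0).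
{ revert Hshift; apply is_contour_ext.
  - intros t Ht. symmetry. apply Hpt.
    + apply (polar_product_circuit N logq u s); auto. apply Ha.
    + rewrite Eal. apply (polar_product_strip N logq u sg); auto; lra.
    + rewrite logpt_shift, Eal. apply (polar_product_strip N logq u sg); auto; lra.
    + intros i Hi. destruct (Hai i Hi) as [Hs' _].
      assert (Ei : c i = qpow logq (upd s i (s i - 1) i)).
      { unfold upd; rewrite Nat.eqb_refl, Ec; reflexivity. }
      rewrite Ei. split.
      * pose proof (separates_inside N logq u _ i 0 t (u t) Hs' ltac:(unfold N; lia) Ht ltac:(lra)) as H.
        now rewrite Cmult_1_r in H.
      * pose proof (separates_outside N logq u _ i 0 t (u t) Hs' ltac:(unfold N; lia) Ht ltac:(lra)) as H.
        now rewrite Cmult_1_r in H.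
  - intros Eo t v Ht. symmetry. destruct (Osg Eo) as [_ Hoff].
    assert (Hoff' : forall j, (1 <= j <= 2 * N)%nat -> off_tail logq (lowered_head n q a j) /\
      off_tail logq (q * lowered_head n q a j)).
    { intros j Hj. rewrite Eal. split; [now apply Hoff|]. now apply off_tail_mult, Hoff. }
    apply Hpt.
    + apply polar_product_tail; auto. destruct Ha as [_ Ha]. destruct (Ha Eo) as [_ H].
      intros j Hj; split; intros v'; now apply H.
    + now apply polar_product_tail.
    + rewrite logpt_shift. now apply polar_product_tail.
    + intros i Hi. destruct (off_tail_factor logq (c i) t v 0 Ht (Oc Eo i Hi)) as [H1 H2].
      now rewrite Cmult_1_r in H1, H2. }
assert (E0 : K * (Contour N logq u F0 - sum_n_m (fun i => b_coef N q a i * Contour N logq u (Fi i)) 1 n) = 0).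
{ rewrite <- (is_contour_unique _ _ _ _ _ Hzero). symmetry. now apply is_contour_unique. }
assert (HK : K <> 0).
{ unfold K. apply Cmult_neq_0; auto. intros E. apply (f_equal (Cmult (Cprod (seq 1 n) (fun j => - c j)))) in E.
  rewrite Cinv_r, Cmult_0_r in E by auto. apply (f_equal Re) in E; simpl in E; lra. }
assert (EC : Contour N logq u F0 = sum_n_m (fun i => b_coef N q a i * Contour N logq u (Fi i)) 1 n).
{ set (X := Contour N logq u F0) in *.
  set (Y := sum_n_m (fun i => b_coef N q a i * Contour N logq u (Fi i)) 1 n : C) in *.
  change (X = Y). replace X with (/ K * (K * (X - Y)) + Y) by (field; auto). rewrite E0; ring. }
change (IN N logq u a) with (Contour N logq u F0 / (2 * PI * Ci)).
rewrite EC. unfold Cdiv. rewrite Cmult_comm, Csum_scal. apply Csum_ext; intros i Hi.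
change (IN N logq u (upd a i (/ q * a i))) with (Contour N logq u (Fi i) * / (2 * PI * Ci)). ring.
Qed.

Theorem theorem3p2 (N : nat) (q logq : C) (u : R -> R) (s a : nat -> C)
  (hN : (2 <= N)%nat)
  (hlog : Cexp logq = q)
  (hq : (Cmod q < 1)%R)
  (hu : circuit u)
  (ha : forall j : nat, a j = qpow logq (s j))
  (hdist : forall i j : nat,
     (1 <= i <= N - 1)%nat -> (1 <= j <= N - 1)%nat -> i <> j -> a i <> a j) :
  ((admissible N logq u s /\
    (forall i : nat, (1 <= i <= N - 1)%nat ->
       admissible N logq u (upd s i (s i - 1))) /\
    1 - / (q ^ (N - 1)) * Cprod (seq 1 (2 * N)) a <> 0) ->
   IN N logq u a =
   sum_n_m (fun i : nat =>
     b_coef N q a i * IN N logq u (upd a i (/ q * a i))) 1 (N - 1))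
  /\
  (let sq := head_tail N (fun j => s j + 1) s in
   let aq := head_tail N (fun j => q * a j) a in
   (admissible N logq u sq /\
    (forall i : nat, (1 <= i <= N - 1)%nat ->
       admissible N logq u (upd sq i (s i))) /\
    1 - Cprod (seq 1 (2 * N)) a <> 0) ->
   IN N logq u aq =
   sum_n_m (fun i : nat =>
     c_coef N a i * IN N logq u (upd aq i (a i))) 1 (N - 1)).
Proof.
destruct N as [|n]; [lia|]. replace (S n - 1)%nat with n in * by lia. subst q.
assert (Ea : a = fun j => qpow logq (s j)) by now apply functional_extensionality.
set (q := Cexp logq) in *. assert (Hl : q <> 0) by apply Cexp_neq_0.
assert (Han : forall j, a j <> 0) by (intros j; rewrite ha; apply Cexp_neq_0).
split.
- intros [H1 [H2 H3]]. rewrite Ea in *. now apply contiguous_relation.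
- intros sq aq [H1 [H2 H3]].
  assert (Eaq : aq = fun j => qpow logq (sq j)).
  { apply functional_extensionality; intros j. unfold aq, sq. destruct (le_lt_dec (S n) j).
    - rewrite !head_tail_ge by auto. apply ha.
    - rewrite !head_tail_lt by auto. rewrite qpow_plus, qpow_1, ha. unfold q; ring. }
  assert (Elt : forall i, (1 <= i <= n)%nat -> aq i = q * a i) by (intros; apply head_tail_lt; lia).
  assert (Ege : forall i, (S n <= i)%nat -> aq i = a i) by (intros; now apply head_tail_ge).
  assert (EP : Cprod (seq 1 (2 * S n)) aq = q ^ n * Cprod (seq 1 (2 * S n)) a).
  { rewrite seq_split, !Cprod_app.
    rewrite (Cprod_ext (seq 1 n) aq (fun j => q * a j)) by (intros j Hj; apply in_seq in Hj; apply Elt; lia).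
    rewrite (Cprod_ext (seq (S n) (S n + 1)) aq a) by (intros j Hj; apply in_seq in Hj; apply Ege; lia).
    rewrite Cprod_mult, Cprod_const, length_seq; ring. }
  assert (Hqn : q ^ n <> 0) by now apply Cpow_nz.
  assert (EB : / (q ^ n) * Cprod (seq 1 (2 * S n)) aq = Cprod (seq 1 (2 * S n)) a)
    by (rewrite EP; field; auto).
  (* The second equation is the first one for the parameters aq. *)
  transitivity (sum_n_m (fun i => b_coef (S n) q aq i * IN (S n) logq u (upd aq i (/ q * aq i))) 1 n).
  + rewrite Eaq in *. apply contiguous_relation; auto.
    * intros i j Hi Hj Hij E. apply (hdist i j Hi Hj Hij).
      rewrite !Elt in E by auto.
      replace (a i) with (/ q * (q * a i)) by (field; auto). rewrite E; field; auto.
    * intros i Hi. replace (sq i - 1) with (s i); [now apply H2|].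
      unfold sq. rewrite head_tail_lt by lia. ring.
    * fold q. now rewrite EB.
  + apply Csum_ext; intros i Hi. rewrite Elt by auto.
    replace (/ q * (q * a i)) with (a i) by (field; auto). f_equal.
    unfold b_coef, c_coef. replace (S n - 1)%nat with n by lia. rewrite EB, Elt by auto.
    f_equal.
    * apply Cprod_ext; intros m Hm; apply in_seq in Hm. rewrite Ege by lia. field; auto.
    * f_equal. apply Cprod_ext; intros j Hj. unfold others in Hj.
      replace (S n - 1)%nat with n in Hj by lia. apply in_indices_except in Hj. rewrite Elt by lia. field; auto.
Qed.
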